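(* Let $F\in\mathbb{C}[x,y,z]$ be a homogeneous polynomial that defines a toric polar Cremona transformation. Then $F$ is equivalent to one of the following: (1) $(x+z)^a(y+z)^b$ for some integers $a,b\geq 1$; (2) $(x+z)^a\bigl((x+z)^d+yz^{d-1}\bigr)^b$ for some integers $a\geq 0$ and $b,d\geq 1$; (3) $\bigl(x^2+y^2+z^2-2(xy+xz+yz)\bigr)^d$ for some integer $d\geq 1$.
   Context: For a homogeneous (possibly Laurent) polynomial $F$ in $x,y,z$ over $\mathbb{C}$, write $F_x,F_y,F_z$ for its partial derivatives. The toric polar linear system of $F$ is $T(F)=\langle xF_x,\,yF_y,\,zF_z\rangle$ and the toric polar map is the rational map $\varphi_F:\mathbb{P}^2\dashrightarrow\mathbb{P}^2$, $[x:y:z]\mapsto[xF_x:yF_y:zF_z]$ (common factors may be removed). $F$ defines a toric polar Cremona transformation if $\varphi_F$ is birational. Equivalence: homogeneous Laurent polynomials $F,G\in\mathbb{C}[x^{\pm1},y^{\pm1},z^{\pm1}]$ are equivalent if $G$ is obtained from $F$ by a finite sequence of operations of the following types: (a) scaling of variables, $F(x,y,z)\mapsto F(\lambda x,\mu y,\nu z)$ with $\lambda,\mu,\nu\in\mathbb{C}^*$; (b) multiplication by a Laurent monomial $x^iy^jz^k$, $i,j,k\in\mathbb{Z}$; (c) an invertible monomial transformation $F(x,y,z)\mapsto F(t^\alpha,t^\beta,t^\gamma)$, where $\alpha,\beta,\gamma\in\mathbb{Z}^3$, $t^\alpha:=x^{\alpha_1}y^{\alpha_2}z^{\alpha_3}$,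 $|\alpha|:=\alpha_1+\alpha_2+\alpha_3$, and it is required that $|\alpha|=|\beta|=|\gamma|\neq 0$ and that $\alpha-\gamma,\beta-\gamma$ form a basis of the free abelian group $\{v\in\mathbb{Z}^3: |v|=0\}$. *)

(* Defs.v *)
(* MathComp, with multinomials for polynomials and real-closed for the field
   R[i] of complex numbers over R : realType. *)
From HB Require Import structures.
From Stdlib Require Import Relation_Operators.
From mathcomp Require Import all_boot all_order all_algebra.
From mathcomp Require Import reals complex freeg mpoly.

Set Implicit Arguments.
Unset Strict Implicit.
Unset Printing Implicit Defensive.

Import GRing.Theory.
Local Open Scope ring_scope.

Section RationalMaps.
Variable K : fieldType.

(* A triple f represents the rational map p |-> [f 0 p : f 1 p : f 2 p] of P^2;
   common factors of the components are allowed. *)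
Definition is_rmap (f : 3.-tuple {mpoly K[3]}) : Prop :=
  (exists d : nat, forall i, tnth f i \is d.-homog) /\ (exists i, tnth f i != 0).

Definition rmap_eq (f g : 3.-tuple {mpoly K[3]}) : Prop :=
  forall i j, tnth f i * tnth g j = tnth f j * tnth g i.

Definition rmap_id : 3.-tuple {mpoly K[3]} := [tuple 'X_i | i < 3].

Definition rmap_comp (g f : 3.-tuple {mpoly K[3]}) : 3.-tuple {mpoly K[3]} :=
  [tuple tnth g i \mPo f | i < 3].

(* f has a rational inverse g.  That the composites are again rational maps
   says that they are defined, i.e. that their components do not all vanish.
   This does not depend on common factors: f and g are then dominant, so a
   common factor of one never becomes zero after composing with the other. *)
Definition birational (f : 3.-tuple {mpoly K[3]}) : Prop :=
  is_rmap f /\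
  exists g : 3.-tuple {mpoly K[3]},
    [/\ is_rmap g,
        is_rmap (rmap_comp g f) /\ rmap_eq (rmap_comp g f) rmap_id &
        is_rmap (rmap_comp f g) /\ rmap_eq (rmap_comp f g) rmap_id].

Definition toric_polar_map (F : {mpoly K[3]}) : 3.-tuple {mpoly K[3]} :=
  [tuple 'X_i * F^`M(i) | i < 3].

Definition toric_polar_cremona (F : {mpoly K[3]}) : Prop :=
  birational (toric_polar_map F).

End RationalMaps.

Section Laurent.
Variable K : fieldType.

(* << c *g v >> is the term c x^(v 0 0) y^(v 0 1) z^(v 0 2). *)
Local Notation laurent := {freeg 'rV[int]_3 / K}.

Definition wt (v : 'rV[int]_3) : int := \sum_i v 0 i.

Definition laurent_homog (F : laurent) : Prop :=
  exists d : int, forall v, v \in dom F -> wt v = d.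

(* The functions below replace each monomial of F; fglift extends linearly. *)

(* F(l x, m y, n z) *)
Definition laurent_scale (l m n : K) (F : laurent) : laurent :=
  fglift (fun v : 'rV[int]_3 =>
    << l ^ v 0 0 * m ^ v 0 1 * n ^ v 0 2 *g v >> : laurent) F.

(* t^u F *)
Definition laurent_shift (u : 'rV[int]_3) (F : laurent) : laurent :=
  fglift (fun v : 'rV[int]_3 => << u + v >> : laurent) F.

(* F(t^al, t^be, t^ga) *)
Definition laurent_subst (al be ga : 'rV[int]_3) (F : laurent) : laurent :=
  fglift (fun v : 'rV[int]_3 =>
    << v 0 0 *: al + v 0 1 *: be + v 0 2 *: ga >> : laurent) F.

Definition invertible_monomial (al be ga : 'rV[int]_3) : Prop :=
  [/\ wt al = wt be, wt be = wt ga, wt ga != 0 &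
      forall v : 'rV[int]_3, wt v = 0 ->
        exists! c : int * int, v = c.1 *: (al - ga) + c.2 *: (be - ga)].

Inductive laurent_step (F : laurent) : laurent -> Prop :=
| StepScale (l m n : K) :
    l != 0 -> m != 0 -> n != 0 -> laurent_step F (laurent_scale l m n F)
| StepShift (u : 'rV[int]_3) :
    laurent_step F (laurent_shift u F)
| StepSubst (al be ga : 'rV[int]_3) :
    invertible_monomial al be ga -> laurent_step F (laurent_subst al be ga F).

Definition laurent_equiv (F G : laurent) : Prop :=
  [/\ laurent_homog F, laurent_homog G & clos_refl_trans _ laurent_step F G].

Definition laurent_of_mpoly (F : {mpoly K[3]}) : laurent :=
  \sum_(m <- msupp F) << F@_m *g \row_i (m i)%:Z >>.

Definition poly_equiv (F G : {mpoly K[3]}) : Prop :=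
  laurent_equiv (laurent_of_mpoly F) (laurent_of_mpoly G).

End Laurent.

(* Main.v *)
(* Write f(x, y) = F(x, y, 1), p = x f_x / f and q = y f_y / f.  The toric polar
   map is birational exactly when (x, y) |-> (p, q) is, and then its inverse has
   a Horn uniformisation: x, y and 1/f are constants times products of integer
   affine forms h in (p, q), each form h = a p + b q + c occurring in x, y and
   1/f with exponents a, b and c.  Indeed a common zero line of the inverse is
   seen, through the chain rule along a generic slice, to have an integral
   equation made of the multiplicities themselves.
   The Jacobian of (log x, log y) has no zero off the lines h = 0, so it is a
   monomial in the forms h.  Its behaviour at infinity along a class of parallel
   lines leaves only three configurations: two pairs of parallel lines, three
   pairs of parallel lines, or one class of parallel lines with two further
   lines.  In each of them f is computed in suitable monomial coordinates; these
   form a unimodular change of coordinates because (p, q) |-> (x, y) is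
   injective.  The three configurations give the forms (1), (3) and (2). *)
From Stdlib Require Import Classical Relation_Operators.
From mathcomp Require Import all_boot all_order all_algebra.
From mathcomp Require Import reals complex freeg mpoly.
From mathcomp Require Import ring lra zify.
Require Import Defs.

Set Implicit Arguments.
Unset Strict Implicit.
Unset Printing Implicit Defensive.

Import Order.TTheory GRing.Theory Num.Theory.
Local Open Scope ring_scope.

(** * Cofinite properties and algebraic limits *)

Section Cofinite.
Variable K : numFieldType.
Implicit Types (P Q : K -> Prop) (A B D : {poly K}) (g u : K -> K).

(** Why so few configurations survive. Comparing orders at infinity along one class of parallel
    lines shows that the Jacobian exponents of the lines outside the class sum to -2. Hence all
    classes have the same exponent sum [t], and [t] times the number of the other classes is -2. The
    same limit, as a function on the class, has simple poles on its lines, and the residues give [t]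
    <= -1; so there are two classes or three. The residues are not all zero because the constants
    [c] have a positive total, and this is where F being a polynomial enters: F is finite wherever x
    and y are, even where x F_x / F or y F_y / F has a pole. Three classes are then separated by the
    positions where the residue vanishes: only there can the Jacobian have a zero instead of a pole.
    All limits are taken along one parameter and are values at 0 of rational functions; generic
    means outside the roots of a nonzero polynomial. The argument is therefore algebraic and runs
    over any [numClosedFieldType]. *)

Definition cofin P := exists2 D : {poly K}, D != 0 & forall t, D.[t] != 0 -> P t.

Lemma poly_nonroot D : D != 0 -> exists t, D.[t] != 0.
Proof.
move=> D0; pose s := [seq i%:R : K | i <- iota 0 (size D)].
case: (boolP (all (root D) s)) => [allr|/allPn[t _ nr]]; last by exists t.
have us : uniq s by rewrite map_inj_uniq ?iota_uniq // => i j /eqP; rewrite eqr_nat => /eqP.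
by have := max_poly_roots D0 allr us; rewrite size_map size_iota ltnn.
Qed.

Lemma cofin_all P : (forall t, P t) -> cofin P.
Proof. by exists 1; rewrite ?oner_neq0. Qed.

Lemma cofin_sub P Q : (forall t, P t -> Q t) -> cofin P -> cofin Q.
Proof. by move=> PQ [D D0 DP]; exists D => // t /DP/PQ. Qed.

Lemma cofinI P Q : cofin P -> cofin Q -> cofin (fun t => P t /\ Q t).
Proof.
move=> [D D0 DP] [E E0 EQ]; exists (D * E); first by rewrite mulf_neq0.
by move=> t; rewrite hornerM mulf_eq0 => /norP[/DP ? /EQ ?].
Qed.

Lemma cofin_sub2 P Q (S : K -> Prop) :
  (forall t, P t -> Q t -> S t) -> cofin P -> cofin Q -> cofin S.
Proof. by move=> PQS cP cQ; apply: cofin_sub (cofinI cP cQ) => t [] /PQS; apply. Qed.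

Lemma cofin_ex P : cofin P -> exists t, P t.
Proof. by move=> [D D0 DP]; have [t /DP ?] := poly_nonroot D0; exists t. Qed.

Lemma cofin_poly D : D != 0 -> cofin (fun t => D.[t] != 0).
Proof. by exists D. Qed.

Lemma cofin_neq a : cofin (fun t => t != a).
Proof. by exists ('X - a%:P); rewrite ?polyXsubC_eq0 // => t; rewrite hornerXsubC subr_eq0. Qed.

Lemma cofin_affine a b : (a != 0) || (b != 0) -> cofin (fun t => a * t + b != 0).
Proof.
move=> ab; exists (a *: 'X + b%:P); last by move=> t; rewrite !hornerE.
apply: contraTneq ab => /polyP E; have := E 0%N; have := E 1%N.
by rewrite !(coefD, coefZ, coefX, coefC, coef0) /= !(mulr1, mulr0, addr0, add0r) => -> ->; rewrite eqxx.
Qed.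

Lemma cofin_forall (I : finType) (P : I -> K -> Prop) :
  (forall i, cofin (P i)) -> cofin (fun t => forall i, P i t).
Proof.
move=> cP; suff : cofin (fun t => forall i, i \in enum I -> P i t).
  by apply: cofin_sub => t h i; apply: h; rewrite mem_enum.
elim: (enum I) => [|i s IH]; first by apply: cofin_all.
apply: cofin_sub2 (cP i) IH => t Pi Ps j; rewrite inE => /predU1P[->//|]; exact: Ps.
Qed.

Lemma cofin_seq (T : eqType) (s : seq T) (P : T -> K -> Prop) :
  (forall i, i \in s -> cofin (P i)) -> cofin (fun t => forall i, i \in s -> P i t).
Proof.
elim: s => [|i s IH] cP; first by apply: cofin_all.
apply: cofin_sub2 (cP i (mem_head _ _)) (IH _) => [t Pi Ps j|j js].
  by rewrite inE => /predU1P[->//|]; exact: Ps.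
by apply: cP; rewrite inE js orbT.
Qed.

Lemma poly_cofin0 A : cofin (fun t => A.[t] = 0) -> A = 0.
Proof.
move=> [D D0 DA]; apply/eqP; rewrite -[_ == 0]negbK; apply/negP => A0.
have [t] := poly_nonroot (mulf_neq0 D0 A0).
by rewrite hornerM mulf_eq0 => /norP[/DA ->]; rewrite eqxx.
Qed.

Lemma poly_cofin_eq A B : cofin (fun t => A.[t] = B.[t]) -> A = B.
Proof.
move=> h; apply/eqP; rewrite -subr_eq0; apply/eqP/poly_cofin0.
by apply: cofin_sub h => t; rewrite !hornerE => ->; rewrite subrr.
Qed.

(* g agrees off a finite set with a rational function regular at 0, whose
   value there is v. *)
Definition lim0 g (v : K) := exists A B,
  [/\ B.[0] != 0, cofin (fun t => g t = A.[t] / B.[t]) & v = A.[0] / B.[0]].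

Lemma lim0_eq g u v : cofin (fun t => g t = u t) -> lim0 g v -> lim0 u v.
Proof.
move=> gu [A [B [B0 e ->]]]; exists A, B; split=> //.
by apply: cofin_sub2 gu e => t <-.
Qed.

Lemma lim0_unique g v w : lim0 g v -> lim0 g w -> v = w.
Proof.
move=> [A [B [B0 e ->]]] [A' [B' [B'0 e' ->]]].
have BN : B != 0 by apply: contraNneq B0 => ->; rewrite horner0.
have B'N : B' != 0 by apply: contraNneq B'0 => ->; rewrite horner0.
have /(congr1 (horner^~ 0)) /= : A * B' = A' * B.
  apply: poly_cofin_eq; apply: cofin_sub2 (cofinI (cofin_poly BN) (cofin_poly B'N)) (cofinI e e').
  move=> t [b b'] [-> ] /eqP; rewrite !hornerM eqr_div // => /eqP; done.
by rewrite !hornerM => h; apply/eqP; rewrite eqr_div // h.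
Qed.

Lemma lim0_horner A : lim0 (horner A) A.[0].
Proof.
exists A, 1; rewrite !hornerC oner_neq0 divr1; split=> //.
by apply: cofin_all => t; rewrite hornerC divr1.
Qed.

Lemma lim0_cst v : lim0 (fun=> v) v.
Proof.
have := lim0_horner v%:P; rewrite hornerC; apply: lim0_eq.
by apply: cofin_all => t; rewrite hornerC.
Qed.

Lemma lim0_id : lim0 id 0.
Proof.
have := lim0_horner 'X; rewrite hornerX; apply: lim0_eq.
by apply: cofin_all => t; rewrite hornerX.
Qed.

Let nz0 B : B.[0] != 0 -> cofin (fun t => B.[t] != 0).
Proof. by move=> B0; apply: cofin_poly; apply: contraNneq B0 => ->; rewrite horner0. Qed.

Lemma lim0D g u v w : lim0 g v -> lim0 u w -> lim0 (fun t => g t + u t) (v + w).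
Proof.
move=> [A [B [B0 e ->]]] [A' [B' [B'0 e' ->]]].
exists (A * B' + A' * B), (B * B'); rewrite hornerM mulf_neq0 //; split=> //.
  apply: cofin_sub2 (cofinI (nz0 B0) (nz0 B'0)) (cofinI e e') => t [b b'] [-> ->].
  by rewrite !(hornerM, hornerD); field; rewrite b b'.
by rewrite !(hornerM, hornerD); field; rewrite B0 B'0.
Qed.

Lemma lim0M g u v w : lim0 g v -> lim0 u w -> lim0 (fun t => g t * u t) (v * w).
Proof.
move=> [A [B [B0 e ->]]] [A' [B' [B'0 e' ->]]].
exists (A * A'), (B * B'); rewrite hornerM mulf_neq0 //; split=> //.
  apply: cofin_sub2 (cofinI (nz0 B0) (nz0 B'0)) (cofinI e e') => t [b b'] [-> ->].
  by rewrite !hornerM; field; rewrite b b'.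
by rewrite !hornerM; field; rewrite B0 B'0.
Qed.

Lemma lim0V g v : v != 0 -> lim0 g v -> lim0 (fun t => (g t)^-1) v^-1.
Proof.
move=> v0 [A [B [B0 e E]]].
have A0 : A.[0] != 0 by apply: contraNneq v0; rewrite E => ->; rewrite mul0r.
exists B, A; split=> //; last by rewrite E invf_div.
by apply: cofin_sub e => t ->; rewrite invf_div.
Qed.

Lemma lim0_nz g v : v != 0 -> lim0 g v -> cofin (fun t => g t != 0).
Proof.
move=> v0 [A [B [B0 e E]]].
have A0 : A.[0] != 0 by apply: contraNneq v0; rewrite E => ->; rewrite mul0r.
apply: cofin_sub2 (cofinI (nz0 A0) (nz0 B0)) e => t [a b] ->.
by rewrite mulf_neq0 ?invr_eq0.
Qed.

Lemma lim0X g v n : lim0 g v -> lim0 (fun t => g t ^+ n) (v ^+ n).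
Proof.
move=> gv; elim: n => [|n IH]; first exact: lim0_cst.
rewrite exprS; apply: lim0_eq (lim0M gv IH).
by apply: cofin_all => t; rewrite exprS.
Qed.

Lemma lim0Xz g v (z : int) : v != 0 -> lim0 g v -> lim0 (fun t => g t ^ z) (v ^ z).
Proof.
move=> v0 gv; case: z => n; first exact: lim0X.
by apply: lim0V; rewrite ?expf_neq0 //; exact: lim0X.
Qed.

Lemma lim0N g v : lim0 g v -> lim0 (fun t => - g t) (- v).
Proof.
move=> /(lim0M (lim0_cst (-1))); rewrite mulN1r; apply: lim0_eq.
by apply: cofin_all => t; rewrite mulN1r.
Qed.

Lemma lim0B g u v w : lim0 g v -> lim0 u w -> lim0 (fun t => g t - u t) (v - w).
Proof. by move=> gv /lim0N; apply: lim0D. Qed.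

Lemma lim0_div g u v w : w != 0 -> lim0 g v -> lim0 u w ->
  lim0 (fun t => g t / u t) (v / w).
Proof. by move=> w0 gv uw; apply: lim0M gv (lim0V w0 uw). Qed.

Lemma lim0_sum (I : Type) (r : seq I) (p : pred I) (g : I -> K -> K) (v : I -> K) :
  (forall i, p i -> lim0 (g i) (v i)) ->
  lim0 (fun t => \sum_(i <- r | p i) g i t) (\sum_(i <- r | p i) v i).
Proof.
move=> gv; elim: r => [|i r IH].
  rewrite big_nil; apply: lim0_eq (lim0_cst 0); apply: cofin_all => t; by rewrite big_nil.
rewrite big_cons; case: ifP => pi.
  by apply: lim0_eq (lim0D (gv i pi) IH); apply: cofin_all => t; rewrite big_cons pi.
by apply: lim0_eq IH; apply: cofin_all => t; rewrite big_cons pi.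
Qed.

Lemma lim0_prod (I : Type) (r : seq I) (p : pred I) (g : I -> K -> K) (v : I -> K) :
  (forall i, p i -> lim0 (g i) (v i)) ->
  lim0 (fun t => \prod_(i <- r | p i) g i t) (\prod_(i <- r | p i) v i).
Proof.
move=> gv; elim: r => [|i r IH].
  rewrite big_nil; apply: lim0_eq (lim0_cst 1); apply: cofin_all => t; by rewrite big_nil.
rewrite big_cons; case: ifP => pi.
  by apply: lim0_eq (lim0M (gv i pi) IH); apply: cofin_all => t; rewrite big_cons pi.
by apply: lim0_eq IH; apply: cofin_all => t; rewrite big_cons pi.
Qed.

Lemma lim0_affine a b : lim0 (fun t => a * t + b) b.
Proof.
have := lim0D (lim0M (lim0_cst a) lim0_id) (lim0_cst b).
by rewrite mulr0 add0r.
Qed.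

(** Since [u] has a nonzero limit, [z] is the order of [g] at 0. This is the tool that turns
    asymptotics of monomials in the lines into conditions on integer exponents. *)
Lemma lim0_order g u v w (z : int) : lim0 g v -> lim0 u w -> w != 0 ->
  cofin (fun t => g t = t ^ z * u t) ->
  [/\ 0 <= z, v != 0 -> z = 0 /\ v = w & v = 0 -> 0 < z].
Proof.
move=> gv uw w0 e; case: z e => [[|n]|n] e.
- have vw : v = w.
    by apply: lim0_unique gv (lim0_eq _ uw); apply: cofin_sub e => t ->; rewrite expr0z mul1r.
  by split=> // v0; move: w0; rewrite -vw v0 eqxx.
- have v0 : v = 0.
    have := lim0M (lim0X n.+1 lim0_id) uw; rewrite exprS !mul0r => h.
    by apply: lim0_unique gv (lim0_eq _ h); apply: cofin_sub e => t ->.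
  by split=> //; rewrite v0 eqxx.
- have := lim0M (lim0X n.+1 lim0_id) gv; rewrite exprS !mul0r => h.
  suff : w = 0 by move/eqP; rewrite (negPf w0).
  apply: lim0_unique uw (lim0_eq _ h).
  apply: cofin_sub2 e (cofin_neq 0) => t -> t0.
  by rewrite mulrA NegzE -exprnN mulfV ?mul1r // expf_neq0.
Qed.

End Cofinite.

(** * Bivariate polynomials vanishing only along finitely many graphs *)

Section LineFactor.
Variable K : numClosedFieldType.
Implicit Types (N : {poly {poly K}}).

Lemma horner_slice N p q : (map_poly (horner_eval q) N).[p] = N.[p%:P].[q].
Proof. by rewrite -{1}(hornerC p q) -[_.[q]]/(horner_eval q _) horner_map. Qed.

(** Roots [x i] are divided out by induction on the degree in the outer variable p. When none is
    left, a generic specialisation of q has no root in p, so over a closed field the degree in p is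
    0. *)
Lemma line_factor (I : finType) (x : I -> {poly K}) N (D : {poly K}) :
    N != 0 -> D != 0 ->
    (forall p q, D.[q] != 0 -> N.[p%:P].[q] = 0 -> exists i, p = (x i).[q]) ->
  exists (n0 : {poly K}) (e : I -> nat), N = n0%:P * \prod_i ('X - (x i)%:P) ^+ e i.
Proof.
move: {2}(size N) (leqnn (size N)) => n.
elim: n N => [|n IH] N sN N0 D0 zN; first by move: sN N0; rewrite leqn0 size_poly_eq0 => ->.
case: (boolP [exists i, root N (x i)]) => [/existsP[i /factor_theorem[M eM]]|noroot].
  have M0 : M != 0 by apply: contraNneq N0 => M0; rewrite eM M0 mul0r.
  have [|p q Dq Mq|n0 [e eN]] := IH M _ M0 D0.
  - by move: sN; rewrite eM size_Mmonic ?monicXsubC // size_XsubC addn2.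
  - by apply: zN Dq _; rewrite eM hornerM hornerM Mq mul0r.
  - exists n0, (fun j => e j + (j == i))%N; rewrite eM eN -mulrA; congr (_ * _).
    under [RHS]eq_bigr do rewrite exprD.
    rewrite big_split /=; congr (_ * _).
    rewrite (bigD1 i) //= eqxx expr1 big1 ?mulr1 // => j /negPf ->; by rewrite expr0.
exists (lead_coef N), (fun=> 0%N); rewrite big1 ?mulr1 => [|i _]; last by rewrite expr0.
(* A [q] off the roots of [E] preserves the degree of [N] and keeps [N] nonzero on every graph
   [x i]. *)
pose E := D * lead_coef N * \prod_i N.[x i].
have E0 : E != 0.
  rewrite !mulf_neq0 ?lead_coef_eq0 //; apply/prodf_neq0 => i _.
  by move: noroot; rewrite negb_exists => /forallP/(_ i).
have [q] := poly_nonroot E0.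
rewrite /E !hornerM !mulf_eq0 !negb_or => /andP[/andP[Dq Lq] Pq].
pose M := map_poly (horner_eval q) N.
have sM : size M = size N by rewrite size_map_poly_id0.
case: (eqVneq (size M) 1%N) => [|/closed_rootP[p /rootP]].
  by rewrite sM => sN1; rewrite {1}(size1_polyC (eq_leq sN1)) lead_coefE sN1.
rewrite horner_slice => Mp.
have [i pi] := zN p q Dq Mp; move: Pq; rewrite horner_prod => /prodf_neq0/(_ i isT).
have : (map_poly (horner_eval q) N).[(x i).[q]] = (N.[x i]).[q].
  by rewrite -[(x i).[q]]/(horner_eval q (x i)) horner_map.
by rewrite -pi horner_slice Mp => <-; rewrite eqxx.
Qed.

End LineFactor.

(** * Evaluation of polynomials along curves *)

Section MPolyEval.
Variables (n : nat) (R : comNzRingType).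
Implicit Types (p : {mpoly R[n]}).

Lemma mpoly_ring_ind (P : {mpoly R[n]} -> Prop) :
  (forall c, P c%:MP) -> (forall i, P 'X_i) ->
  (forall p q, P p -> P q -> P (p + q)) -> (forall p q, P p -> P q -> P (p * q)) ->
  forall p, P p.
Proof.
move=> PC PX PD PM p; rewrite [p]mpolyE.
apply: (big_ind P); [by rewrite -mpolyC0; apply: (PC)|exact: PD|move=> m _].
rewrite -mul_mpolyC; apply: (PM); first exact: PC.
rewrite mpolyXE_id.
apply: (big_ind P); [by rewrite -mpolyC1; apply: (PC)|exact: PM|move=> i _].
elim: (m i) => [|k IH]; first by rewrite expr0 -mpolyC1; apply: PC.
by rewrite exprS; apply: (PM).
Qed.

Lemma rmorph_mmap (S T : comNzRingType) (f : {rmorphism S -> T})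
    (c : R -> S) (h : 'I_n -> S) p :
  f (mmap c h p) = mmap (f \o c) (f \o h) p.
Proof.
rewrite /mmap rmorph_sum; apply: eq_bigr => m _.
by rewrite rmorphM /mmap1 rmorph_prod; congr (_ * _); apply: eq_bigr => i _; rewrite rmorphXn.
Qed.

Lemma eq_mmap (S : comNzRingType) (c c' : R -> S) (h h' : 'I_n -> S) p :
  c =1 c' -> h =1 h' -> mmap c h p = mmap c' h' p.
Proof.
move=> ec eh; apply: eq_bigr => m _; rewrite ec; congr (_ * _).
by apply: eq_bigr => i _; rewrite eh.
Qed.

Lemma mmap_homog (S : comNzRingType) (c : R -> S) (h : 'I_n -> S) (s : S) d p :
  p \is d.-homog -> mmap c (fun i => s * h i) p = s ^+ d * mmap c h p.
Proof.
move=> /dhomogP hp; rewrite /mmap mulr_sumr; apply: eq_big_seq => m /hp /= md.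
rewrite mulrCA; congr (_ * _); rewrite /mmap1; under eq_bigr do rewrite exprMn.
by rewrite big_split /= prodrXr -md mdegE.
Qed.

Lemma mulX_mderivX i m : 'X_i * ('X_[m])^`M(i) = (m i)%:R *: 'X_[m] :> {mpoly R[n]}.
Proof.
rewrite mderivX -scalerAr -mpolyXD; case: (posnP (m i)) => [->|mi]; first by rewrite !scale0r.
by rewrite mpoly.addmC submK // lep1mP -lt0n.
Qed.

Lemma euler_homog d p : p \is d.-homog -> \sum_i 'X_i * p^`M(i) = d%:R *: p.
Proof.
move=> /dhomogP hp.
have E i : 'X_i * p^`M(i) = \sum_(m <- msupp p) (m i)%:R *: (p@_m *: 'X_[m]).
  rewrite {1}[p]mpolyE linear_sum mulr_sumr /=; apply: eq_bigr => m _.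
  by rewrite linearZ /= -scalerAr mulX_mderivX scalerA mulrC -scalerA.
rewrite (eq_bigr _ (fun i _ => E i)) exchange_big {3}[p]mpolyE scaler_sumr /=.
by apply: eq_big_seq => m /hp /= <-; rewrite mdegE natr_sum scaler_suml.
Qed.

Lemma deriv_mmap (h : 'I_n -> {poly R}) p :
  (mmap polyC h p)^`() = \sum_i mmap polyC h p^`M(i) * (h i)^`().
Proof.
elim/mpoly_ring_ind: p => [c|i|p q IHp IHq|p q IHp IHq].
- by rewrite mmapC derivC big1 // => i _; rewrite mderivC mmap0 mul0r.
- rewrite mmapX mmap1U (bigD1 i) //= big1 => [|j ji]; rewrite mderivX mmapZ mmapX mnm1E.
    have -> : (U_(i) - U_(i) = 0)%MM by apply/mnmP => k; rewrite mnmBE mnm0E subnn.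
    by rewrite eqxx mmap11 !mul1r addr0.
  by rewrite eq_sym (negPf ji) mulr0n rmorph0 !mul0r.
- rewrite mmapD derivD IHp IHq -big_split; apply: eq_bigr => i _ /=.
  by rewrite mderivD mmapD mulrDl.
- rewrite rmorphM derivM IHp IHq mulr_suml mulr_sumr -big_split; apply: eq_bigr => i _ /=.
  by rewrite mderivM mmapD !rmorphM; ring.
Qed.

End MPolyEval.

(** * Residues of logarithmic derivatives *)

Section LogDerivative.
Variable K : numClosedFieldType.
Implicit Types (p : {poly K}).

Lemma poly_mup s p : p != 0 ->
  exists2 u : {poly K}, u.[s] != 0 & p = ('X - s%:P) ^+ mup s p * u.
Proof.
move=> p0; have [m [u]] := multiplicity_XsubC p s; rewrite p0 /= => us E.
exists u; first exact: us.
have u0 : u != 0 by apply: contraNneq us => ->; rewrite root0.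
suff -> : mup s p = m by rewrite mulrC.
by rewrite E mupM ?expf_neq0 ?polyXsubC_eq0 // mupNroot // mup_XsubCX eqxx.
Qed.

Lemma lim0_shift s p : lim0 (fun t => p.[s + t]) p.[s].
Proof.
have := lim0_horner (p \Po ('X + s%:P)).
rewrite horner_comp !hornerE; apply: lim0_eq; apply: cofin_all => t.
by rewrite horner_comp !hornerE addrC.
Qed.

(** Near [s] the polynomial is t^m u with u(s) nonzero; the factor t^m contributes m / t to the
    logarithmic derivative and u a regular term. *)
Lemma lim0_logderiv s p : p != 0 ->
  lim0 (fun t => t * (p^`().[s + t] / p.[s + t])) (mup s p)%:R.
Proof.
move=> p0; have [u us E] := poly_mup s p0; set m := mup s p in E *.
pose g t := m%:R + t * (u^`().[s + t] / u.[s + t]).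
have lu := lim0_shift s u.
have : lim0 g (m%:R + 0 * (u^`().[s] / u.[s])).
  exact: lim0D (lim0_cst _) (lim0M (lim0_id _) (lim0_div us (lim0_shift _ _) lu)).
rewrite mul0r addr0; apply: lim0_eq; rewrite /g.
apply: cofin_sub2 (cofin_neq 0) (lim0_nz us lu) => t t0 ut.
have -> : p^`().[s + t] = m%:R * t ^+ m.-1 * u.[s + t] + t ^+ m * u^`().[s + t].
  rewrite E derivM deriv_exp derivXsubC mul1r !(hornerD, hornerM, hornerMn, horner_exp).
  by rewrite !hornerE [s + t]addrC addrK mulr_natl.
have -> : p.[s + t] = t ^+ m * u.[s + t].
  by rewrite E hornerM horner_exp !hornerE [s + t]addrC addrK.
case: (m) => [|k] /=; first by rewrite !expr0 !mul0r !add0r !mul1r.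
rewrite exprS; field; by rewrite ut t0 expf_neq0.
Qed.

Lemma lim0_horner_infty p (m : nat) : (size p <= m.+1)%N ->
  lim0 (fun t => t ^+ m * p.[t^-1]) p`_m.
Proof.
move=> sp; pose L t := \sum_(i < m.+1) p`_i * t ^+ (m - i).
have : lim0 L (\sum_(i < m.+1) p`_i * 0 ^+ (m - i)).
  by apply: lim0_sum => i _; apply: lim0M (lim0_cst _) (lim0X _ (lim0_id _)).
rewrite big_ord_recr /= subnn expr0 mulr1 big1 ?add0r => [|i _]; last first.
  by rewrite expr0n subn_eq0 leqNgt ltn_ord mulr0.
apply: lim0_eq; apply: cofin_sub (cofin_neq 0) => t t0.
rewrite (horner_coef_wide _ sp) mulr_sumr; apply: eq_bigr => i _.
have -> : t ^+ m = t ^+ i * t ^+ (m - i) by rewrite -exprD subnKC // -ltnS.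
by rewrite exprVn; field; rewrite !expf_neq0.
Qed.

Lemma lim0_logderiv_infty p : p != 0 ->
  lim0 (fun t => t^-1 * (p^`().[t^-1] / p.[t^-1])) (size p).-1%:R.
Proof.
move=> p0; have sp : (0 < size p)%N by rewrite lt0n size_poly_eq0.
have lc0 : lead_coef p != 0 by rewrite lead_coef_eq0.
have l1 : lim0 _ (lead_coef p) := lim0_horner_infty (leqSpred (size p)).
have sd : (size ('X * p^`())%R <= (size p).-1.+1)%N.
  rewrite prednK // mulrC; case: (eqVneq p^`() 0) => [->|d0]; first by rewrite mul0r size_poly0.
  by rewrite size_mulX // lt_size_deriv.
have l2 := lim0_horner_infty sd.
have := lim0_div lc0 l2 l1.
have -> : ('X * p^`())`_(size p).-1 = (size p).-1%:R * lead_coef p.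
  rewrite coefXM lead_coefE; case: ((size p).-1) => [|k]; first by rewrite mul0r.
  by rewrite /= coef_deriv mulr_natl.
rewrite mulfK //; apply: lim0_eq.
apply: cofin_sub2 (cofin_neq 0) (lim0_nz lc0 l1) => t t0.
rewrite mulf_eq0 negb_or => /andP[tm pt].
rewrite hornerM hornerX; move: (p^`().[_]) (p.[_]) pt (t ^+ _) tm => u v v0 w w0.
by field; rewrite v0 t0 w0.
Qed.

Variables (phi : {poly K}) (g pi : 'I_3 -> {poly K}).
Hypotheses (phi0 : phi != 0) (g0 : forall i, g i != 0).
Hypothesis dlog : phi^`() * (\prod_i g i) =
  phi * \sum_i pi i * (g i)^`() * \prod_(j | j != i) g j.

Lemma dlog_horner t : phi.[t] != 0 -> (forall i, (g i).[t] != 0) ->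
  phi^`().[t] / phi.[t] = \sum_i (pi i).[t] * ((g i)^`().[t] / (g i).[t]).
Proof.
move=> ph gt; have G0 : \prod_i (g i).[t] != 0 by apply/prodf_neq0.
apply: (mulIf G0); rewrite mulrAC; apply: (mulIf ph); rewrite divfK //.
have := congr1 (horner^~ t) dlog; rewrite /= !hornerM !horner_prod => ->.
rewrite [RHS]mulrC; congr (_ * _); rewrite horner_sum mulr_suml; apply: eq_bigr => i _.
rewrite !hornerM horner_prod [X in _ = _ * X](bigD1 i) //=; have := gt i.
by move: (\prod_(j | _) _) => u ?; field.
Qed.

(** [dlog] is phi' / phi = sum of pi_i g_i' / g_i cleared of denominators; this compares the
    residues at [s], where the [pi i] are regular. *)
Lemma dlog_mup s : (mup s phi)%:R = \sum_i (pi i).[s] * (mup s (g i))%:R.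
Proof.
have l1 := lim0_logderiv s phi0.
have : lim0 (fun t => \sum_i (pi i).[s + t] * (t * ((g i)^`().[s + t] / (g i).[s + t])))
    (\sum_i (pi i).[s] * (mup s (g i))%:R).
  by apply: lim0_sum => i _; apply: lim0M (lim0_shift _ _) (lim0_logderiv _ (g0 i)).
apply: lim0_unique; apply: lim0_eq l1.
have sh p : p != 0 -> cofin (fun t => p.[s + t] != 0).
  move=> p0; have [u us E] := poly_mup s p0.
  apply: cofin_sub2 (cofin_neq 0) (lim0_nz us (lim0_shift s u)) => t t0 ut.
  by rewrite E hornerM horner_exp !hornerE [s + t]addrC addrK mulf_neq0 ?expf_neq0 // addrC.
apply: cofin_sub2 (sh _ phi0) (cofin_forall (fun i => sh _ (g0 i))) => t ph gt.
rewrite dlog_horner // mulr_sumr; apply: eq_bigr => i _; ring.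
Qed.

(** At infinity phi' / phi tends to 0, while pi_i grows like [sl i] t and g_i' / g_i decays like
    deg(g_i) / t. *)
Lemma dlog_degree (sl : 'I_3 -> K) : (forall i, exists c, pi i = sl i *: 'X + c%:P) ->
  \sum_i sl i * (size (g i)).-1%:R = 0.
Proof.
move=> affine.
have l1 := lim0M (lim0_id K) (lim0_logderiv_infty phi0); rewrite mul0r in l1.
have : lim0 (fun t => \sum_i (t * (pi i).[t^-1]) * (t^-1 * ((g i)^`().[t^-1] / (g i).[t^-1])))
    (\sum_i sl i * (size (g i)).-1%:R).
  apply: lim0_sum => i _; apply: lim0M (lim0_logderiv_infty (g0 i)).
  have [c ->] := affine i; apply: lim0_eq (lim0_affine c (sl i)).
  apply: cofin_sub (cofin_neq 0) => t t0; rewrite !hornerE; field; exact: t0.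
move=> l2; apply: lim0_unique l2 (lim0_eq _ l1).
have sh p : p != 0 -> cofin (fun t : K => p.[t^-1] != 0).
  rewrite -lead_coef_eq0 => p0.
  have := lim0_nz p0 (lim0_horner_infty (leqSpred (size p))).
  by apply: cofin_sub => t; rewrite mulf_eq0 => /norP[].
apply: cofin_sub2 (cofin_neq 0) (cofinI (sh _ phi0) (cofin_forall (fun i => sh _ (g0 i)))).
move=> t t0 [ph gt].
by rewrite dlog_horner // mulrA mulfV // mul1r; apply: eq_bigr => i _; field; rewrite ?gt ?t0.
Qed.

End LogDerivative.

Section Prelim.
Variable K : numClosedFieldType.

(** Squaring gives m^2 = - n^2. The number ['i] thus serves as a slope that no line with integral
    coefficients has. *)
Lemma imag_irrational (m n : int) : m%:~R + 'i * n%:~R = 0 :> K -> m = 0 /\ n = 0.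
Proof.
move=> h; have : (m * m + n * n)%:~R = 0 :> K.
  rewrite rmorphD !rmorphM /=; have -> : m%:~R = - ('i * n%:~R) :> K by apply/eqP; rewrite -addr_eq0 h.
  by rewrite mulrNN mulrACA -expr2 sqrCi; ring.
by move/eqP; rewrite intr_eq0 => /eqP; split; nia.
Qed.

(** Kronecker substitution x_i := X^(B^i), with [B] above every exponent, keeps distinct monomials
    distinct and reduces the claim to one variable. *)
Lemma mpoly_nonroot (p : {mpoly K[3]}) : p != 0 -> exists v, p.@[v] != 0.
Proof.
move=> p0; pose B := (msize p).+1.
pose e (m : 'X_{1..3}) := (m ord0 + B * (m (fintype.lift ord0 ord0) + B * m (fintype.lift ord0 (fintype.lift ord0 ord0))))%N.
have lt m i : m \in msupp p -> (m i < B)%N.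
  move=> /msize_mdeg_lt; rewrite mdegE (bigD1 i) //= => h.
  by rewrite /B ltnS; apply: leq_trans (ltnW h); apply: leq_addr.
have einj : {in msupp p &, injective e}.
  move=> m m' /lt hm /lt hm' E.
  have divB (a b a' b' : nat) : (a < B)%N -> (a' < B)%N ->
      (a + B * b = a' + B * b')%N -> a = a' /\ b = b'.
    move=> la la' E'; have B0 : (0 < B)%N by [].
    have := congr1 (modn^~ B) E'; have := congr1 (divn^~ B) E'.
    by rewrite !(mulnC B) ![(_ + _ * B)%N]addnC !divnMDl // !modnMDl !divn_small // !modn_small // !addn0 => -> ->.
  have [e0 E1] := divB _ _ _ _ (hm _) (hm' _) E.
  have [e1 e2] := divB _ _ _ _ (hm _) (hm' _) E1.
  apply/mnmP => i; case: i => [[|[|[|//]]] lti].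
  - by move: e0; congr (_ = _); congr (fun_of_multinom _ _); apply: val_inj.
  - by move: e1; congr (_ = _); congr (fun_of_multinom _ _); apply: val_inj.
  - by move: e2; congr (_ = _); congr (fun_of_multinom _ _); apply: val_inj.
pose h (i : 'I_3) : {poly K} := 'X^(B ^ i).
pose P := mmap polyC h p.
have hE m : mmap1 h m = 'X^(e m).
  rewrite /mmap1 !big_ord_recl big_ord0 mulr1 -!exprM -!exprD; congr ('X^_).
  rewrite /e /= expn0 expn1 mul1n.
  by rewrite /bump /=; ring.
have P0 : P != 0.
  have [m mp] : exists m, m \in msupp p.
    by exists (mlead p); apply: mlead_supp.
  suff : P`_(e m) = p@_m by apply: contra_eqN => /eqP ->; rewrite coef0 eq_sym mcoeff_eq0 mp.
  rewrite /P /mmap coef_sum (bigD1_seq m) //= big1_seq => [|m' /andP[m'm m'p]].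
    by rewrite hE coefCM coefXn eqxx mulr1 addr0.
  rewrite hE coefCM coefXn; case: eqP => [/einj E|]; last by rewrite mulr0.
  by rewrite E ?eqxx in m'm.
have [t] := poly_nonroot P0.
rewrite -[P.[t]]/(horner_eval t P) rmorph_mmap => Pt.
exists (fun i => (h i).[t]); move: Pt; rewrite /meval (@eq_mmap _ _ _ _ idfun _ (fun i => (h i).[t])) //.
by move=> c /=; rewrite /horner_eval hornerC.
Qed.

Lemma mup_proportional (p q : {poly K}) : p != 0 -> q != 0 ->
  (forall x, mup x p = mup x q) -> exists2 c, c != 0 & p = c *: q.
Proof.
elim: {p}(size p) {-2}p q (leqnn (size p)) => [|n IH] p q sp p0 q0 E.
  by move: sp p0; rewrite leqn0 size_poly_eq0 => ->.
case: (eqVneq (size p) 1%N) => [sp1|/closed_rootP[x px]].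
  case: (eqVneq (size q) 1%N) => [sq1|/closed_rootP[x qx]].
    have [a ea] := size_poly1P _ (introT eqP sp1).
    have [b eb] := size_poly1P _ (introT eqP sq1).
    move=> -> ->; exists (a / b); rewrite ?mulf_neq0 ?invr_eq0 //.
    by rewrite -mul_polyC -polyCM divfK.
  have := E x; rewrite (mupNroot (q := p)) => [/esym m0|].
    by move: qx; rewrite root_factor_theorem XsubC_dvd // m0.
  move: p0; rewrite (size1_polyC (eq_leq sp1)) polyC_eq0 => a0.
  by rewrite rootC.
have qx : root q x.
  by rewrite root_factor_theorem XsubC_dvd // -E -XsubC_dvd // -root_factor_theorem.
have [p' ep] := factor_theorem _ _ px; have [q' eq] := factor_theorem _ _ qx.
have p'0 : p' != 0 by apply: contraNneq p0 => z; rewrite ep z mul0r.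
have q'0 : q' != 0 by apply: contraNneq q0 => z; rewrite eq z mul0r.
have [||||c c0 e] := IH p' q' => //.
- by move: sp; rewrite ep size_Mmonic ?monicXsubC // size_XsubC addn2.
- by move=> y; have := E y; rewrite ep eq !mupM ?polyXsubC_eq0 // => /addIn.
- by exists c => //; rewrite ep eq e scalerAl.
Qed.

End Prelim.

Definition o0 : 'I_3 := Ordinal (isT : (0 < 3)%N).
Definition o1 : 'I_3 := Ordinal (isT : (1 < 3)%N).
Definition o2 : 'I_3 := Ordinal (isT : (2 < 3)%N).

Lemma ord3P (P : 'I_3 -> Prop) : P o0 -> P o1 -> P o2 -> forall i, P i.
Proof.
by move=> p0 p1 p2 [[|[|[|//]]] h]; [move: p0|move: p1|move: p2];
  congr (P _); apply: val_inj.
Qed.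

Lemma sum3 (V : nmodType) (f : 'I_3 -> V) : \sum_i f i = f o0 + f o1 + f o2.
Proof.
rewrite !big_ord_recl big_ord0 addr0 addrA.
by congr (f _ + f _ + f _); apply: val_inj.
Qed.

(** * The polar relation on an affine plane *)

Section Horn.
Variable K : numClosedFieldType.
Local Notation B := {poly {poly K}}.
Local Notation theta := ('i : K).

Lemma toric_homog d (F : {mpoly K[3]}) i : F \is d.-homog -> 'X_i * F^`M(i) \is d.-homog.
Proof.
move=> /dhomogP hF; rewrite {1}[F]mpolyE linear_sum mulr_sumr /=.
rewrite big_seq; apply: rpred_sum => m mF; rewrite linearZ /= -scalerAr mulX_mderivX.
by rewrite !rpredZ // dhomogX /= (hF m mF).
Qed.

Variables (d : nat) (F : {mpoly K[3]}).
Hypothesis hF : F \is d.-homog.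
Let TF i := 'X_i * F^`M(i).

(* Affine coordinates (p, q) on the plane P_0 + P_1 + P_2 = d, skewed by the
   irrational theta so that no line with integral coefficients a P_0 + b P_1 + c = 0
   is of the form q = const. *)
Definition slp (i : 'I_3) : K := [:: 1; theta; - 1 - theta]`_i.
Definition slq (i : 'I_3) : K := [:: 0; 1; - 1]`_i.
Definition cst (i : 'I_3) : K := [:: 0; 0; d%:R]`_i.
Definition PB (i : 'I_3) : B :=
  (slp i)%:P *: 'X + (slq i *: 'X + (cst i)%:P)%:P.

Local Notation cB := (polyC \o polyC : K -> B).
Local Notation evB G := (mmap cB G).

(** The toric polar map sends the triple [G] to the point [PB]; as the [PB i] sum to d, Euler's
    identity makes F(G) the common factor. *)
Definition Rel (G : 'I_3 -> B) := forall i, evB G (TF i) = PB i * evB G F.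

(** Both sides are homogeneous of degree d in [G], so common factors cancel. Having [s] and [t] on
    the two sides allows factors to be removed without division. *)
Lemma rel_scale (s t : B) (G G' : 'I_3 -> B) : s != 0 -> t != 0 ->
  (forall i, s * G i = t * G' i) -> Rel G ->
  Rel G' /\ s ^+ d * evB G F = t ^+ d * evB G' F.
Proof.
move=> s0 t0 E RG.
have H p : p \is d.-homog -> s ^+ d * evB G p = t ^+ d * evB G' p.
  by move=> hp; rewrite -!mmap_homog //; apply: eq_mmap => // i; rewrite E.
split=> [i|]; last exact: H.
apply: (mulfI (expf_neq0 d t0)).
by rewrite -H ?toric_homog // RG mulrCA [RHS]mulrCA H.
Qed.

Section Slice.
Variables (f : {rmorphism B -> {poly K}}) (G : 'I_3 -> B).
Hypotheses (fC : forall c, f (cB c) = c%:P) (RG : Rel G).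
Hypotheses (G0 : forall i, f (G i) != 0) (F0 : f (evB G F) != 0).

(** The chain rule for F(G) along the slice, with each G_i F_i(G) replaced by its value from the
    polar relation. *)
Lemma slice_dlog : (f (evB G F))^`() * (\prod_i f (G i)) =
  f (evB G F) * \sum_i f (PB i) * (f (G i))^`() * \prod_(j | j != i) f (G j).
Proof.
have ev p : f (evB G p) = mmap polyC (f \o G) p.
  by rewrite rmorph_mmap; apply: eq_mmap.
rewrite {1}ev deriv_mmap mulr_suml mulr_sumr; apply: eq_bigr => i _.
rewrite (bigD1 i) //=.
have := congr1 f (RG i); rewrite /TF !rmorphM /= mmapX mmap1U => R.
rewrite -!ev; transitivity (f (G i) * f (evB G F^`M(i)) * ((f (G i))^`() * \prod_(j | j != i) f (G j))).
  by ring.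
by rewrite R; ring.
Qed.

Lemma slice_mup s : (mup s (f (evB G F)))%:R = \sum_i (f (PB i)).[s] * (mup s (f (G i)))%:R.
Proof. exact: dlog_mup F0 G0 slice_dlog s. Qed.

Lemma slice_degree (sl : 'I_3 -> K) : (forall i, exists c, f (PB i) = sl i *: 'X + c%:P) ->
  \sum_i sl i * (size (f (G i))).-1%:R = 0.
Proof. exact: dlog_degree F0 G0 slice_dlog sl. Qed.
End Slice.

Definition hs (q : K) : {rmorphism B -> {poly K}} := map_poly (horner_eval q).
Definition vs (p : K) : {rmorphism B -> {poly K}} := horner_eval p%:P.

Lemma hsC q c : hs q (cB c) = c%:P.
Proof. by rewrite /= map_polyC /= /horner_eval hornerC. Qed.

Lemma vsC p c : vs p (cB c) = c%:P.
Proof. by rewrite /= /horner_eval hornerC. Qed.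

Lemma hs_PB q i : hs q (PB i) = slp i *: 'X + (slq i * q + cst i)%:P.
Proof.
rewrite /= /PB rmorphD /= map_polyZ map_polyX map_polyC /= /horner_eval.
by rewrite !hornerE.
Qed.

Lemma vs_PB p i : vs p (PB i) = slq i *: 'X + (slp i * p + cst i)%:P.
Proof.
rewrite /= /PB /horner_eval hornerD hornerZ hornerX hornerC -polyCM addrC -addrA -polyCD.
by congr (_ + _%:P); rewrite addrC.
Qed.

(** The slopes are 1, theta and -1 - theta, and 1 and theta are independent over the integers. *)
Lemma slp_sum (m : 'I_3 -> int) : \sum_i slp i * (m i)%:~R = 0 ->
  m o0 = m o2 /\ m o1 = m o2.
Proof.
rewrite sum3 /slp /= => E.
have : (m o0 - m o2)%:~R + theta * (m o1 - m o2)%:~R = 0.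
  by rewrite !rmorphB /= -[RHS]E; ring.
by move/imag_irrational => [/subr0_eq ? /subr0_eq].
Qed.

End Horn.

(** * Horn uniformisation *)

Section HornInit.
Variable K : numClosedFieldType.
Local Notation B := {poly {poly K}}.
Local Notation cB := (polyC \o polyC : K -> B).
Local Notation evB G := (mmap cB G).
Variables (d : nat) (F : {mpoly K[3]}).
Hypothesis hF : F \is d.-homog.

Lemma PB_at (v : 'I_3 -> K) : v o0 + v o1 + v o2 = d%:R -> forall i,
  (PB K d i).[(v o0)%:P].[v o1 - 'i * v o0] = v i.
Proof.
by move=> sv; elim/ord3P; rewrite /PB /slp /slq /cst !hornerE /= -?sv; ring.
Qed.

Lemma PB_sum : PB K d o0 + PB K d o1 + PB K d o2 = d%:R.
Proof.
transitivity ((slp K o0 + slp K o1 + slp K o2)%:P *: 'X +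
    ((slq K o0 + slq K o1 + slq K o2) *: 'X + (cst K d o0 + cst K d o1 + cst K d o2)%:P)%:P).
  by rewrite /PB !(polyCD, scalerDl); ring.
have -> : slp K o0 + slp K o1 + slp K o2 = 0 by rewrite /slp /=; ring.
have -> : slq K o0 + slq K o1 + slq K o2 = 0 by rewrite /slq /=; ring.
by rewrite /cst /= !scale0r !add0r !polyC_natr.
Qed.

(** [G] is the inverse map restricted to the plane P_0 + P_1 + P_2 = d. The composite equals the
    identity only up to a factor, which Euler's identity computes as F(G). *)
Lemma horn_init : toric_polar_cremona F -> exists G : 'I_3 -> B,
  [/\ forall i, G i != 0, evB G F != 0, Rel d F G & (0 < d)%N].
Proof.
move=> [_ [g [[[e ge] _] _ [[[D AD] [i0 Ai0]] Aeq]]]].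
pose A i := tnth (rmap_comp (toric_polar_map F) g) i.
have AE i : A i = tnth g i * (F^`M(i) \mPo g).
  by rewrite /A !tnth_mktuple rmorphM /= comp_mpolyXU -tnth_nth.
have Aeq' i j : A i * 'X_j = A j * 'X_i by have := Aeq i j; rewrite -!/(A _) !(tnth_mktuple (fun i => 'X_i)).
have X0 i : 'X_i != 0 :> {mpoly K[3]}.
  apply/eqP => /(congr1 (mcoeff U_(i))); rewrite mcoeffXU eqxx mcoeff0.
  by move/eqP; rewrite oner_eq0.
have A0 j : A j != 0.
  have := mulf_neq0 Ai0 (X0 j); rewrite -/(A i0) Aeq'; apply: contraNneq => ->.
  by rewrite mul0r.
pose S : {mpoly K[3]} := 'X_o0 + 'X_o1 + 'X_o2.
have S0 : S != 0.
  have : S@_U_(o0) != 0 by rewrite !mcoeffD !mcoeffXU /= !addr0 oner_neq0.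
  by apply: contraNneq => ->; rewrite mcoeff0.
have sumA : A o0 + A o1 + A o2 = d%:R * (F \mPo g).
  have := congr1 (comp_mpoly g) (euler_homog hF).
  rewrite sum3 !rmorphD !rmorphM /= !comp_mpolyXU -!tnth_nth !AE => ->.
  by rewrite comp_mpolyZ scaler_nat mulr_natl.
(* For d = 0 Euler's identity makes the components of the composite sum to 0, although they are
   proportional to the variables. *)
have d0 : (0 < d)%N.
  rewrite lt0n; apply/eqP => dz; move: sumA; rewrite dz mul0r => sA.
  have : A o0 * S = 0.
    by rewrite /S !mulrDr (Aeq' o0 o1) (Aeq' o0 o2) -!mulrDl sA mul0r.
  by move/eqP; rewrite mulf_eq0 (negPf (A0 o0)) (negPf S0).
have [v] := mpoly_nonroot (mulf_neq0 (mulf_neq0 (mulf_neq0 (A0 o0) (A0 o1)) (A0 o2)) S0).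
rewrite !mevalM !mulf_eq0 !negb_or -!andbA => /and4P[Av0 Av1 Av2 Sv].
(* Scaling by [t] moves the point onto the plane P_0 + P_1 + P_2 = d, which shows that restriction
   to this plane does not kill the [A i]. *)
pose t := d%:R / S.@[v]; pose w i := t * v i.
have dK : d%:R != 0 :> K by rewrite pnatr_eq0 -lt0n.
have t0 : t != 0 by rewrite mulf_neq0 ?invr_eq0.
have Aw : forall i, (A i).@[w] != 0.
  move=> i; have -> : (A i).@[w] = t ^+ D * (A i).@[v] := mmap_homog idfun v t (AD i).
  rewrite mulf_neq0 ?expf_neq0 //.
  by move: i; elim/ord3P.
have sw : w o0 + w o1 + w o2 = d%:R.
  rewrite /w -!mulrDr /t; have -> : v o0 + v o1 + v o2 = S.@[v].
    by rewrite !mevalD !mevalXU.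
  by rewrite divfK.
pose ev (N : B) := N.[(w o0)%:P].[w o1 - 'i * w o0].
pose G i := evB (PB K d) (tnth g i).
have evG p : evB (PB K d) (p \mPo g) = evB G p.
  rewrite /comp_mpoly rmorph_mmap; apply: eq_mmap => // c /=.
  by rewrite mmapC.
have AEG i : evB (PB K d) (A i) = evB G ('X_i * F^`M(i)).
  by rewrite AE !rmorphM /= evG mmapX mmap1U.
have A0G i : evB (PB K d) (A i) != 0.
  have : ev (evB (PB K d) (A i)) = (A i).@[w].
    rewrite /ev -[X in X.[_]]/(horner_eval (w o0)%:P _) rmorph_mmap.
    rewrite -[LHS]/(horner_eval (w o1 - 'i * w o0) _) rmorph_mmap /meval; apply: eq_mmap => j /=.
      by rewrite /horner_eval !hornerC.
    by rewrite /horner_eval PB_at.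
  by move=> E; apply: contraNneq (Aw i) => z; rewrite -E z /ev !horner0.
have AeqG i j : evB (PB K d) (A i) * PB K d j = evB (PB K d) (A j) * PB K d i.
  by have := congr1 (evB (PB K d)) (Aeq' i j); rewrite !rmorphM /= !mmapX !mmap1U.
have dB : d%:R != 0 :> B by rewrite -!polyC_natr !polyC_eq0.
have R : Rel d F G.
  move=> i; rewrite -AEG; apply: (mulIf dB).
  have E : evB (PB K d) (A i) * (PB K d o0 + PB K d o1 + PB K d o2) =
      PB K d i * evB (PB K d) (A o0 + A o1 + A o2).
    have comb (x x0 x1 x2 y y0 y1 y2 : B) : x * y0 = x0 * y -> x * y1 = x1 * y ->
      x * y2 = x2 * y -> x * (y0 + y1 + y2) = y * (x0 + x1 + x2) 
      by move=> h0 h1 h2; rewrite !mulrDr h0 h1 h2; ring.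
    by rewrite !mmapD; exact: comb (AeqG i o0) (AeqG i o1) (AeqG i o2).
  by rewrite PB_sum sumA rmorphM /= rmorph_nat evG in E; rewrite E mulrCA mulrC.
exists G; split=> // [i|].
  by have := A0G i; rewrite AE rmorphM mulf_eq0 negb_or => /andP[].
by have := A0G o0; rewrite AEG R mulf_eq0 negb_or => /andP[].
Qed.

End HornInit.

Section HornLines.
Variable K : numClosedFieldType.
Local Notation B := {poly {poly K}}.
Local Notation cB := (polyC \o polyC : K -> B).
Local Notation evB G p := (mmap cB G p : B).
Variables (d : nat) (F : {mpoly K[3]}).
Hypothesis hF : F \is d.-homog.

(** Bezout over the field of rational functions in q, cleared of denominators; this is why [c] and
    [r] are polynomials in q alone. *)
Lemma gcd3 (x y z : B) : x != 0 -> exists (h u0 u1 u2 x' y' z' : B) (c r : {poly K}),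
  [/\ h != 0, c != 0, r != 0 & [/\ c *: x = h * x', c *: y = h * y', c *: z = h * z' &
    u0 * x' + u1 * y' + u2 * z' = r%:P]].
Proof.
move=> x0; pose g := gcdp y z; pose h := gcdp x g.
have h0 : h != 0 by rewrite gcdp_eq0 negb_and x0.
have [v /eqpP[[c1 c2] /= /andP[c10 c20] ev]] := Pdiv.CommonIdomain.Bezoutp y z.
have [w /eqpP[[c3 c4] /= /andP[c30 c40] ew]] := Pdiv.CommonIdomain.Bezoutp x g.
have [[cx qx] /= cx0 ex] := Pdiv.WeakIdomain.dvdpP _ _ (dvdp_gcdl x g).
have hg : h %| g := dvdp_gcdr x g.
have [[cy qy] /= cy0 ey] := Pdiv.WeakIdomain.dvdpP _ _ (dvdp_trans hg (dvdp_gcdl y z)).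
have [[cz qz] /= cz0 ez] := Pdiv.WeakIdomain.dvdpP _ _ (dvdp_trans hg (dvdp_gcdr y z)).
rewrite -/g -/h in ev ew ex ey ez.
pose c := cx * cy * cz.
exists h, ((c2 * c3) *: w.1), ((c1 * c3) *: (w.2 * v.1)), ((c1 * c3) *: (w.2 * v.2)),
  ((cy * cz) *: qx), ((cx * cz) *: qy), ((cx * cy) *: qz), c, (c2 * c4 * c).
have E1 : c *: x = h * ((cy * cz) *: qx).
  by rewrite -scalerAr [h * _]mulrC -ex scalerA; congr (_ *: _); rewrite /c; ring.
have E2 : c *: y = h * ((cx * cz) *: qy).
  by rewrite -scalerAr [h * _]mulrC -ey scalerA; congr (_ *: _); rewrite /c; ring.
have E3 : c *: z = h * ((cx * cy) *: qz).
  by rewrite -scalerAr [h * _]mulrC -ez scalerA; congr (_ *: _); rewrite /c; ring.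
split; rewrite ?mulf_neq0 //; split=> //.
apply: (mulfI h0); rewrite !mulrDr ![h * (_ * _)]mulrCA -E1 -E2 -E3.
transitivity (c%:P * ((c2 *: (c3 *: (w.1 * x)) + c3 *: (w.2 * (c1 *: (v.1 * y + v.2 * z)))))).
  by rewrite -!mul_polyC !polyCM; ring.
have -> : c2 *: (c3 *: (w.1 * x)) + c3 *: (w.2 * (c1 *: (v.1 * y + v.2 * z))) =
   c2 *: (c3 *: (w.1 * x + w.2 * g)).
  by rewrite ev -!mul_polyC; ring.
by rewrite ew -!mul_polyC !polyCM; ring.
Qed.

Lemma horn_coprime (G : 'I_3 -> B) :
    (forall i, G i != 0) -> evB G F != 0 -> Rel d F G ->
  exists (G' u : 'I_3 -> B) (r : {poly K}), [/\ forall i, G' i != 0, evB G' F != 0,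
    Rel d F G', r != 0 & \sum_i u i * G' i = r%:P].
Proof.
move=> G0 F0 RG.
have [h [u0 [u1 [u2 [x [y [z [c [r [h0 c0 r0 [ex ey ez eu]]]]]]]]]]] :=
  gcd3 (G o1) (G o2) (G0 o0).
pose G' (i : 'I_3) := [:: x; y; z]`_i.
have E i : c%:P * G i = h * G' i.
  by move: i; elim/ord3P; rewrite mul_polyC.
have cP0 : c%:P != 0 by rewrite polyC_eq0.
have [RG' EF] := rel_scale hF cP0 h0 E RG.
exists G', (fun i => [:: u0; u1; u2]`_i), r; split=> // [i||].
- by have := mulf_neq0 cP0 (G0 i); rewrite E mulf_eq0 => /norP[].
- by have := mulf_neq0 (expf_neq0 d cP0) F0; rewrite EF mulf_eq0 => /norP[].
- by rewrite sum3.
Qed.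

Lemma mup_size (s : K) (p : {poly K}) : p != 0 -> (mup s p < size p)%N.
Proof.
move=> p0; have : ('X - s%:P) ^+ mup s p %| p by rewrite -mup_geq.
by move=> /(dvdp_leq p0); rewrite size_exp_XsubC.
Qed.

Section Locus.
Variables (G u : 'I_3 -> B) (r : {poly K}).
Hypotheses (G0 : forall i, G i != 0) (F0 : evB G F != 0) (RG : Rel d F G).
Hypotheses (r0 : r != 0) (bez : \sum_i u i * G i = r%:P).

(** On a slice with q fixed, the residues at a zero equate the multiplicity of F(G) with the sum of
    P_i times that of [G i]. The multiplicities of the [G i] are not all equal, since one of them
    vanishes by coprimality and not all do, so the equation gives p as an affine function of q.
    Being bounded by degrees, they yield finitely many lines. *)
Lemma horn_locus : exists (I : finType) (x : I -> {poly K}) (D : {poly K}),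
  [/\ injective x, D != 0 & forall M : B, (M = evB G F \/ exists i, M = G i) ->
   forall p q, D.[q] != 0 -> M.[p%:P].[q] = 0 -> exists l, p = (x l).[q]].
Proof.
pose Phi := evB G F.
pose m := maxn (size Phi) (\max_i size (G i)).
(* Indices are candidate multiplicities of the [G i] and of F(G), and [x0] solves the residue
   equation for p. Candidates with denominator 0 only add harmless lines. *)
pose I0 := ({ffun 'I_3 -> 'I_m.+1} * 'I_m.+1)%type.
pose x0 (f : I0) : {poly K} := (\sum_i slp K i * (f.1 i)%:R)^-1 *:
  ((f.2)%:R%:P - \sum_i (f.1 i)%:R *: (slq K i *: 'X + (cst K d i)%:P)).
exists (seq_sub (codom x0)), val, (r * lead_coef Phi * \prod_i lead_coef (G i)).
split; first exact: val_inj.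
  by rewrite !mulf_neq0 ?lead_coef_eq0 //; apply/prodf_neq0 => i _; rewrite lead_coef_eq0.
move=> M hM p q; rewrite !hornerM horner_prod !mulf_eq0 !negb_or -andbA => /and3P[rq Lq /prodf_neq0 Gq] Mpq.
have hs0 (L : B) : (lead_coef L).[q] != 0 -> hs q L != 0.
  by move=> Ll; rewrite -lead_coef_eq0 /= lead_coef_map_eq.
have hG i : hs q (G i) != 0 by apply/hs0/Gq.
have hPhi : hs q Phi != 0 by apply: hs0.
have := slice_mup (hsC q) RG hG hPhi p.
rewrite -/Phi; set mP := mup p _; pose mG i := mup p (hs q (G i)); rewrite -/(mG _).
under eq_bigr do rewrite hs_PB !hornerE -/(mG _).
move=> emu.
have bound (L : B) : hs q L != 0 -> (size L <= m)%N -> (mup p (hs q L) < m.+1)%N.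
  move=> L0 sL; rewrite ltnS ltnW // (leq_trans (mup_size p L0)) //.
  by apply: leq_trans (size_poly _ _) sL.
have bG i : (mG i < m.+1)%N.
  by apply: bound => //; rewrite leq_max (leq_bigmax (F := fun i => size (G i))) orbT.
have bP : (mP < m.+1)%N by apply: bound => //; rewrite leq_max leqnn.
pose f : I0 := ([ffun i => Ordinal (bG i)], Ordinal bP).
have hx0 : x0 f \in codom x0 by apply: codom_f.
exists (SeqSub hx0) => /=.
have hM0 : hs q M != 0 by case: hM => [->|[i ->]].
have muM : (0 < mup p (hs q M))%N.
  by rewrite -XsubC_dvd // -root_factor_theorem /root /= horner_slice Mpq.
have [i mi0] : exists i, mG i = 0%N.
  have : (r%:P : B).[p%:P].[q] != 0 by rewrite hornerC.
  rewrite -bez sum3 !hornerE => h.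
  have : [exists i, (G i).[p%:P].[q] != 0].
    apply: contraNT h; rewrite negb_exists => /forallP h.
    by have := h o0; have := h o1; have := h o2; rewrite !negbK => /eqP-> /eqP-> /eqP->; rewrite !mulr0 !addr0.
  move=> /existsP[i Gi]; exists i; apply: mupNroot.
  by rewrite /root /= horner_slice.
(* A zero sum of slopes would make the multiplicities equal, hence 0 by [mi0], hence [mP] = 0 as
   well; but [M] has a zero at the point. *)
have sl0 : \sum_i slp K i * (mG i)%:R != 0.
  apply/eqP => /(slp_sum (m := fun i => (mG i)%:Z)) [/eqP]; rewrite eqz_nat => /eqP e02 /eqP.
  rewrite eqz_nat => /eqP e12.
  have mG0 j : mG j = 0%N.
    have : mG o2 = 0%N by move: mi0; move: i; elim/ord3P; rewrite ?e02 ?e12.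
    by move=> z; move: j; elim/ord3P; rewrite ?e02 ?e12 z.
  have mP0 : mP = 0%N.
    apply/eqP; rewrite -(pnatr_eq0 K) emu big1 // => j _; by rewrite mG0 mulr0.
  by case: hM muM => [->|[j ->]]; rewrite -/Phi -/mP -?/(mG _) ?mP0 ?mG0.
rewrite /x0 /=; under eq_bigr do rewrite ffunE.
apply: (mulfI sl0); rewrite hornerZ mulrA divff // mul1r hornerD hornerN hornerC horner_sum emu.
rewrite mulr_suml -sumrB; apply: eq_bigr => j _; rewrite ffunE !hornerE /=; ring.
Qed.
End Locus.

End HornLines.

Definition pt (K : nzRingType) (x y : K) (i : 'I_3) : K := [:: x; y; 1]`_i.

Definition line (K : nzRingType) (I : Type) (a b c : I -> int) (l : I) (p q : K) : K :=
  (a l)%:~R * p + (b l)%:~R * q + (c l)%:~R.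

(* Horn uniformisation: (p, q) |-> (x, y) inverts the logarithmic Gauss map of
   F(x, y, 1), with the exponents of each line in x, y and 1/F being its
   coefficients. *)
Record horn_data (K : fieldType) (F : {mpoly K[3]}) (I : finType)
    (a b c : I -> int) (k1 k2 k3 : K) : Prop := HornData {
  horn_k1 : k1 != 0;
  horn_k2 : k2 != 0;
  horn_k3 : k3 != 0;
  horn_dir : forall l, (a l != 0) || (b l != 0);
  horn_dist : forall l l', a l * b l' = a l' * b l -> a l * c l' = a l' * c l ->
    b l * c l' = b l' * c l -> l = l';
  horn_suma : \sum_l a l = 0;
  horn_sumb : \sum_l b l = 0;
  horn_eq : forall p q : K, (forall l, line a b c l p q != 0) ->
    let x := k1 * \prod_l line a b c l p q ^ a l in
    let y := k2 * \prod_l line a b c l p q ^ b l in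
    [/\ F.@[pt x y] = k3 * \prod_l line a b c l p q ^ (- c l),
        x * F^`M(o0).@[pt x y] = p * F.@[pt x y] &
        y * F^`M(o1).@[pt x y] = q * F.@[pt x y]] }.

Section Prelim2.
Variable K : numClosedFieldType.

Lemma affine_cofin0 (a b : K) : cofin (fun t => a * t + b = 0) -> a = 0 /\ b = 0.
Proof.
move=> h; case: (boolP ((a != 0) || (b != 0))) => [/cofin_affine g|].
  by have [t [->]] := cofin_ex (cofinI h g); rewrite eqxx.
by rewrite negb_or !negbK => /andP[/eqP -> /eqP ->].
Qed.

Lemma mupX (s : K) (p : {poly K}) n : p != 0 -> mup s (p ^+ n) = (n * mup s p)%N.
Proof.
move=> p0; elim: n => [|n IH]; first by rewrite expr0 mul0n mupNroot // root1.
by rewrite exprS mupM ?expf_neq0 // IH mulSn.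
Qed.

Lemma mup_prod_XsubC (I : finType) (y : I -> K) (e : I -> nat) l0 :
  (forall l, l != l0 -> y l != y l0) ->
  mup (y l0) (\prod_l ('X - (y l)%:P) ^+ e l) = e l0.
Proof.
move=> yd; rewrite (bigD1 l0) //= mupMl ?mup_XsubCX ?eqxx //.
rewrite /root horner_prod; apply/prodf_neq0 => l ll0.
by rewrite horner_exp expf_neq0 // hornerXsubC subr_eq0 eq_sym yd.
Qed.

Lemma size_prod_XsubC_exp (I : finType) (P : pred I) (y : I -> K) (e : I -> nat) :
  size (\prod_(l | P l) ('X - (y l)%:P) ^+ e l) = (\sum_(l | P l) e l).+1.
Proof.
rewrite size_prod => [|l _]; last by rewrite expf_neq0 ?polyXsubC_eq0.
under eq_bigr do rewrite size_exp_XsubC -addn1.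
by rewrite big_split /= sum1_card -addSn addnK.
Qed.

Lemma cofin_poly_neq (p q : {poly K}) : p != q -> cofin (fun t => p.[t] != q.[t]).
Proof.
rewrite -subr_eq0 => /cofin_poly; apply: cofin_sub => t.
by rewrite !hornerE subr_eq0.
Qed.

End Prelim2.

Section HornFactor.
Variable K : numClosedFieldType.
Local Notation B := {poly {poly K}}.
Local Notation cB := (polyC \o polyC : K -> B).
Local Notation evB G p := (mmap cB G p : B).
Variables (d : nat) (F : {mpoly K[3]}).
Hypothesis hF : F \is d.-homog.
Variables (I : finType) (x : I -> {poly K}).
Hypothesis x_inj : injective x.
Let pr (e : I -> nat) : B := \prod_l ('X - (x l)%:P) ^+ e l.

Lemma vs_pr p e : vs p (pr e) = \prod_l (p%:P - x l) ^+ e l.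
Proof.
rewrite /= /horner_eval horner_prod; apply: eq_bigr => l _.
by rewrite horner_exp hornerXsubC.
Qed.

Lemma hs_pr q e : hs q (pr e) = \prod_l ('X - (x l).[q]%:P) ^+ e l.
Proof.
rewrite rmorph_prod; apply: eq_bigr => l _.
by rewrite rmorphXn rmorphB /= map_polyX map_polyC.
Qed.

Section Vertical.
Variables (G : 'I_3 -> B) (n : 'I_3 -> {poly K}) (e : 'I_3 -> I -> nat).
Variables (nF : {poly K}) (eF : I -> nat).
Hypotheses (n0 : forall i, n i != 0) (nF0 : nF != 0).
Hypotheses (GE : forall i, G i = (n i)%:P * pr (e i)) (FE : evB G F = nF%:P * pr eF).
Hypothesis RG : Rel d F G.

(** On vertical slices the multiplicities at [k] of the factors in q alone do not depend on the
    generic p, so the residue equation is an identity in p. Its slope forces the first two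
    equalities and its constant term the third. *)
Lemma vertical_mup k : [/\ mup k (n o0) = mup k (n o2), mup k (n o1) = mup k (n o2) &
  mup k nF = (d * mup k (n o2))%N].
Proof.
have gen : cofin (fun p : K => forall l, p != (x l).[k]).
  by apply: cofin_forall => l; apply: cofin_neq.
have E p : (forall l, p != (x l).[k]) ->
    (\sum_i slp K i * (mup k (n i))%:R) * p +
    (\sum_i (slq K i * k + cst K d i) * (mup k (n i))%:R - (mup k nF)%:R) = 0.
  move=> gp; have prk f : ~~ root (vs p (pr f)) k.
    rewrite vs_pr /root horner_prod; apply/prodf_neq0 => l _.
    by rewrite horner_exp expf_neq0 // !hornerE subr_eq0.
  have vsC' (m : {poly K}) : vs p m%:P = m by rewrite /= /horner_eval hornerC.
  have vM (m : {poly K}) f : vs p (m%:P * pr f) = m * vs p (pr f).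
    by rewrite rmorphM vsC'.
  have pr0 f : vs p (pr f) != 0 by apply: contraNneq (prk f) => ->; rewrite root0.
  have := slice_mup (vsC p) RG _ _ k; rewrite FE vM mupMl // => ->; last first.
  - by rewrite mulf_neq0.
  - by move=> i; rewrite GE vM mulf_neq0.
  by rewrite !sum3 !GE !vM !mupMl // !vs_PB !(hornerD, hornerZ, hornerX, hornerC); ring.
have [S1 S2] := affine_cofin0 (cofin_sub E gen).
have [/eqP + /eqP] := slp_sum (m := fun i => (mup k (n i))%:Z) S1.
rewrite !eqz_nat => /eqP e0 /eqP e1; split=> //; apply/eqP.
rewrite -(eqr_nat K) natrM; apply/eqP; move/eqP: S2; rewrite subr_eq0 => /eqP <-.
by rewrite sum3 e0 e1 /slq /cst /=; ring.
Qed.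
End Vertical.

Variables (u : 'I_3 -> K) (e : 'I_3 -> I -> nat) (w : K) (eF : I -> nat).
Hypotheses (u0 : forall i, u i != 0) (w0 : w != 0).
Let G i : B := (u i)%:P%:P * pr (e i).
Hypotheses (FE : evB G F = w%:P%:P * pr eF) (RG : Rel d F G).

Let hsG q i : hs q (G i) = (u i)%:P * hs q (pr (e i)).
Proof. by rewrite rmorphM /= map_polyC /= /horner_eval hornerC. Qed.
Let hsF q : hs q (evB G F) = w%:P * hs q (pr eF).
Proof. by rewrite FE rmorphM /= map_polyC /= /horner_eval hornerC. Qed.
Let hsG0 q i : hs q (G i) != 0.
Proof.
rewrite hsG mulf_neq0 ?polyC_eq0 // hs_pr; apply/prodf_neq0 => l _.
by rewrite expf_neq0 // polyXsubC_eq0.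
Qed.
Let hsF0 q : hs q (evB G F) != 0.
Proof.
rewrite hsF mulf_neq0 ?polyC_eq0 // hs_pr; apply/prodf_neq0 => l _.
by rewrite expf_neq0 // polyXsubC_eq0.
Qed.

Let a l : int := (e o0 l)%:Z - (e o2 l)%:Z.
Let b l : int := (e o1 l)%:Z - (e o2 l)%:Z.
Let c l : int := d%:Z * (e o2 l)%:Z - (eF l)%:Z.

(** For generic q the roots x_l(q) are distinct, so the residue equation holds with the exponents as
    multiplicities. Eliminating P_2 = d - P_0 - P_1 turns it into a P_0 + b P_1 + c = 0, where P_0 =
    p and P_1 = q + 'i p. *)
Lemma line_on l q : ((a l)%:~R + 'i * (b l)%:~R) * (x l).[q] + (b l)%:~R * q + (c l)%:~R = 0 :> K.
Proof.
pose P : {poly K} := ((a l)%:~R + 'i * (b l)%:~R) *: x l + (b l)%:~R *: 'X + (c l)%:~R%:P.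
suff P0 : P = 0 by have := congr1 (horner^~ q) P0; rewrite !hornerE.
apply: poly_cofin0.
have : cofin (fun q : K => forall l', l' != l -> (x l').[q] != (x l).[q]).
  apply: cofin_forall => l'; case: (eqVneq l' l) => [->|ne]; first by apply: cofin_all.
  by apply: cofin_sub (cofin_poly_neq (contra_neq (@x_inj l' l) ne)).
apply: cofin_sub => {}q xd; have := slice_mup (hsC q) RG (hsG0 q) (hsF0 q) (x l).[q].
have mp f : mup (x l).[q] (hs q (pr f)) = f l.
  by rewrite hs_pr (@mup_prod_XsubC _ _ (fun l => (x l).[q])).
rewrite hsF mupMr ?rootC // mp; under eq_bigr do rewrite hsG mupMr ?rootC // mp hs_PB.
rewrite sum3 !hornerE /slp /slq /cst /= => E.
rewrite /a /b /c !rmorphB rmorphM /= -!pmulrn E; ring.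
Qed.

Lemma line_shape l p q : line a b c l p (q + 'i * p) = ((a l)%:~R + 'i * (b l)%:~R) * (p - (x l).[q]) :> K.
Proof.
rewrite /line; have -> : (c l)%:~R = - (((a l)%:~R + 'i * (b l)%:~R) * (x l).[q] + (b l)%:~R * q) :> K.
  by apply/eqP; rewrite -addr_eq0 addrC line_on.
ring.
Qed.

(** The residue at infinity of a horizontal slice gives all [G i] the same degree in p. *)
Lemma sum_ab : \sum_l a l = 0 /\ \sum_l b l = 0.
Proof.
have := slice_degree (hsC 0) RG (hsG0 0) (hsF0 0) (sl := slp K).
have sz i : (size (hs 0 (G i))).-1 = (\sum_l e i l)%N.
  by rewrite hsG size_Cmul ?u0 // hs_pr size_prod_XsubC_exp.
under eq_bigr do rewrite sz.
move/(_ (fun i => ex_intro _ _ (hs_PB d 0 i)))/(slp_sum (m := fun i => (\sum_l e i l)%N%:Z)).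
have PS (f : I -> nat) : (\sum_l f l)%N%:Z = \sum_l (f l)%:Z  by rewrite (big_morph Posz PoszD (id1 := 0) (id2 := 0%N)).
by rewrite !PS /a /b !sumrB => -[-> ->]; rewrite !subrr.
Qed.

End HornFactor.

Section HornMain.
Variable K : numClosedFieldType.
Local Notation B := {poly {poly K}}.
Local Notation cB := (polyC \o polyC : K -> B).
Local Notation evB G p := (mmap cB G p : B).
Variables (d : nat) (F : {mpoly K[3]}).
Hypothesis hF : F \is d.-homog.

(** In the chart z = 1, x and y are G_0 / G_2 and G_1 / G_2, and F(x, y, 1) is F(G) / G_2^d, which
    explains the exponents a, b and - c. The constants absorb the factors [k l] between a line and p
    - x_l(q). *)
Lemma horn_of_factor (I : finType) (x : I -> {poly K}) (u : 'I_3 -> K)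
    (e : 'I_3 -> I -> nat) (w : K) (eF : I -> nat) :
  injective x -> (forall i, u i != 0) -> w != 0 ->
  let G i : B := (u i)%:P%:P * \prod_l ('X - (x l)%:P) ^+ e i l in
  evB G F = w%:P%:P * \prod_l ('X - (x l)%:P) ^+ eF l -> Rel d F G ->
  (forall l, (e o0 l != e o2 l) || (e o1 l != e o2 l)) ->
  exists (a b c : I -> int) (k1 k2 k3 : K), horn_data F a b c k1 k2 k3.
Proof.
move=> x_inj u0 w0 G FE RG good.
pose a l : int := (e o0 l)%:Z - (e o2 l)%:Z.
pose b l : int := (e o1 l)%:Z - (e o2 l)%:Z.
pose c l : int := d%:Z * (e o2 l)%:Z - (eF l)%:Z.
pose k l : K := (a l)%:~R + 'i * (b l)%:~R.
have dir l : (a l != 0) || (b l != 0).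
  by rewrite /a /b !subr_eq0 !eqz_nat good.
have k0 l : k l != 0.
  by apply: contraTneq (dir l) => /imag_irrational[-> ->]; rewrite eqxx.
have shape l p q : line a b c l p (q + 'i * p) = k l * (p - (x l).[q]).
  exact: (line_shape x_inj u0 w0 FE RG).
have [sa sb] := sum_ab u0 w0 FE RG.
exists a, b, c, (u o0 / u o2 * \prod_l k l ^ (- a l)), (u o1 / u o2 * \prod_l k l ^ (- b l)),
  (w / u o2 ^+ d * \prod_l k l ^ c l).
have kp (f : I -> int) : \prod_l k l ^ f l != 0.
  by apply/prodf_neq0 => l _; rewrite expfz_neq0.
split=> //; rewrite ?mulf_neq0 ?invr_eq0 ?expf_neq0 //.
  (* Proportional coefficients describe the same line, hence the same root. *)
  move=> l l' e1 e2 e3; apply: (x_inj); apply: poly_cofin_eq; apply: cofin_all => q.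
  have s1 : k l * (x l).[q] + (b l)%:~R * q + (c l)%:~R = 0 := line_on x_inj u0 w0 FE RG l q.
  have s2 : k l' * (x l').[q] + (b l')%:~R * q + (c l')%:~R = 0 := line_on x_inj u0 w0 FE RG l' q.
  have t1 : (a l)%:~R * (b l')%:~R = (a l')%:~R * (b l)%:~R :> K by rewrite -!rmorphM /= e1.
  have t2 : (a l)%:~R * (c l')%:~R = (a l')%:~R * (c l)%:~R :> K by rewrite -!rmorphM /= e2.
  have t3 : (b l)%:~R * (c l')%:~R = (b l')%:~R * (c l)%:~R :> K by rewrite -!rmorphM /= e3.
  apply: (mulfI (mulf_neq0 (k0 l) (k0 l'))).
  have -> : k l * k l' * (x l).[q] = k l' * (k l * (x l).[q]) by ring.
  have -> : k l * (x l).[q] = - ((b l)%:~R * q + (c l)%:~R) by apply/eqP; rewrite -addr_eq0 addrA s1.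
  have -> : k l * k l' * (x l').[q] = k l * (k l' * (x l').[q]) by ring.
  have -> : k l' * (x l').[q] = - ((b l')%:~R * q + (c l')%:~R) by apply/eqP; rewrite -addr_eq0 addrA s2.
  apply: oppr_inj; rewrite -!mulrN !opprK /k !mulrDl !mulrDr.
  have -> : (a l')%:~R * ((b l)%:~R * q) = (a l)%:~R * ((b l')%:~R * q) :> K by rewrite !mulrA t1.
  by rewrite t2 -!mulrA t3 [(b l')%:~R * (_ * q)]mulrCA; ring.
move=> P0 P1 hU X Y.
pose q := P1 - 'i * P0; pose y l := P0 - (x l).[q].
have hE l : line a b c l P0 P1 = k l * y l by rewrite -shape /q subrK.
have y0 l : y l != 0 by have := hU l; rewrite hE mulf_eq0 => /norP[].
pose pi := [the {rmorphism B -> K} of horner_eval q \o horner_eval P0%:P].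
pose g i := pi (G i).
have gE i : g i = u i * \prod_l y l ^+ e i l.
  rewrite /g /pi /= /horner_eval !hornerM !hornerC !horner_prod; congr (_ * _); apply: eq_bigr => l _.
  by rewrite !(horner_exp, hornerXsubC, hornerD, hornerN, hornerC).
have yp (f : I -> nat) : \prod_l y l ^+ f l != 0.
  by apply/prodf_neq0 => l _; rewrite expf_neq0.
have g0 i : g i != 0 by rewrite gE mulf_neq0.
have evg p : pi (evB G p) = p.@[g].
  by rewrite rmorph_mmap; apply: eq_mmap => // c' /=; rewrite /horner_eval !hornerC.
have powE (f1 f2 : I -> nat) (f : I -> int) : (forall l, f l = (f1 l)%:Z - (f2 l)%:Z) ->
    \prod_l k l ^ (- f l) * \prod_l line a b c l P0 P1 ^ f l =
    (\prod_l y l ^+ f1 l) / \prod_l y l ^+ f2 l.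
  move=> fE; rewrite -prodf_div -big_split /=; apply: eq_bigr => l _.
  by rewrite hE expfzMl mulrA -expfzDr // addNr mul1r fE expfzDr // -exprnN.
have XE : g o0 = g o2 * X.
  have -> : X = u o0 / u o2 * ((\prod_l y l ^+ e o0 l) / \prod_l y l ^+ e o2 l).
    by rewrite -(powE _ _ a) // mulrA.
  by rewrite !gE; field; rewrite u0 yp.
have YE : g o1 = g o2 * Y.
  have -> : Y = u o1 / u o2 * ((\prod_l y l ^+ e o1 l) / \prod_l y l ^+ e o2 l).
    by rewrite -(powE _ _ b) // mulrA.
  by rewrite !gE; field; rewrite u0 yp.
have gv i : g i = g o2 * pt X Y i by move: i; elim/ord3P; rewrite /pt /= ?mulr1.
have homE p n : p \is n.-homog -> p.@[g] = g o2 ^+ n * p.@[pt X Y].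
  by move=> hp; rewrite -[RHS](mmap_homog idfun _ _ hp); apply: eq_mmap.
have FgE : F.@[g] = w * \prod_l y l ^+ eF l.
  rewrite -evg FE /pi /= /horner_eval !hornerM !hornerC !horner_prod; congr (_ * _); apply: eq_bigr => l _.
  by rewrite !(horner_exp, hornerXsubC, hornerD, hornerN, hornerC).
have relE i : pt X Y i * F^`M(i).@[pt X Y] = pi (PB K d i) * F.@[pt X Y].
  have : pi (evB G ('X_i * F^`M(i))) = pi (PB K d i) * pi (evB G F).
    by rewrite -[RHS]rmorphM; congr (pi _); apply: RG.
  rewrite !evg (homE _ _ (toric_homog i hF)) (homE _ _ hF).
  by rewrite mulrCA mevalM mevalXU => /(mulfI (expf_neq0 d (g0 o2))).
split.
- have -> : w / u o2 ^+ d * \prod_l k l ^ c l * \prod_l line a b c l P0 P1 ^ (- c l) =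
     w / u o2 ^+ d * ((\prod_l y l ^+ eF l) / \prod_l y l ^+ (e o2 l * d)).
    rewrite -(powE _ _ (fun l => - c l)); last by move=> l; rewrite /c; lia.
    by rewrite mulrA; congr (_ * _ * _); apply: eq_bigr => l _; rewrite opprK.
  apply: (mulfI (expf_neq0 d (g0 o2))); rewrite -homE // FgE gE exprMn.
  have -> : \prod_l y l ^+ (e o2 l * d) = (\prod_l y l ^+ e o2 l) ^+ d.
    by rewrite -prodrXl; apply: eq_bigr => l _; rewrite exprM.
  by field; rewrite !expf_neq0.
- have := relE o0; rewrite {1}/pt /= => ->; congr (_ * _).
  by rewrite /horner_eval /PB /slp /slq /cst !hornerE /=; ring.
- have := relE o1; rewrite {1}/pt /= => ->; congr (_ * _).
  rewrite /horner_eval /PB /slp /slq /cst !hornerE /= /q; ring.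
Qed.

End HornMain.

Section HornFinal.
Variable K : numClosedFieldType.
Local Notation B := {poly {poly K}}.
Local Notation cB := (polyC \o polyC : K -> B).
Local Notation evB G p := (mmap cB G p : B).
Variables (d : nat) (F : {mpoly K[3]}).
Hypothesis hF : F \is d.-homog.

(** What remains is to strip common factors with [rel_scale]: the factors in q alone, which vertical
    slices show to be proportional, and the lines with a = b = 0, for which the line equation leaves
    c = 0, so that they occur equally in the three components and [d] times as often in F(G). *)
Lemma horn_uniformisation : toric_polar_cremona F ->
  exists (I : finType) (a b c : I -> int) (k1 k2 k3 : K), horn_data F a b c k1 k2 k3.
Proof.
move=> hcr; have [G0 [G0n F0n R0 _]] := horn_init hF hcr.
have [G [u [r [Gn Fn RG rn bez]]]] := horn_coprime hF G0n F0n R0.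
have [I [x [D [x_inj D0 loc]]]] := horn_locus Gn Fn RG rn bez.
pose pr (e : I -> nat) : B := \prod_l ('X - (x l)%:P) ^+ e l.
have prn e : pr e != 0 by apply/prodf_neq0 => l _; rewrite expf_neq0 // polyXsubC_eq0.
have /fin_all_exists[n /fin_all_exists[e GE]] i : exists n e, G i = n%:P * pr e.
  by apply: (line_factor (Gn i) D0); apply: loc; right; exists i.
have [nF [eF FE]] : exists n e, evB G F = n%:P * pr e.
  by apply: (line_factor Fn D0); apply: loc; left.
have nn i : n i != 0 by have := Gn i; rewrite GE mulf_eq0 polyC_eq0 => /norP[].
have nFn : nF != 0 by have := Fn; rewrite FE mulf_eq0 polyC_eq0 => /norP[].
have vm := vertical_mup nn nFn GE FE RG.
have [v vn vE] : exists2 v : 'I_3 -> K, forall i, v i != 0 & forall i, n i = v i *: n o2.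
  have H i : exists v, v != 0 /\ n i = v *: n o2.
    have [y|v vn E] := @mup_proportional K (n i) (n o2) (nn i) (nn o2); last by exists v.
    by have [m0 m1 _] := vm y; move: i; elim/ord3P.
  have [v vP] := fin_all_exists H.
  by exists v => i; case: (vP i).
have [w wn wE] : exists2 w, w != 0 & nF = w *: n o2 ^+ d.
  apply: mup_proportional; rewrite ?expf_neq0 // => y.
  by have [_ _ ->] := vm y; rewrite mupX.
pose G1 i : B := (v i)%:P%:P * pr (e i).
have n2B : (n o2)%:P != 0 by rewrite polyC_eq0.
have E1 i : 1 * G i = (n o2)%:P * G1 i.
  by rewrite mul1r GE vE /G1 -mul_polyC polyCM; ring.
have [R1 FE1] := rel_scale hF (oner_neq0 _) n2B E1 RG.
have F1 : evB G1 F = w%:P%:P * pr eF.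
  apply: (mulfI (expf_neq0 d n2B)); rewrite -FE1 expr1n mul1r FE wE -mul_polyC polyCM.
  by rewrite polyC_exp; ring.
have on := line_on x_inj vn wn F1 R1.
pose good l := (e o0 l != e o2 l) || (e o1 l != e o2 l).
have bad l : ~~ good l -> [/\ e o0 l = e o2 l, e o1 l = e o2 l & eF l = (d * e o2 l)%N].
  rewrite negb_or !negbK => /andP[/eqP e0 /eqP e1]; split=> //.
  have := on l 0; rewrite /= e0 e1 !subrr !(mulr0, mul0r, addr0, add0r) => /eqP.
  by rewrite intr_eq0 subr_eq0 -PoszM eqz_nat => /eqP.
pose J := {l | l \in good}.
pose xJ (l : J) := x (val l).
pose R : B := \prod_(l | l \notin good) ('X - (x l)%:P) ^+ e o2 l.
have R0' : R != 0 by apply/prodf_neq0 => l _; rewrite expf_neq0 // polyXsubC_eq0.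
pose prJ (f : I -> nat) : B := \prod_(l : J) ('X - (xJ l)%:P) ^+ f (val l).
have prE f : (forall l, ~~ good l -> f l = e o2 l) -> pr f = R * prJ f.
  move=> fb; rewrite /pr (bigID (mem good)) /= mulrC; congr (_ * _).
    by apply: eq_bigr => l /fb ->.
  by rewrite (big_sub good (fun l => ('X - (x l)%:P) ^+ f l)).
pose G2 i : B := (v i)%:P%:P * prJ (e i).
have E2 i : 1 * G1 i = R * G2 i.
  have -> : G1 i = (v i)%:P%:P * pr (e i) by [].
  have -> : G2 i = (v i)%:P%:P * prJ (e i) by [].
  have -> : pr (e i) = R * prJ (e i) by apply: prE => l /bad[e0 e1 _]; move: i; elim/ord3P.
  by rewrite mul1r [LHS]mulrCA.
have [R2 FE2] := rel_scale hF (oner_neq0 _) R0' E2 R1.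
have F2 : evB G2 F = w%:P%:P * prJ eF.
  apply: (mulfI (expf_neq0 d R0')); rewrite -FE2 expr1n mul1r F1 mulrCA; congr (_ * _).
  rewrite /pr (bigID (mem good)) /= mulrC; congr (_ * _).
    by rewrite -prodrXl; apply: eq_bigr => l /bad[_ _ ->]; rewrite mulnC exprM.
  by rewrite (big_sub good (fun l => ('X - (x l)%:P) ^+ eF l)).
have xJ_inj : injective xJ by move=> l l' /x_inj /val_inj.
have [|a [b [c [k1 [k2 [k3 H]]]]]] := horn_of_factor hF xJ_inj vn wn F2 R2.
  by move=> l; exact: (valP l).
by exists J, a, b, c, k1, k2, k3.
Qed.

End HornFinal.

(** * The Jacobian *)

Section Derivative.
Variable K : numFieldType.
Implicit Types (g u : K -> K) (v w s : K).

(** The first-order expansion g(t) = v + s t + o(t), with algebraic limits. *)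
Definition der0 g v s := lim0 g v /\ lim0 (fun t => (g t - v) / t) s.

Lemma der0_eq g u v s : cofin (fun t => g t = u t) -> der0 g v s -> der0 u v s.
Proof.
move=> e [g1 g2]; split; first exact: lim0_eq e g1.
by apply: lim0_eq g2; apply: cofin_sub e => t ->.
Qed.

Lemma der0_cst v : der0 (fun=> v) v 0.
Proof.
split; first exact: lim0_cst.
by apply: lim0_eq (lim0_cst 0); apply: cofin_all => t; rewrite subrr mul0r.
Qed.

Lemma der0_affine s v : der0 (fun t => s * t + v) v s.
Proof.
split; first exact: lim0_affine.
apply: lim0_eq (lim0_cst s); apply: cofin_sub (cofin_neq 0) => t t0.
by rewrite addrK mulfK.
Qed.

Lemma der0D g u v w s r : der0 g v s -> der0 u w r -> der0 (fun t => g t + u t) (v + w) (s + r).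
Proof.
move=> [g1 g2] [u1 u2]; split; first exact: lim0D.
by apply: lim0_eq (lim0D g2 u2); apply: cofin_all => t; rewrite -mulrDl; congr (_ / _); ring.
Qed.

Lemma der0M g u v w s r : der0 g v s -> der0 u w r ->
  der0 (fun t => g t * u t) (v * w) (s * w + v * r).
Proof.
move=> [g1 g2] [u1 u2]; split; first exact: lim0M.
apply: lim0_eq (lim0D (lim0M g2 u1) (lim0M (lim0_cst v) u2)).
by apply: cofin_all => t; ring.
Qed.

Lemma der0V g v s : v != 0 -> der0 g v s -> der0 (fun t => (g t)^-1) v^-1 (- s / v ^+ 2).
Proof.
move=> v0 [g1 g2]; split; first exact: lim0V.
have -> : - s / v ^+ 2 = - s * (v^-1 * v^-1) by rewrite expr2 invfM.
apply: lim0_eq (lim0M (lim0N g2) (lim0M (lim0V v0 g1) (lim0_cst v^-1))).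
by apply: cofin_sub2 (cofin_neq 0) (lim0_nz v0 g1) => t t0 gt; field; rewrite v0 gt t0.
Qed.

Lemma der0Xz g v s (z : int) : v != 0 -> der0 g v s ->
  der0 (fun t => g t ^ z) (v ^ z) (v ^ z * (z%:~R * (s / v))).
Proof.
move=> v0 gv.
have pos n : der0 (fun t => g t ^+ n) (v ^+ n) (v ^+ n * (n%:R * (s / v))).
  elim: n => [|n IH]; first by rewrite mul0r mulr0; exact: der0_cst.
  have -> : v ^+ n.+1 * (n.+1%:R * (s / v)) = s * v ^+ n + v * (v ^+ n * (n%:R * (s / v))).
    by rewrite exprS -natr1; field.
  by rewrite exprS; apply: der0_eq (der0M gv IH); apply: cofin_all => t; rewrite exprS.
case: z => n; first exact: pos.
have := der0V (expf_neq0 n.+1 v0) (pos n.+1); congr (der0 _ _ _).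
by rewrite NegzE rmorphN /= -exprnN; field; rewrite v0 expf_neq0.
Qed.

Lemma der0_prod (I : Type) (r : seq I) (g : I -> K -> K) (v s : I -> K) :
  (forall l, v l != 0) -> (forall l, der0 (g l) (v l) (s l)) ->
  der0 (fun t => \prod_(l <- r) g l t) (\prod_(l <- r) v l)
    ((\prod_(l <- r) v l) * \sum_(l <- r) s l / v l).
Proof.
move=> v0 gv; elim: r => [|l r IH].
  rewrite !big_nil mulr0; apply: der0_eq (der0_cst 1).
  by apply: cofin_all => t; rewrite big_nil.
rewrite !big_cons; have := der0M (gv l) IH.
have -> : s l * \prod_(j <- r) v j + v l * (\prod_(l0 <- r) v l0 * \sum_(l0 <- r) s l0 / v l0) =
  v l * \prod_(j <- r) v j * (s l / v l + \sum_(j <- r) s j / v j).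
  by move: (\prod_(_ <- _) _) (\sum_(_ <- _) _) => P S; field.
by apply: der0_eq; apply: cofin_all => t; rewrite big_cons.
Qed.

Lemma der0_meval n (h : 'I_n -> K -> K) (v : 'I_n -> K) (p : {mpoly K[n]}) :
  (forall i, der0 (h i) (v i) 0) -> der0 (fun t => p.@[fun i => h i t]) p.@[v] 0.
Proof.
move=> hv; elim/mpoly_ring_ind: p => [c|i|p q IHp IHq|p q IHp IHq].
- by rewrite mevalC; apply: der0_eq (der0_cst c); apply: cofin_all => t; rewrite mevalC.
- by rewrite mevalXU; apply: der0_eq (hv i); apply: cofin_all => t; rewrite mevalXU.
- have := der0D IHp IHq; rewrite addr0 mevalD; apply: der0_eq.
  by apply: cofin_all => t; rewrite mevalD.
- have := der0M IHp IHq; rewrite mul0r mulr0 addr0 mevalM; apply: der0_eq.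
  by apply: cofin_all => t; rewrite mevalM.
Qed.

Lemma lim0_meval n (h : 'I_n -> K -> K) (v : 'I_n -> K) (p : {mpoly K[n]}) :
  (forall i, lim0 (h i) (v i)) -> lim0 (fun t => p.@[fun i => h i t]) p.@[v].
Proof.
move=> hv; elim/mpoly_ring_ind: p => [c|i|p q IHp IHq|p q IHp IHq].
- by rewrite mevalC; apply: lim0_eq (lim0_cst c); apply: cofin_all => t; rewrite mevalC.
- by rewrite mevalXU; apply: lim0_eq (hv i); apply: cofin_all => t; rewrite mevalXU.
- rewrite mevalD; apply: lim0_eq (lim0D IHp IHq); apply: cofin_all => t; by rewrite mevalD.
- rewrite mevalM; apply: lim0_eq (lim0M IHp IHq); apply: cofin_all => t; by rewrite mevalM.
Qed.

End Derivative.

Section HornConsequences.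
Variable K : numClosedFieldType.
Variables (F : {mpoly K[3]}) (I : finType) (a b c : I -> int) (k1 k2 k3 : K).
Hypothesis H : horn_data F a b c k1 k2 k3.
Local Notation h l := (line a b c l : K -> K -> K).
Definition off_lines (p q : K) := forall l, h l p q != 0.
Let X p q := k1 * \prod_l h l p q ^ a l.
Let Y p q := k2 * \prod_l h l p q ^ b l.
Let f p q := F.@[pt (X p q) (Y p q)].

Lemma horn_f_neq0 p q : off_lines p q -> f p q != 0.
Proof.
move=> U; have [e _ _] := horn_eq H U; rewrite /f /X /Y e mulf_neq0 ?(horn_k3 H) //.
by apply/prodf_neq0 => l _; rewrite expfz_neq0.
Qed.

(** The pair (p, q) is read off (x, y) as x F_x / F and y F_y / F, where F is nonzero. *)
Lemma horn_inj p q p' q' : off_lines p q -> off_lines p' q' ->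
  X p q = X p' q' -> Y p q = Y p' q' -> p = p' /\ q = q'.
Proof.
move=> U U' eX eY; have [_ e0 e1] := horn_eq H U; have [_ e0' e1'] := horn_eq H U'.
rewrite -/(X p q) -/(Y p q) -/(f p q) in e0 e1.
rewrite -/(X p' q') -/(Y p' q') -eX -eY -/(f p q) in e0' e1'.
have f0 := horn_f_neq0 U.
by split; apply: (mulIf f0); rewrite -?e0 -?e1 ?e0' ?e1'.
Qed.

Lemma off_lines_dir p q (al be : K) : off_lines p q ->
  cofin (fun t => off_lines (al * t + p) (be * t + q)).
Proof.
move=> U; apply: cofin_forall => l.
have : cofin (fun t : K => ((a l)%:~R * al + (b l)%:~R * be) * t + h l p q != 0).
  by apply: cofin_affine; rewrite U orbT.
by apply: cofin_sub => t; congr (_ != 0); rewrite /line; ring.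
Qed.

Lemma off_lines_ex : exists p q, off_lines p q.
Proof.
have : cofin (fun q : K => forall l, a l = 0 -> (b l)%:~R * q + (c l)%:~R != 0).
  apply: cofin_forall => l; case: (eqVneq (a l) 0) => [al|al]; last first.
    by apply: cofin_all => t al'; rewrite al' eqxx in al.
  have := horn_dir H l; rewrite al eqxx /= => bl.
  have : cofin (fun t : K => (b l)%:~R * t + (c l)%:~R != 0).
    by apply: cofin_affine; rewrite intr_eq0 bl.
  by apply: cofin_sub.
move=> /cofin_ex[q hq].
have : cofin (fun p : K => forall l, h l p q != 0).
  apply: cofin_forall => l.
  have : cofin (fun t : K => (a l)%:~R * t + ((b l)%:~R * q + (c l)%:~R) != 0).
    apply: cofin_affine; rewrite intr_eq0; case: (eqVneq (a l) 0) => //= /hq; done.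
  by apply: cofin_sub => t; rewrite /line addrA.
by move=> /cofin_ex[p hp]; exists p, q.
Qed.

Definition jac (p q : K) : K :=
  (\sum_l (a l)%:~R ^+ 2 / h l p q) * (\sum_l (b l)%:~R ^+ 2 / h l p q) -
  (\sum_l (a l)%:~R * (b l)%:~R / h l p q) ^+ 2.

(* jac is the Jacobian of (log x, log y).  Along a null direction x, y, F and
   its derivatives would be stationary, but p = x F_x / F and q = y F_y / F
   are not. *)
Lemma jac_neq0 p q : off_lines p q -> jac p q != 0.
Proof.
move=> U; apply/eqP; rewrite /jac; set A := \sum_l _; set G := \sum_l _; set E := \sum_l _ => j0.
have [al [be [ab0 e1 e2]]] : exists al be : K,
    [/\ (al != 0) || (be != 0), al * A + be * E = 0 & al * E + be * G = 0].
  case: (boolP ((E != 0) || (A != 0))) => [n|]; last first.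
    rewrite negb_or !negbK => /andP[/eqP-> /eqP->]; exists 1, 0.
    by rewrite oner_neq0 !mulr0 mul0r addr0.
  by exists (- E), A; rewrite oppr_eq0 n; split=> //; [ring | rewrite -[RHS]j0; ring].
have hd l : der0 (fun t => h l (al * t + p) (be * t + q)) (h l p q)
    (al * (a l)%:~R + be * (b l)%:~R).
  apply: der0_eq (der0_affine _ _); apply: cofin_all => t; rewrite /line; ring.
have dX (k : K) (e : I -> int) : \sum_l (e l)%:~R * ((al * (a l)%:~R + be * (b l)%:~R) / h l p q) = 0 ->
    der0 (fun t => k * \prod_l h l (al * t + p) (be * t + q) ^ e l) (k * \prod_l h l p q ^ e l) 0.
  move=> s0.
  have v0 l : h l p q ^ e l != 0 by rewrite expfz_neq0.
  have := der0M (der0_cst k) (der0_prod (index_enum I) v0 (fun l => der0Xz (e l) (U l) (hd l))).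
  congr (der0 _ _ _); rewrite mul0r add0r.
  rewrite (_ : \sum_l _ = 0) ?mulr0 // -[RHS]s0; apply: eq_bigr => l _.
  by rewrite mulrC mulKf.
have xd : der0 (fun t => X (al * t + p) (be * t + q)) (X p q) 0.
  apply: dX; rewrite -[RHS]e1 !mulr_sumr -big_split; apply: eq_bigr => l _ /=; ring.
have yd : der0 (fun t => Y (al * t + p) (be * t + q)) (Y p q) 0.
  apply: dX; rewrite -[RHS]e2 !mulr_sumr -big_split; apply: eq_bigr => l _ /=; ring.
pose v i t := pt (X (al * t + p) (be * t + q)) (Y (al * t + p) (be * t + q)) i.
have vd i : der0 (v i) (pt (X p q) (Y p q) i) 0.
  by move: i; elim/ord3P => //; exact: der0_cst.
have gen := off_lines_dir al be U.
have Fd := der0_meval F vd.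
have end_ (s r : K) (x : K -> K) (i : 'I_3) : der0 x (x 0) 0 ->
    cofin (fun t => x t * F^`M(i).@[fun i => v i t] = (s * t + r) * F.@[fun i => v i t]) ->
    x 0 * F^`M(i).@[pt (X p q) (Y p q)] = r * F.@[pt (X p q) (Y p q)] -> s = 0.
  move=> xd0 e e0; have d1 := der0M xd0 (der0_meval F^`M(i) vd).
  have d2 := der0M (der0_affine s r) Fd.
  have := der0_eq e d1; rewrite mul0r mulr0 addr0 e0 => -[_ l1]; have [_ l2] := d2.
  have := lim0_unique l1 l2; rewrite mulr0 addr0 => /esym/eqP.
  by rewrite mulf_eq0 (negPf (horn_f_neq0 U)) orbF => /eqP.
have [_ eX eY] := horn_eq H U.
have al0 : al = 0.
  apply: (end_ al p (fun t => X (al * t + p) (be * t + q)) o0); rewrite ?mulr0 ?add0r //.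
  by apply: cofin_sub gen => t Ut; have [_ ->] := horn_eq H Ut.
have be0 : be = 0.
  apply: (end_ be q (fun t => Y (al * t + p) (be * t + q)) o1); rewrite ?mulr0 ?add0r //.
  by apply: cofin_sub gen => t Ut; have [_ _ ->] := horn_eq H Ut.
by move: ab0; rewrite al0 be0 eqxx.
Qed.

Let dir (al be : K) l := (a l)%:~R * al + (b l)%:~R * be.

(* At infinity in direction (al, be) the monomials x and y stay finite and
   nonzero while x F_x / F or y F_y / F has a pole, so F vanishes there. *)
Lemma horn_pole (al be : K) : (al != 0) || (be != 0) ->
  \sum_(l | dir al be l != 0) a l = 0 -> \sum_(l | dir al be l != 0) b l = 0 ->
  0 < \sum_(l | dir al be l != 0) c l.
Proof.
move=> ab0 sa sb; have [p [q U]] := off_lines_ex.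
pose P t := al / t + p; pose Q t := be / t + q.
have UPQ : cofin (fun t => off_lines (P t) (Q t)).
  apply: cofin_forall => l.
  have : cofin (fun t : K => h l p q * t + dir al be l != 0) by apply: cofin_affine; rewrite U.
  apply: cofin_sub2 (cofin_neq 0) => t t0; apply: contra_neq => e.
  have -> : h l p q * t + dir al be l = t * h l (P t) (Q t).
    by rewrite /line /P /Q /dir; field.
  by rewrite e mulr0.
(* [r l] is the line with its pole removed, so that its limit [r0 l] is finite and nonzero. *)
pose r l t := if dir al be l != 0 then h l p q * t + dir al be l else h l p q.
pose r0 l := if dir al be l != 0 then dir al be l else h l p q.
have r00 l : r0 l != 0 by rewrite /r0; case: ifP.
have rl l : lim0 (r l) (r0 l).
  by rewrite /r /r0; case: ifP => _; [apply: lim0_affine|apply: lim0_cst].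
have hr l t : t != 0 -> h l (P t) (Q t) = (if dir al be l != 0 then t^-1 else 1) * r l t.
  move=> t0; rewrite /r; case: ifP => [_|/negbFE/eqP d0].
    by rewrite /line /P /Q /dir; field.
  by rewrite mul1r -[RHS]add0r -(mul0r t^-1) -d0 /line /P /Q /dir; ring.
have prodr (e : I -> int) t : t != 0 -> \prod_l h l (P t) (Q t) ^ e l =
    t ^ (- \sum_(l | dir al be l != 0) e l) * \prod_l r l t ^ e l.
  move=> t0; rewrite (eq_bigr (fun l => (if dir al be l != 0 then t^-1 else 1) ^ e l * r l t ^ e l)).
    rewrite big_split /=; congr (_ * _); rewrite -sumrN.
    rewrite (big_morph (fun z => t ^ z) (id1 := 1) (op1 := *%R)) //; last first.
      by move=> x y; rewrite expfzDr.
    rewrite [RHS]big_mkcond; apply: eq_bigr => l _.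
    by case: ifP => _; rewrite ?exp1rz // exprz_inv.
  by move=> l _; rewrite hr // expfzMl.
have lr (e : I -> int) : lim0 (fun t => \prod_l r l t ^ e l) (\prod_l r0 l ^ e l).
  by apply: lim0_prod => l _; apply: lim0Xz.
have lx (k : K) (e : I -> int) : \sum_(l | dir al be l != 0) e l = 0 ->
    lim0 (fun t => k * \prod_l h l (P t) (Q t) ^ e l) (k * \prod_l r0 l ^ e l).
  move=> s0; apply: lim0_eq (lim0M (lim0_cst k) (lr e)).
  by apply: cofin_sub (cofin_neq 0) => t t0; rewrite prodr // s0 mul1r.
have xl := lx k1 a sa; have yl := lx k2 b sb.
pose v i t := pt (X (P t) (Q t)) (Y (P t) (Q t)) i.
pose v0 := pt (k1 * \prod_l r0 l ^ a l) (k2 * \prod_l r0 l ^ b l).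
have vl i : lim0 (v i) (v0 i).
  by move: i; elim/ord3P => //; exact: lim0_cst.
set C := \sum_(l | _) c l.
have main (s r' : K) (x : K -> K) (x0 : K) i : s != 0 -> lim0 x x0 ->
    cofin (fun t => x t * F^`M(i).@[fun i => v i t] = (s / t + r') * F.@[fun i => v i t]) -> 0 < C.
  move=> s0 x0l e.
  have ul : lim0 (fun t => (r' * t + s) * (k3 * \prod_l r l t ^ (- c l)))
       (s * (k3 * \prod_l r0 l ^ (- c l))).
    by apply: lim0M (lim0_affine _ _) (lim0M (lim0_cst _) (lr _)).
  have u0 : s * (k3 * \prod_l r0 l ^ (- c l)) != 0.
    by rewrite !mulf_neq0 ?(horn_k3 H) //; apply/prodf_neq0 => l _; rewrite expfz_neq0.
  (* F alone has order [C]; the pole of p or q lowers the order of the product by one. *)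
  have [] := lim0_order (z := C - 1) (lim0M x0l (lim0_meval F^`M(i) vl)) ul u0.
    apply: cofin_sub2 (cofin_neq 0) (cofinI e UPQ) => t t0 [-> Ut].
    have [-> _ _] := horn_eq H Ut; rewrite prodr // sumrN opprK -/C expfzDr // exprN1.
    by field.
  by rewrite subr_ge0 gtz0_ge1.
case/orP: ab0 => n0.
  apply: (main al p _ _ o0 n0 xl).
  by apply: cofin_sub UPQ => t Ut; have [_ -> _] := horn_eq H Ut.
apply: (main be q _ _ o1 n0 yl).
by apply: cofin_sub UPQ => t Ut; have [_ _ ->] := horn_eq H Ut.
Qed.

End HornConsequences.

Section JacMonomial.
Variable K : numClosedFieldType.
Local Notation B := {poly {poly K}}.
Variables (F : {mpoly K[3]}) (I : finType) (a b c : I -> int) (k1 k2 k3 : K).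
Hypothesis H : horn_data F a b c k1 k2 k3.
Local Notation h l := (line a b c l : K -> K -> K).
Local Notation off := (@off_lines K I a b c).

(** Multiplied by the square of the product of the lines, the Jacobian becomes a polynomial [N]
    vanishing only on them, so [line_factor] applies. The remaining factor in q is constant: a root
    would make [N] vanish for every p, but for each q the lines meet only finitely many p. *)
Lemma jac_monomial : exists (cst : K) (m : I -> int), cst != 0 /\
  forall p q, off p q -> jac a b c p q = cst * \prod_l h l p q ^ m l.
Proof.
pose k l : K := (a l)%:~R + 'i * (b l)%:~R.
have k0 l : k l != 0.
  by apply: contraTneq (horn_dir H l) => /imag_irrational[-> ->]; rewrite eqxx.
pose L l : B := (k l)%:P *: 'X + ((b l)%:~R *: 'X + (c l)%:~R%:P)%:P.
pose Lc l : B := \prod_(j | j != l) L j.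
pose N : B := (\sum_l ((a l)%:~R ^+ 2)%:P%:P * Lc l) * (\sum_l ((b l)%:~R ^+ 2)%:P%:P * Lc l) -
  (\sum_l ((a l)%:~R * (b l)%:~R)%:P%:P * Lc l) ^+ 2.
pose ev p q := [the {rmorphism B -> K} of horner_eval q \o horner_eval p%:P].
have evC p q s : ev p q s%:P%:P = s by rewrite /= /horner_eval !hornerC.
have evL p q l : ev p q (L l) = h l p (q + 'i * p).
  by rewrite /= /horner_eval /L /line !hornerE /= /k; ring.
have evN p q : off p (q + 'i * p) ->
    ev p q N = jac a b c p (q + 'i * p) * (\prod_l h l p (q + 'i * p)) ^+ 2.
  move=> U; have evS (s : I -> K) : ev p q (\sum_l (s l)%:P%:P * Lc l) =
      (\sum_l s l / h l p (q + 'i * p)) * \prod_l h l p (q + 'i * p).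
    rewrite rmorph_sum mulr_suml; apply: eq_bigr => l _.
    have evLc : ev p q (Lc l) = \prod_(j | j != l) h j p (q + 'i * p).
      by rewrite rmorph_prod; apply: eq_bigr => j _; rewrite evL.
    rewrite rmorphM evC evLc [X in _ = _ * X](bigD1 l) //=.
    by move: (\prod_(_ | _) _) => P; field; apply: U.
  by rewrite /N rmorphB rmorphXn rmorphM !evS /jac; ring.
pose x l : {poly K} := (- (k l)^-1) *: ((b l)%:~R *: 'X + (c l)%:~R%:P).
have hx l p q : h l p (q + 'i * p) = k l * (p - (x l).[q]).
  by rewrite /x !hornerE /line /k; field; apply: k0.
have [p0 [q0 U0]] := off_lines_ex H.
have N0 : N != 0.
  have : ev p0 (q0 - 'i * p0) N != 0.
    rewrite evN ?subrK // mulf_neq0 ?expf_neq0 //; first exact: (jac_neq0 H).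
    by apply/prodf_neq0 => l _.
  by apply: contraNneq => ->; rewrite rmorph0.
have zero p q : N.[p%:P].[q] = 0 -> exists l, p = (x l).[q].
  move=> Npq; case: (boolP [forall l, h l p (q + 'i * p) != 0]) => [/forallP U|].
    have := evN p q U; rewrite [LHS]Npq => /esym/eqP.
    rewrite mulf_eq0 (negPf (jac_neq0 H U)) expf_eq0 /= => /prodf_eq0[l _].
    by rewrite (negPf (U l)).
  rewrite negb_forall => /existsP[l]; rewrite negbK hx mulf_eq0 (negPf (k0 l)) /= subr_eq0.
  by move=> /eqP; exists l.
have [n0 [e NE]] := line_factor (x := x) N0 (oner_neq0 _) (fun p q _ => @zero p q).
have sn0 : size n0 == 1%N.
  apply/negPn/negP => /closed_rootP[q nq].
  have : cofin (fun p => forall l, p != (x l).[q]).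
    by apply: cofin_forall => l; apply: cofin_neq.
  move=> /cofin_ex[p px]; have [|l /eqP] := zero p q; last by rewrite (negPf (px l)).
  by rewrite NE !hornerE (eqP nq) mul0r.
have [n n_neq0 nE] : exists2 n : K, n != 0 & n0 = n%:P.
  by have /size_poly1P[n ? ?] := sn0; exists n.
exists (n * \prod_l k l ^- e l), (fun l => (e l)%:Z - 2); split.
  by rewrite mulf_neq0 //; apply/prodf_neq0 => l _; rewrite invr_neq0 // expf_neq0.
move=> p q U; pose q' := q - 'i * p; have qE : q = q' + 'i * p by rewrite /q' subrK.
have U' : off p (q' + 'i * p) by rewrite -qE.
have P0 : (\prod_l h l p q) ^+ 2 != 0.
  by rewrite expf_neq0 //; apply/prodf_neq0 => l _.
apply: (mulIf P0); rewrite {1 2}qE -evN // NE.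
rewrite rmorphM nE evC rmorph_prod -mulrA -prodrXl -!big_split -mulrA -big_split /=.
congr (_ * _); apply: eq_bigr => l _.
rewrite /= /horner_eval !(horner_exp, hornerXsubC) hornerD hornerN hornerC qE hx.
rewrite expfzDr ?mulf_neq0 ?subr_eq0 //; last by have := U' l; rewrite hx mulf_eq0 subr_eq0 => /norP[].
have y0 : p - (x l).[q'] != 0 by have := U' l; rewrite hx mulf_eq0 => /norP[].
rewrite -[_ ^ (e l)]/(_ ^+ e l) exprMn -exprnN.
by field; rewrite ?expf_neq0 ?mulf_neq0 ?k0 ?y0.
Qed.

End JacMonomial.

(** * Sums of simple poles that are monomials *)

Section SimplePoles.
Variable K : numClosedFieldType.
Variables (I : finType) (P : pred I) (r R : I -> K) (m : I -> int) (cst : K).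
Hypothesis r_inj : {in P &, injective r}.
Hypothesis cst0 : cst != 0.
Hypothesis E : forall q, (forall l, P l -> q != r l) ->
  \sum_(l | P l) R l / (q - r l) = cst * \prod_(l | P l) (q - r l) ^ m l.

(** A nonzero residue is a pole of order exactly one, and with residue 0 the sum is regular at the
    point. *)
Lemma simple_pole l0 : P l0 -> (R l0 != 0 -> m l0 = -1) /\ (R l0 = 0 -> 0 <= m l0).
Proof.
move=> Pl0.
have rd l : P l && (l != l0) -> r l0 - r l != 0.
  by move=> /andP[Pl ll0]; rewrite subr_eq0; apply: contraNneq ll0 => /r_inj ->.
have lr l : lim0 (fun t => r l0 + t - r l) (r l0 - r l).
  by apply: lim0_eq (lim0_affine 1 (r l0 - r l)); apply: cofin_all => t; ring.
have l1 : lim0 (fun t => R l0 + t * \sum_(l | P l && (l != l0)) R l / (r l0 + t - r l)) (R l0).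
  have : lim0 (fun t => \sum_(l | P l && (l != l0)) R l / (r l0 + t - r l))
      (\sum_(l | P l && (l != l0)) R l / (r l0 - r l)).
    by apply: lim0_sum => l /rd ?; apply: lim0_div (lim0_cst _) (lr l).
  by move=> s; have := lim0D (lim0_cst (R l0)) (lim0M (lim0_id K) s); rewrite mul0r addr0.
have l2 : lim0 (fun t => cst * \prod_(l | P l && (l != l0)) (r l0 + t - r l) ^ m l)
    (cst * \prod_(l | P l && (l != l0)) (r l0 - r l) ^ m l).
  by apply: lim0M (lim0_cst _) _; apply: lim0_prod => l /rd ?; apply: lim0Xz.
have u0 : cst * \prod_(l | P l && (l != l0)) (r l0 - r l) ^ m l != 0.
  by rewrite mulf_neq0 //; apply/prodf_neq0 => l /rd ?; rewrite expfz_neq0.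
have gen : cofin (fun t => forall l, P l -> r l0 + t != r l).
  apply: cofin_forall => l; apply: cofin_sub (cofin_neq (r l - r l0)) => t tl _.
  by apply: contraNneq tl => <-; rewrite [r l0 + t]addrC addrK.
have [] := lim0_order (z := m l0 + 1) l1 l2 u0.
  apply: cofin_sub2 (cofin_neq 0) gen => t t0 g.
  have := E g; rewrite !(bigD1 l0 Pl0) /=.
  have -> : r l0 + t - r l0 = t by ring.
  move=> e; rewrite expfzDr // expr1z.
  transitivity (t * (R l0 / t + \sum_(l | P l && (l != l0)) R l / (r l0 + t - r l))).
    by move: (\sum_(_ | _) _) => s; field.
  by rewrite e; ring.
move=> _ n z; split=> [/n[]|/z]; lia.
Qed.

(** At infinity the left side behaves like the sum of the residues divided by q. *)
Lemma simple_pole_sum : \sum_(l | P l) R l != 0 -> \sum_(l | P l) m l = -1.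
Proof.
move=> s0.
have k l : lim0 (fun t : K => 1 - r l * t) 1.
  by apply: lim0_eq (lim0_affine (- r l) 1); apply: cofin_all => t; ring.
have l1 : lim0 (fun t => \sum_(l | P l) R l / (1 - r l * t)) (\sum_(l | P l) R l).
  apply: lim0_sum => l _; rewrite -{2}[R l]divr1.
  by apply: lim0_div (lim0_cst _) (k l); rewrite oner_neq0.
have l2 : lim0 (fun t => cst * \prod_(l | P l) (1 - r l * t) ^ m l) cst.
  rewrite -{2}[cst]mulr1; apply: lim0M (lim0_cst _) _.
  have : lim0 (fun t => \prod_(l | P l) (1 - r l * t) ^ m l) (\prod_(l | P l) 1 ^ m l).
    by apply: lim0_prod => l _; apply: lim0Xz (k l); rewrite oner_neq0.
  by rewrite big1 // => l _; rewrite exp1rz.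
have [|_ n _] := lim0_order (z := - (\sum_(l | P l) m l) - 1) l1 l2 cst0.
  have gen : cofin (fun t : K => forall l, 1 - r l * t != 0).
    by apply: cofin_forall => l; apply: lim0_nz (k l); rewrite oner_neq0.
  apply: cofin_sub2 (cofin_neq 0) gen => t t0 g.
  have qr l : t^-1 - r l = t^-1 * (1 - r l * t) by field.
  have qr0 l : P l -> t^-1 != r l by rewrite -subr_eq0 qr mulf_neq0 ?invr_neq0.
  have := E qr0; under [X in _ = _ * X]eq_bigr do rewrite qr expfzMl.
  rewrite big_split /= => e.
  have pw : \prod_(l | P l) t^-1 ^ m l = t ^ (- \sum_(l | P l) m l).
    rewrite -sumrN (big_morph (fun z => t ^ z) (id1 := 1) (op1 := *%R)) //; last first.
      by move=> x y; rewrite expfzDr.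
    by apply: eq_bigr => l _; rewrite exprz_inv.
  rewrite pw in e; rewrite expfzDr // exprN1 mulrAC -[RHS]mulrA -[in RHS]mulrA.
  transitivity (t^-1 * \sum_(l | P l) R l / (t^-1 - r l)).
    rewrite mulr_sumr; apply: eq_bigr => l _; rewrite qr; field.
    by rewrite t0 (g l).
  by rewrite e; ring.
by have [+ _] := n s0; lia.
Qed.
End SimplePoles.

Lemma pole_zero (K : numClosedFieldType) (I : finType) (P : pred I) (r R : I -> K) :
  {in P &, injective r} ->
  (forall q, (forall l, P l -> q != r l) -> \sum_(l | P l) R l / (q - r l) = 0) ->
  forall l, P l -> R l = 0.
Proof.
move=> r_inj E l0 Pl0.
have rd l : P l && (l != l0) -> r l0 - r l != 0.
  by move=> /andP[Pl ll0]; rewrite subr_eq0; apply: contraNneq ll0 => /r_inj ->.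
have lr l : lim0 (fun t => r l0 + t - r l) (r l0 - r l).
  by apply: lim0_eq (lim0_affine 1 (r l0 - r l)); apply: cofin_all => t; ring.
have l1 : lim0 (fun t => R l0 + t * \sum_(l | P l && (l != l0)) R l / (r l0 + t - r l)) (R l0).
  have : lim0 (fun t => \sum_(l | P l && (l != l0)) R l / (r l0 + t - r l))
      (\sum_(l | P l && (l != l0)) R l / (r l0 - r l)).
    by apply: lim0_sum => l /rd ?; apply: lim0_div (lim0_cst _) (lr l).
  by move=> s; have := lim0D (lim0_cst (R l0)) (lim0M (lim0_id K) s); rewrite mul0r addr0.
apply: lim0_unique l1 (lim0_eq _ (lim0_cst 0)).
have gen : cofin (fun t => forall l, P l -> r l0 + t != r l).
  apply: cofin_forall => l; apply: cofin_sub (cofin_neq (r l - r l0)) => t tl _.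
  by apply: contraNneq tl => <-; rewrite [r l0 + t]addrC addrK.
apply: cofin_sub2 (cofin_neq 0) gen => t t0 g.
have := E _ g; rewrite (bigD1 l0 Pl0) /=.
have -> : r l0 + t - r l0 = t by ring.
move/(congr1 (fun x => t * x)); rewrite mulr0 => e.
by rewrite -[LHS]e; move: (\sum_(_ | _) _) => s; field.
Qed.

(** * The Jacobian at infinity along a class of parallel lines *)

Section ClassAtInfinity.
Variable K : numClosedFieldType.
Variables (I : finType) (al be ga : I -> K) (m : I -> int) (cst : K).
Let L l p q := al l * p + be l * q + ga l.
Hypotheses (sal : \sum_l al l = 0) (sbe : \sum_l be l = 0) (cst0 : cst != 0).
Hypothesis HJ : forall p q, (forall l, L l p q != 0) ->
  (\sum_l al l ^+ 2 / L l p q) * (\sum_l be l ^+ 2 / L l p q) -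
  (\sum_l al l * be l / L l p q) ^+ 2 = cst * \prod_l L l p q ^ m l.
Local Notation Z := (fun l => al l == 0).
Hypothesis be0 : forall l, Z l -> be l != 0.
Let r l := - ga l / be l.
Hypothesis r_inj : {in Z &, injective r}.
Let M := \sum_(l | Z l) be l.
Let C := \sum_(l | ~~ Z l) ga l.
Let kap l := be l * C + M * ga l.
Let Phi q := \sum_(l | Z l) (- kap l) / (q - r l).

(* With q fixed and p = 1 / t -> oo, t^-2 J tends to
   (M q - C) \sum_Z be^2 / (be q + ga) - M^2 = Phi q. *)
Lemma class_limit q : (forall l, Z l -> q != r l) ->
  [/\ 0 <= - 2 - \sum_(l | ~~ Z l) m l,
   Phi q != 0 -> - 2 - \sum_(l | ~~ Z l) m l = 0 /\
     Phi q = cst * \prod_(l | ~~ Z l) al l ^ m l * \prod_(l | Z l) (be l * q + ga l) ^ m l &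
   Phi q = 0 -> 0 < - 2 - \sum_(l | ~~ Z l) m l].
Proof.
move=> qr; pose k l t := al l + t * (be l * q + ga l).
have kl l : lim0 (k l) (al l).
  by apply: lim0_eq (lim0_affine (be l * q + ga l) (al l)); apply: cofin_all => t; rewrite /k; ring.
have hZ l : Z l -> be l * q + ga l != 0.
  move=> Zl; have := qr l Zl; apply: contraNneq => e; apply/eqP; rewrite /r.
  by apply: (mulfI (be0 Zl)); rewrite mulrCA divff ?be0 // mulr1; apply/eqP; rewrite -addr_eq0 e.
pose S := \sum_(l | Z l) be l ^+ 2 / (be l * q + ga l).
have lA : lim0 (fun t => - \sum_(l | ~~ Z l) al l * (be l * q + ga l) / k l t)
    (- \sum_(l | ~~ Z l) (be l * q + ga l)).
  apply: lim0N; apply: lim0_sum => l nZ.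
  by have := lim0_div nZ (lim0_cst (al l * (be l * q + ga l))) (kl l); rewrite mulrAC divff // mul1r.
have lG : lim0 (fun t => S + t * \sum_(l | ~~ Z l) be l ^+ 2 / k l t) S.
  have : lim0 (fun t => \sum_(l | ~~ Z l) be l ^+ 2 / k l t) (\sum_(l | ~~ Z l) be l ^+ 2 / al l).
    by apply: lim0_sum => l nZ; apply: lim0_div (lim0_cst _) (kl l).
  by move=> s; have := lim0D (lim0_cst S) (lim0M (lim0_id K) s); rewrite mul0r addr0.
have lE : lim0 (fun t => \sum_(l | ~~ Z l) al l * be l / k l t) (\sum_(l | ~~ Z l) be l).
  apply: lim0_sum => l nZ.
  by have := lim0_div nZ (lim0_cst (al l * be l)) (kl l); rewrite mulrAC divff // mul1r.
have l1 := lim0B (lim0M lA lG) (lim0X 2 lE).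
have l2 : lim0 (fun t => cst * \prod_(l | Z l) (be l * q + ga l) ^ m l * \prod_(l | ~~ Z l) k l t ^ m l)
    (cst * \prod_(l | Z l) (be l * q + ga l) ^ m l * \prod_(l | ~~ Z l) al l ^ m l).
  by apply: lim0M (lim0_cst _) _; apply: lim0_prod => l nZ; apply: lim0Xz (kl l).
have w0 : cst * \prod_(l | Z l) (be l * q + ga l) ^ m l * \prod_(l | ~~ Z l) al l ^ m l != 0.
  rewrite !mulf_neq0 //; apply/prodf_neq0 => l ?; rewrite expfz_neq0 //; exact: hZ.
have [|] := lim0_order (z := - 2 - \sum_(l | ~~ Z l) m l) l1 l2 w0.
  have gen : cofin (fun t => forall l, ~~ Z l -> k l t != 0).
    apply: cofin_forall => l; case: (boolP (Z l)) => [_|nZ]; first by apply: cofin_all.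
    by apply: cofin_sub (lim0_nz nZ (kl l)).
  apply: cofin_sub2 (cofin_neq 0) gen => t t0 g.
  have LZ l : Z l -> L l t^-1 q = be l * q + ga l by rewrite /L => /eqP ->; rewrite mul0r add0r.
  have LnZ l : L l t^-1 q = t^-1 * k l t by rewrite /L /k; field.
  have U l : L l t^-1 q != 0.
    by case: (boolP (Z l)) => Zl; [rewrite LZ ?hZ | rewrite LnZ mulf_neq0 ?invr_neq0 ?g].
  have := HJ U.
  have split2 (s : I -> K) : \sum_l s l / L l t^-1 q =
      \sum_(l | Z l) s l / (be l * q + ga l) + t * \sum_(l | ~~ Z l) s l / k l t.
    rewrite (bigID Z) /=; congr (_ + _); first by apply: eq_bigr => l Zl; rewrite LZ.
    rewrite mulr_sumr; apply: eq_bigr => l nZ; rewrite LnZ; field.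
    by rewrite t0 g.
  rewrite !split2.
  have -> : \sum_(l | Z l) al l ^+ 2 / (be l * q + ga l) = 0.
    by rewrite big1 // => l /eqP ->; rewrite expr0n mul0r.
  have -> : \sum_(l | Z l) al l * be l / (be l * q + ga l) = 0.
    by rewrite big1 // => l /eqP ->; rewrite !mul0r.
  (* Here al^2 / k = al - t al (be q + ga) / k, and the leading terms cancel because the al sum to
     0; this yields the second factor t. *)
  have -> : \sum_(l | ~~ Z l) al l ^+ 2 / k l t =
      t * - \sum_(l | ~~ Z l) al l * (be l * q + ga l) / k l t.
    have sal' : \sum_(l | ~~ Z l) al l = 0.
      by have := sal; rewrite (bigID Z) /= big1 ?add0r // => l /eqP.
    rewrite -[LHS]subr0 -[X in _ - X]sal' -sumrB mulrN mulr_sumr -sumrN; apply: eq_bigr => l nZ.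
    by have := g l nZ; rewrite /k => ?; field.
  have -> : \prod_l L l t^-1 q ^ m l = \prod_(l | Z l) (be l * q + ga l) ^ m l *
      (\prod_(l | ~~ Z l) t^-1 ^ m l * \prod_(l | ~~ Z l) k l t ^ m l).
    rewrite (bigID Z) /= -big_split /=; congr (_ * _); apply: eq_bigr => l Zl.
      by rewrite LZ.
    by rewrite LnZ expfzMl.
  have -> : \prod_(l | ~~ Z l) t^-1 ^ m l = t ^ (- \sum_(l | ~~ Z l) m l).
    rewrite -sumrN (big_morph (fun z => t ^ z) (id1 := 1) (op1 := *%R)) //; last first.
      by move=> x y; rewrite expfzDr.
    by apply: eq_bigr => l _; rewrite exprz_inv.
  rewrite -/S expfzDr // => e.
  have -> : t ^ (-2 : int) = t^-1 ^+ 2 by rewrite exprVn.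
  apply: (mulfI (expf_neq0 2 t0)).
  transitivity (cst * (\prod_(l | Z l) (be l * q + ga l) ^ m l *
    (t ^ (- \sum_(l | ~~ Z l) m l) * \prod_(l | ~~ Z l) k l t ^ m l))).
    by rewrite -e; ring.
  have shuffle (w T P Q : K) : w * (P * (T * Q)) = t ^+ 2 * (t^-1 ^+ 2 * T * (w * P * Q)) by field.
  exact: shuffle.
suff -> : Phi q = - (\sum_(l | ~~ Z l) (be l * q + ga l)) * S - (\sum_(l | ~~ Z l) be l) ^+ 2.
  by move=> z n v; split=> // P0; have [-> ->] := n P0; split=> //; ring.
have sbe' : \sum_(l | ~~ Z l) be l = - M.
  by have := sbe; rewrite (bigID Z) /= -/M => /eqP; rewrite addrC addr_eq0 => /eqP.
rewrite big_split /= -mulr_suml sbe' -/C.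
transitivity (\sum_(l | Z l) (be l ^+ 2 / (be l * q + ga l) * (M * q - C) - M * be l)); last first.
  by rewrite sumrB -mulr_suml -mulr_sumr -/M -/S; ring.
apply: eq_bigr => l Zl; rewrite /r /kap; have b0 := be0 Zl; have hl := hZ l Zl.
have -> : q - - ga l / be l = (be l * q + ga l) / be l by field.
by field; rewrite b0 hl.
Qed.

(** A nonzero [kap] gives [Phi] a pole, so [Phi] is not identically zero and fixes the order at
    infinity. Then [Phi] is itself a monomial in the lines of the class, and its poles and its order
    at infinity give the exponents. *)
Lemma class_at_infinity l1 : Z l1 -> kap l1 != 0 ->
  [/\ \sum_(l | ~~ Z l) m l = -2,
   forall l, Z l -> (kap l != 0 -> m l = -1) /\ (kap l = 0 -> 0 <= m l) &
   \sum_(l | Z l) kap l != 0 -> \sum_(l | Z l) m l = -1].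
Proof.
move=> Z1 k1.
have sm : \sum_(l | ~~ Z l) m l = -2.
  have [q0 [qr Phi0]] : exists q, (forall l, Z l -> q != r l) /\ Phi q != 0.
    apply: NNPP => nex; move: k1; rewrite -oppr_eq0; apply/negP; rewrite negbK; apply/eqP.
    apply: (pole_zero r_inj (R := fun l => - kap l)) Z1 => q qr.
    by apply/eqP/negPn/negP => Phi0; apply: nex; exists q.
  by have [_ /(_ Phi0)[+ _] _] := class_limit qr; lia.
pose cst' := cst * \prod_(l | ~~ Z l) al l ^ m l * \prod_(l | Z l) be l ^ m l.
have cst'0 : cst' != 0.
  by rewrite !mulf_neq0 //; apply/prodf_neq0 => l ?; rewrite expfz_neq0 ?be0.
(* With exponent sum -2 the last case of [class_limit] is void, so [Phi] has no zero off the
   lines. *)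
have E q : (forall l, Z l -> q != r l) -> Phi q = cst' * \prod_(l | Z l) (q - r l) ^ m l.
  move=> qr; have [_ n z] := class_limit qr; have Phi0 : Phi q != 0.
    by apply/eqP => /z; rewrite sm.
  have [_ ->] := n Phi0; rewrite /cst' -!mulrA -big_split /=; congr (_ * (_ * _)).
  apply: eq_bigr => l Zl; rewrite -expfzMl; congr (_ ^ _); rewrite /r.
  by have := be0 Zl => ?; field.
split=> // [l Zl|].
  have [p1 p2] := simple_pole r_inj cst'0 E Zl.
  split=> [k0|k0]; first by apply: p1; rewrite oppr_eq0.
  by apply: p2; rewrite k0 oppr0.
move=> s0; have := simple_pole_sum cst'0 E; apply.
by rewrite sumrN oppr_eq0.
Qed.

End ClassAtInfinity.

(** * Classes of parallel lines *)

Section DirectionClasses.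
Variable K : numClosedFieldType.
Variables (F : {mpoly K[3]}) (I : finType) (a b c : I -> int) (k1 k2 k3 : K).
Hypothesis H : horn_data F a b c k1 k2 k3.
Variables (cst : K) (m : I -> int).
Hypothesis cst0 : cst != 0.
Local Notation h l := (line a b c l : K -> K -> K).
Hypothesis HJ : forall p q, @off_lines K I a b c p q ->
  jac a b c p q = cst * \prod_l h l p q ^ m l.

Definition par l0 l := a l * b l0 == a l0 * b l.

Definition lam l0 l : K :=
  if a l0 != 0 then (a l)%:~R / (a l0)%:~R else (b l)%:~R / (b l0)%:~R.

(** The total of the vectors (a, b) over the class, in units of the vector of [l0]. *)
Definition cmass l0 : K := \sum_(l | par l0 l) lam l0 l.

Lemma par_refl l : par l l. Proof. by rewrite /par. Qed.

Lemma par_sym l l' : par l l' = par l' l.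
Proof. by rewrite /par eq_sym. Qed.

Lemma lamP l0 l : par l0 l ->
  (a l)%:~R = lam l0 l * (a l0)%:~R /\ (b l)%:~R = lam l0 l * (b l0)%:~R.
Proof.
move=> /eqP e; have eK : (a l)%:~R * (b l0)%:~R = (a l0)%:~R * (b l)%:~R :> K.
  by rewrite -!rmorphM /= e.
rewrite /lam; case: (eqVneq (a l0) 0) => [a0|a0] /=.
  have b0 : (b l0)%:~R != 0 :> K by have := horn_dir H l0; rewrite a0 eqxx intr_eq0.
  rewrite a0 divfK // mulr0; split=> //; move: eK; rewrite a0 mul0r => /eqP.
  by rewrite mulf_eq0 (negPf b0) orbF => /eqP.
have a0' : (a l0)%:~R != 0 :> K by rewrite intr_eq0.
by rewrite divfK //; split=> //; apply: (mulfI a0'); rewrite -eK; field.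
Qed.

Lemma lam_neq0 l0 l : par l0 l -> lam l0 l != 0.
Proof.
move=> /lamP[ea eb]; have := horn_dir H l; rewrite -!(intr_eq0 K) ea eb.
by apply: contraTneq => ->; rewrite !mul0r eqxx.
Qed.

Lemma lam_self l : lam l l = 1.
Proof.
rewrite /lam; case: (eqVneq (a l) 0) => [a0|a0] /=; rewrite divff ?intr_eq0 //.
by have := horn_dir H l; rewrite a0 eqxx.
Qed.

Lemma par_trans l1 l2 l3 : par l1 l2 -> par l2 l3 -> par l1 l3.
Proof.
move=> /lamP[ea eb] /lamP[ea' eb']; rewrite /par -(eqr_int K) !rmorphM /=.
by rewrite ea' eb' ea eb; apply/eqP; ring.
Qed.

(** This is [horn_pole] in the direction (1, 'i), to which no integral line is parallel, so its sums
    run over all lines. *)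
Lemma csum_gt0 : 0 < \sum_l c l.
Proof.
have d l : (a l)%:~R * 1 + (b l)%:~R * 'i != 0 :> K.
  rewrite mulr1 [_ * 'i]mulrC; apply: contraTneq (horn_dir H l) => /imag_irrational[-> ->].
  by rewrite eqxx.
have := horn_pole (al := 1) (be := 'i) H; rewrite oner_neq0 /= => /(_ isT).
have E (f : I -> int) : \sum_(l | (a l)%:~R * 1 + (b l)%:~R * 'i != 0 :> K) f l = \sum_l f l.
  by apply: eq_bigl => l; rewrite d.
by rewrite !E (horn_suma H) (horn_sumb H); apply.
Qed.

Lemma sum_par l0 : (\sum_(l | par l0 l) (a l)%:~R = cmass l0 * (a l0)%:~R) /\
  (\sum_(l | par l0 l) (b l)%:~R = cmass l0 * (b l0)%:~R).
Proof.
by split; rewrite /cmass mulr_suml; apply: eq_bigr => l /lamP[].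
Qed.

(** This is [horn_pole] in the direction of the class itself; mass 0 balances the exponents of the
    remaining lines. *)
Lemma cnonpar_gt0 l0 : cmass l0 = 0 -> 0 < \sum_(l | ~~ par l0 l) c l.
Proof.
move=> M0; have d l : ((a l)%:~R * (b l0)%:~R + (b l)%:~R * - (a l0)%:~R != 0 :> K) = ~~ par l0 l.
  by rewrite mulrN subr_eq0 [(b l)%:~R * _]mulrC -!rmorphM /= eqr_int.
have [sa sb] := sum_par l0; rewrite M0 !mul0r in sa sb.
have s (f : I -> int) : \sum_l f l = 0 -> \sum_(l | par l0 l) (f l)%:~R = 0 :> K ->
    \sum_(l | ~~ par l0 l) f l = 0.
  move=> s0; rewrite -rmorph_sum /= => /eqP; rewrite intr_eq0 => /eqP p0.
  by move: s0; rewrite (bigID (par l0)) /= p0 add0r.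
have := horn_pole (al := (b l0)%:~R) (be := - (a l0)%:~R) H.
rewrite oppr_eq0 !intr_eq0 orbC (horn_dir H l0) => /(_ isT).
have E (f : I -> int) : \sum_(l | (a l)%:~R * (b l0)%:~R + (b l)%:~R * - (a l0)%:~R != 0 :> K) f l =
    \sum_(l | ~~ par l0 l) f l.
  by apply: eq_bigl => l; rewrite d.
by rewrite !E s ?(horn_suma H) // s ?(horn_sumb H) //; apply.
Qed.

Lemma quad_form (x1 x2 y1 y2 p q : K) :
  \sum_l ((a l)%:~R * x1 + (b l)%:~R * x2) * ((a l)%:~R * y1 + (b l)%:~R * y2) / h l p q =
  x1 * y1 * (\sum_l (a l)%:~R ^+ 2 / h l p q) +
  (x1 * y2 + x2 * y1) * (\sum_l (a l)%:~R * (b l)%:~R / h l p q) +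
  x2 * y2 * (\sum_l (b l)%:~R ^+ 2 / h l p q).
Proof.
rewrite !mulr_sumr -!big_split; apply: eq_bigr => l _ /=.
by move: (h l p q)^-1 => t; ring.
Qed.

Definition cout l0 : K := \sum_(l | ~~ par l0 l) (c l)%:~R.
(** Up to sign, the residue on [l] of the limit of the Jacobian at infinity along the class of
    [l0]. *)
Definition kap l0 l : K := lam l0 l * cout l0 + cmass l0 * (c l)%:~R.

(** A change of (p, q) of determinant 1 makes the lines of the class depend on q alone, with
    coefficients [lam]. The residues are not all zero: they sum to the mass times the positive total
    of [c], and for mass 0 each is [lam] times the positive number [cout]. *)
Lemma class_exponents l0 :
  [/\ \sum_(l | ~~ par l0 l) m l = -2,
   forall l, par l0 l -> (kap l0 l != 0 -> m l = -1) /\ (kap l0 l = 0 -> 0 <= m l),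
   cmass l0 != 0 -> \sum_(l | par l0 l) m l = -1 &
   cmass l0 = 0 -> forall l, par l0 l -> m l = -1].
Proof.
have [u1 [u2 [det lamE]]] : exists u1 u2 : K, (b l0)%:~R * u2 + (a l0)%:~R * u1 = 1 /\
    forall l, lam l0 l = (a l)%:~R * u1 + (b l)%:~R * u2.
  have := horn_dir H l0; rewrite /lam; case: (eqVneq (a l0) 0) => [a0|a0] /= b0.
    by exists 0, ((b l0)%:~R)^-1; rewrite a0 divff ?intr_eq0 // mul0r addr0; split=> // l; ring.
  by exists ((a l0)%:~R)^-1, 0; rewrite divff ?intr_eq0 // mulr0 add0r; split=> // l; ring.
pose al l : K := (a l)%:~R * (b l0)%:~R + (b l)%:~R * - (a l0)%:~R.
have alE l : (al l == 0) = par l0 l.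
  by rewrite /al mulrN subr_eq0 [(b l)%:~R * _]mulrC -!rmorphM /= eqr_int.
have sK (f : I -> int) : \sum_l f l = 0 -> \sum_l (f l)%:~R = 0 :> K.
  by move=> s0; rewrite -rmorph_sum s0.
have sal : \sum_l al l = 0.
  by rewrite big_split -!mulr_suml /= !sK ?(horn_suma H) ?(horn_sumb H) // !mul0r addr0.
have sbe : \sum_l lam l0 l = 0.
  by rewrite (eq_bigr _ (fun l _ => lamE l)) big_split -!mulr_suml /= !sK ?(horn_suma H) ?(horn_sumb H) // !mul0r addr0.
have LE l p q : al l * p + lam l0 l * q + (c l)%:~R =
    h l ((b l0)%:~R * p + u1 * q) (- (a l0)%:~R * p + u2 * q).
  by rewrite lamE /al /line; ring.
have HJ' p q : (forall l, al l * p + lam l0 l * q + (c l)%:~R != 0) ->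
    (\sum_l al l ^+ 2 / (al l * p + lam l0 l * q + (c l)%:~R)) *
    (\sum_l lam l0 l ^+ 2 / (al l * p + lam l0 l * q + (c l)%:~R)) -
    (\sum_l al l * lam l0 l / (al l * p + lam l0 l * q + (c l)%:~R)) ^+ 2 =
    cst * \prod_l (al l * p + lam l0 l * q + (c l)%:~R) ^ m l.
  move=> U; set P := (b l0)%:~R * p + u1 * q; set Q := - (a l0)%:~R * p + u2 * q.
  have UPQ : @off_lines K I a b c P Q by move=> l; rewrite -LE.
  transitivity (jac a b c P Q); last by rewrite HJ //; congr (_ * _); apply: eq_bigr => l _; rewrite LE.
  have -> : \sum_l al l ^+ 2 / (al l * p + lam l0 l * q + (c l)%:~R) =
      \sum_l al l * al l / h l P Q.
    by apply: eq_bigr => l _; rewrite LE expr2.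
  have -> : \sum_l lam l0 l ^+ 2 / (al l * p + lam l0 l * q + (c l)%:~R) =
      \sum_l ((a l)%:~R * u1 + (b l)%:~R * u2) * ((a l)%:~R * u1 + (b l)%:~R * u2) / h l P Q.
    by apply: eq_bigr => l _; rewrite LE expr2 lamE.
  have -> : \sum_l al l * lam l0 l / (al l * p + lam l0 l * q + (c l)%:~R) =
      \sum_l al l * ((a l)%:~R * u1 + (b l)%:~R * u2) / h l P Q.
    by apply: eq_bigr => l _; rewrite LE lamE.
  rewrite !quad_form /jac; set A := \sum_l _; set E := \sum_l _; set G := \sum_l _.
  rewrite -[RHS]mulr1 -(expr1n K 2) -[in RHS]det; ring.
have lam0 l : al l == 0 -> lam l0 l != 0 by rewrite alE; apply: lam_neq0.
have r_inj : {in (fun l => al l == 0) &, injective (fun l => - (c l)%:~R / lam l0 l)}.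
  move=> l l' Z Z' e; rewrite unfold_in in Z; rewrite unfold_in in Z'; have l0' := lam0 _ Z; have l0'' := lam0 _ Z'.
  have := Z; have := Z'; rewrite !alE => /lamP[ea' eb'] /lamP[ea eb].
  have ec : (c l)%:~R * lam l0 l' = (c l')%:~R * lam l0 l.
    apply: oppr_inj; rewrite -!mulNr.
    have -> : - (c l)%:~R = (- (c l')%:~R / lam l0 l') * lam l0 l by rewrite -e divfK.
    by field.
  apply: (horn_dist H); apply/eqP; rewrite -(eqr_int K) !rmorphM /= ?ea ?ea' ?eb ?eb'; apply/eqP.
  - by ring.
  - by rewrite mulrAC [_ * (c l')%:~R]mulrC -ec; ring.
  - by rewrite mulrAC [_ * (c l')%:~R]mulrC -ec; ring.
have CE : \sum_(l | ~~ (al l == 0)) (c l)%:~R = cout l0 :> K.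
  by apply: eq_bigl => l; rewrite alE.
have ME : \sum_(l | al l == 0) lam l0 l = cmass l0 by apply: eq_bigl => l; rewrite alE.
have sumkap : \sum_(l | al l == 0) kap l0 l = cmass l0 * (\sum_l c l)%:~R.
  have -> : (\sum_l c l)%:~R = \sum_(l | al l == 0) (c l)%:~R + cout l0 :> K.
    by rewrite rmorph_sum (bigID (fun l => al l == 0)) -CE.
  have E1 : cmass l0 * cout l0 = \sum_(l | al l == 0) lam l0 l * cout l0 by rewrite -ME mulr_suml.
  by rewrite mulrDr E1 mulr_sumr addrC -big_split.
have ckap : cmass l0 = 0 -> forall l, par l0 l -> kap l0 l != 0.
  move=> M0 l pl; rewrite /kap M0 mul0r addr0 mulf_neq0 ?lam_neq0 //.
  by rewrite /cout -rmorph_sum intr_eq0 gt_eqF // cnonpar_gt0.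
have e0 : (\sum_l c l)%:~R != 0 :> K by rewrite intr_eq0 gt_eqF // csum_gt0.
have [l1 Z1 kl1] : exists2 l1, al l1 == 0 & kap l0 l1 != 0.
  case: (eqVneq (cmass l0) 0) => [M0|M0].
    by exists l0; rewrite ?alE ?par_refl // ckap ?par_refl.
  apply: NNPP => nex; have := mulf_neq0 M0 e0; rewrite -sumkap big1 ?eqxx // => l Zl.
  by apply/eqP/negPn/negP => kl; apply: nex; exists l.
have := class_at_infinity sal sbe cst0 HJ' lam0 r_inj Z1.
rewrite ME CE => /(_ kl1) [s1 s2 s3]; split.
- by rewrite -[RHS]s1; apply: eq_bigl => l; rewrite alE.
- by move=> l pl; apply: s2; rewrite alE.
- move=> M0; rewrite -[RHS]s3; first by apply: eq_bigl => l; rewrite alE.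
  by rewrite -/(kap l0 _) sumkap mulf_neq0.
- by move=> M0 l pl; apply: (s2 l _).1; rewrite ?alE //; apply: ckap.
Qed.

End DirectionClasses.

Section DirectionCount.
Variable K : numClosedFieldType.
Variables (F : {mpoly K[3]}) (I : finType) (a b c : I -> int) (k1 k2 k3 : K).
Hypothesis H : horn_data F a b c k1 k2 k3.
Variables (cst : K) (m : I -> int).
Hypothesis cst0 : cst != 0.
Local Notation h l := (line a b c l : K -> K -> K).
Hypothesis HJ : forall p q, @off_lines K I a b c p q ->
  jac a b c p q = cst * \prod_l h l p q ^ m l.
Local Notation par := (par a b).
Local Notation cmass := (cmass K a b).

Let msum l0 : \sum_(l | ~~ par l0 l) m l = -2.
Proof. by have [] := class_exponents H cst0 HJ l0. Qed.

Let t := \sum_l m l + 2.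

Lemma class_sum l0 : \sum_(l | par l0 l) m l = t.
Proof.
have : \sum_l m l = \sum_(l | par l0 l) m l + -2 by rewrite (bigID (par l0)) /= msum.
by rewrite /t => ->; rewrite subrK.
Qed.

(** Mass 0 makes every exponent of the class -1, and it takes two lines at least, a single one
    having mass 1. *)
Lemma class_sum_mass0 l0 : cmass l0 = 0 -> t = - (#|par l0|)%:Z /\ (1 < #|par l0|)%N.
Proof.
move=> M0; have [_ _ _ /(_ M0) m1] := class_exponents H cst0 HJ l0.
split.
  by rewrite -(class_sum l0) (eq_bigr (fun=> -1)) // sumr_const mulNrn natz.
rewrite ltnNge; apply/negP => /card_le1P; move=> le1.
have := M0; rewrite /cmass (bigD1 l0) ?par_refl //= big1 => [|l /andP[pl ll0]].
  by rewrite addr0 (lam_self H) => /eqP; rewrite oner_eq0.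
by have := le1 l0 (par_refl a b l0) l; rewrite (_ : (l \in _) = true) ?inE ?(negPf ll0).
Qed.

Lemma class_sum_le (l0 : I) : t <= -1.
Proof.
case: (eqVneq (cmass l0) 0) => [/class_sum_mass0[-> ?]|M0]; first by lia.
by have [_ _ /(_ M0) s _] := class_exponents H cst0 HJ l0; rewrite -(class_sum l0) s.
Qed.

(** A union of classes is peeled off one class at a time, each contributing [t] <= -1. *)
Lemma closed_sum_le0 (P : pred I) : (forall l l', P l -> par l l' -> P l') ->
  \sum_(l | P l) m l <= 0.
Proof.
have [n] := ubnP #|P|; elim: n P => // n IH P cP clP.
case: (pickP P) => [l0 Pl0|P0]; last by rewrite big_pred0.
rewrite (bigID (par l0)) /=.
have -> : \sum_(l | P l && par l0 l) m l = t.
  rewrite -(class_sum l0); apply: eq_bigl => l; case pl: (par l0 l); last by rewrite andbF.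
  by rewrite (clP _ _ Pl0 pl).
have := class_sum_le l0; have : \sum_(l | P l && ~~ par l0 l) m l <= 0; last by move=> x y; apply: le_trans (lerD y x) _.
apply: IH => [|l l' /andP[Pl nl] pl'].
  apply: leq_trans (_ : #|P| <= n)%N; last by rewrite -ltnS.
  apply: proper_card; apply/properP; split; first by apply/subsetP => l /andP[].
  by exists l0 => //; rewrite unfold_in /= par_refl andbF.
rewrite (clP _ _ Pl pl') /=; apply: contra nl => p0; apply: par_trans H _ _ _ p0 _.
by rewrite par_sym.
Qed.

Definition two_classes := exists l1 l2, [/\ ~~ par l1 l2, forall l, par l1 l || par l2 l,
  cmass l1 = 0 /\ cmass l2 = 0 & #|par l1| = 2 /\ #|par l2| = 2].

Definition three_classes := exists l1 l2 l3, [/\ [/\ ~~ par l1 l2, ~~ par l1 l3 & ~~ par l2 l3],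
  forall l, [|| par l1 l, par l2 l | par l3 l],
  [/\ cmass l1 != 0, cmass l2 != 0 & cmass l3 != 0] & forall l0, \sum_(l | par l0 l) m l = -1].

(** The classes other than the first have total -2: either one with [t] = -2 or two with [t] = -1.
    Nonzero mass belongs to [t] = -1 and mass 0 to [t] <= -2. *)
Lemma direction_count : two_classes \/ three_classes.
Proof.
have rest (P : pred I) : \sum_(l | P l) m l != 0 -> exists l, P l.
  by case: (pickP P) => [l Pl _|P0]; [exists l|rewrite big_pred0 // eqxx].
have [l1 _] : exists l : I, true.
  have [p [q U]] := off_lines_ex H; have := jac_neq0 H U; rewrite /jac.
  case: (pickP (fun _ : I => true)) => [l _|no]; first by exists l.
  by rewrite !big_pred0 // mul0r expr0n subr0 eqxx.
have [l2 n12] : exists l, ~~ par l1 l by apply: rest; rewrite msum.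
have split2 (P : pred I) l0 : (forall l, par l0 l -> P l) ->
    \sum_(l | P l) m l = t + \sum_(l | P l && ~~ par l0 l) m l.
  move=> sP; rewrite (bigID (par l0)) /= -(class_sum l0); congr (_ + _).
  by apply: eq_bigl => l; case pl: (par l0 l); rewrite ?andbF // (sP _ pl).
have npar l0 l l' : ~~ par l0 l -> par l l' -> ~~ par l0 l'.
  by move=> n p; apply: contra n => q; apply: par_trans H _ _ _ q _; rewrite par_sym.
have t1 l0 : cmass l0 != 0 -> t = -1.
  by move=> M0; have [_ _ /(_ M0) <- _] := class_exponents H cst0 HJ l0; rewrite class_sum.
have s2 := msum l1; rewrite (split2 _ l2) in s2; last by move=> l; apply: npar.
case: (pickP (fun l => ~~ par l1 l && ~~ par l2 l)) => [l3 /andP[n13 n23]|no3]; last first.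
  left; exists l1, l2; rewrite big_pred0 // addr0 in s2.
  have M0 l : cmass l = 0 by apply/eqP/negPn/negP => /t1; rewrite s2.
  have card l : #|par l| = 2 by have [] := class_sum_mass0 (M0 l); rewrite s2 => e _; lia.
  by split=> // l; have := no3 l; rewrite -negb_or => /negbFE.
right; exists l1, l2, l3.
rewrite (split2 _ l3) in s2; last by move=> l p; rewrite (npar _ _ _ n13 p) (npar _ _ _ n23 p).
(* With a fourth class the exponents outside the first would sum to at most -3. *)
case: (pickP (fun l => (~~ par l1 l && ~~ par l2 l) && ~~ par l3 l)) => [l4 /andP[/andP[n14 n24] n34]|no4].
  rewrite (split2 _ l4) in s2; last first.
    by move=> l p; rewrite (npar _ _ _ n14 p) (npar _ _ _ n24 p) (npar _ _ _ n34 p).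
  have := class_sum_le l1.
  have : \sum_(l | [&& ~~ par l1 l && ~~ par l2 l, ~~ par l3 l & ~~ par l4 l]) m l <= 0.
    apply: closed_sum_le0 => l l' /and3P[/andP[a1 a2] a3 a4] p.
    by rewrite (npar _ _ _ a1 p) (npar _ _ _ a2 p) (npar _ _ _ a3 p) (npar _ _ _ a4 p).
  rewrite (eq_bigl (fun l => (~~ par l1 l && ~~ par l2 l && ~~ par l3 l) && ~~ par l4 l)) => [|l]; last by rewrite !andbA.
  have -> : \sum_(l | (~~ par l1 l && ~~ par l2 l && ~~ par l3 l) && ~~ par l4 l) m l = -2 - t - t - t.
    by rewrite -s2; ring.
  by move: (t) => u; lia.
rewrite big_pred0 // addr0 in s2; have tm1 : t = -1 by move: (t) s2 => u; lia.
split=> //.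
- by move=> l; have := no4 l; rewrite -!negb_or => /negbFE; rewrite orbA.
- by split; apply/eqP => /class_sum_mass0[]; rewrite tm1; lia.
- by move=> l0; rewrite class_sum.
Qed.

End DirectionCount.

(** * Three directions in normalised position *)

Section ThreeClasses.
Variable K : numClosedFieldType.
Variables (I : finType) (nu De : I -> K) (m : I -> int) (cst : K).
Hypothesis cst0 : cst != 0.

Definition polar (P : pred I) (z : K) : K := \sum_(l | P l) nu l / (z + De l).
Definition away (P : pred I) (z : K) := forall l, P l -> z + De l != 0.
Definition weight (P : pred I) (z : K) : K := \prod_(l | P l) (z + De l) ^ m l.

(* A class of parallel lines at the normalised positions De; De l = 0 is the
   position where the Jacobian may vanish. *)
Record normal_class (P : pred I) : Prop := NormalClass {
  nc_nu : forall l, P l -> nu l != 0;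
  nc_inj : {in P &, injective De};
  nc_sum : \sum_(l | P l) nu l = 1;
  nc_mean : \sum_(l | P l) nu l * De l = 1;
  nc_m : forall l, P l -> (De l != 0 -> m l = -1) /\ (De l = 0 -> 0 <= m l);
  nc_msum : \sum_(l | P l) m l = -1 }.

(** [tr_jac] is the Jacobian identity: for vectors with V1 + V2 + V3 = 0, the determinant of A V1
    V1^t + B V2 V2^t + C V3 V3^t is a constant times AB + AC + BC. The same relation ties the three
    coordinates by x + y + w = -2. *)
Record triple (P1 P2 P3 : pred I) : Prop := Triple {
  tr1 : normal_class P1; tr2 : normal_class P2; tr3 : normal_class P3;
  tr_jac : forall x y w, x + y + w = - 2 -> away P1 x -> away P2 y -> away P3 w ->
    polar P1 x * polar P2 y + polar P1 x * polar P3 w + polar P2 y * polar P3 w =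
    cst * (weight P1 x * weight P2 y * weight P3 w) }.

Lemma triple12 P1 P2 P3 : triple P1 P2 P3 -> triple P2 P1 P3.
Proof.
case=> t1 t2 t3 J; split=> // x y w e a1 a2 a3.
have := J y x w; rewrite [y + x]addrC => /(_ e a2 a1 a3) E.
by rewrite [weight P2 x * _]mulrC -E; ring.
Qed.

Lemma triple23 P1 P2 P3 : triple P1 P2 P3 -> triple P1 P3 P2.
Proof.
case=> t1 t2 t3 J; split=> // x y w e a1 a2 a3.
have := J x w y; rewrite addrAC => /(_ e a1 a3 a2) E.
by rewrite -[weight P1 x * _ * _]mulrA [weight P3 y * _]mulrC [weight P1 x * _]mulrA -E; ring.
Qed.

Lemma class_away P (s : K) (s0 : s != 0) (z : K) : cofin (fun t => away P (s * t + z)).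
Proof.
apply: cofin_forall => l.
have : cofin (fun t : K => s * t + (z + De l) != 0) by apply: cofin_affine; rewrite s0.
by apply: cofin_sub => t; rewrite addrA.
Qed.

Section Class.
Variable P : pred I.
Hypothesis nP : normal_class P.

(** Away from the special position every exponent is -1, and the exponents sum to -1. *)
Lemma nonspecial_single : (forall l, P l -> De l != 0) ->
  exists2 l, P l & [/\ forall l', P l' -> l' = l, nu l = 1 & De l = 1].
Proof.
move=> ns; have [l Pl] : exists l, P l.
  case: (pickP P) => [l Pl|P0]; first by exists l.
  by have /eqP := nc_sum nP; rewrite big_pred0 // eq_sym oner_eq0.
have m1 l' : P l' -> m l' = -1 by move=> Pl'; apply: (nc_m nP Pl').1; apply: ns.
have cP : (#|P| <= 1)%N.
  have := nc_msum nP; rewrite (eq_bigr (fun=> -1)) // sumr_const mulNrn natz; lia.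
have uniq l' : P l' -> l' = l.
  move=> Pl'; have e : (l' \in P) = (l' == l) := card_le1P cP l Pl l'.
  by apply/eqP; rewrite -e.
exists l => //; have sE (f : I -> K) : \sum_(j | P j) f j = f l.
  rewrite (bigD1 l) //= big1 ?addr0 // => j /andP[/uniq -> ]; by rewrite eqxx.
have n1 : nu l = 1 by rewrite -sE (nc_sum nP).
by split=> //; have := nc_mean nP; rewrite sE n1 mul1r.
Qed.

(** The weighted mean of the positions is 1, so a line at position 0 cannot be alone. *)
Lemma special_other l0 : P l0 -> De l0 = 0 -> exists2 l, P l & l != l0.
Proof.
move=> P0 D0; case: (pickP (fun l => P l && (l != l0))) => [l /andP[? ?]|no]; first by exists l.
have := nc_mean nP; rewrite (bigD1 l0) //= big_pred0 // D0 mulr0 addr0 => /eqP.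
by rewrite eq_sym oner_eq0.
Qed.

Lemma polar_lim l0 s : P l0 -> s != 0 ->
  lim0 (fun t => t * polar P (s * t - De l0)) (nu l0 / s).
Proof.
move=> P0 s0; have dl l : P l && (l != l0) -> De l - De l0 != 0.
  by move=> /andP[Pl ll0]; rewrite subr_eq0; apply: contraNneq ll0 => /(nc_inj nP) ->.
have : lim0 (fun t => nu l0 / s + t * \sum_(l | P l && (l != l0)) nu l / (s * t + (De l - De l0)))
   (nu l0 / s + 0 * \sum_(l | P l && (l != l0)) nu l / (De l - De l0)).
  apply: lim0D (lim0_cst _) (lim0M (lim0_id _) _); apply: lim0_sum => l /dl ?.
  exact: lim0_div (lim0_cst _) (lim0_affine _ _).
rewrite mul0r addr0; apply: lim0_eq; apply: cofin_sub (cofin_neq 0) => t t0.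
rewrite /polar [X in _ = _ * X](bigD1 l0) //= subrK mulrDr; congr (_ + _ * _); first by field; rewrite s0 t0.
by apply: eq_bigr => l _; congr (_ / _); ring.
Qed.

Lemma polar_reg z : away P z -> forall s, lim0 (fun t => polar P (s * t + z)) (polar P z).
Proof.
move=> az s; apply: lim0_sum => l Pl; apply: lim0_div (az l Pl) (lim0_cst _) _.
by apply: lim0_eq (lim0_affine s (z + De l)); apply: cofin_all => t; rewrite addrA.
Qed.
End Class.

(** Both sides have simple poles with nonzero residues, at - De on the left and at De' - 2 on the
    right; poles and residues must agree. *)
Lemma polar_match P P' : normal_class P -> normal_class P' ->
  (forall z, away P z -> away P' (- 2 - z) -> polar P z = - polar P' (- 2 - z)) ->
  forall l, P l -> exists2 l', P' l' & De l' = 2 - De l /\ nu l' = nu l.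
Proof.
move=> nP nP' E l Pl; have := polar_lim nP Pl (oner_neq0 _); rewrite divr1 => l1.
have gen : cofin (fun t => away P (1 * t - De l) /\ away P' (-1 * t + (De l - 2))).
  by apply: cofinI; apply: class_away; rewrite ?oppr_eq0 oner_neq0.
have eq2 t : - 2 - (1 * t - De l) = -1 * t + (De l - 2) by ring.
case: (pickP (fun l' => P' l' && (De l' == 2 - De l))) => [l' /andP[Pl' /eqP dl']|no].
  exists l' => //; split=> //.
  have m1 : - 1 != 0 :> K by rewrite oppr_eq0 oner_neq0.
  have l2 := lim0N (polar_lim nP' Pl' m1); rewrite invrN invr1 mulrN1 opprK in l2.
  apply: lim0_unique l2 (lim0_eq _ l1); apply: cofin_sub gen => t [g1 g2].
  by rewrite E // eq2 // dl' opprB mulrN.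
have az : away P' (De l - 2).
  move=> l' Pl'; have := no l'; rewrite Pl' /=; apply: contraFneq => e.
  by rewrite -subr_eq0 -[_ - _]/(_ + _) -[X in _ == X]e; apply/eqP; ring.
have l2 := lim0M (lim0_id K) (lim0N (polar_reg az (-1))); rewrite mul0r in l2.
have := nc_nu nP Pl; rewrite (lim0_unique l1 (lim0_eq _ l2)) ?eqxx //.
by apply: cofin_sub gen => t [g1 g2]; rewrite E // eq2.
Qed.

Lemma weight_special P l0 : normal_class P -> P l0 -> De l0 = 0 ->
  exists u w, [/\ w != 0, lim0 u w & cofin (fun t => weight P t = t ^ m l0 * u t)].
Proof.
move=> nP P0 D0; exists (fun t => \prod_(l | P l && (l != l0)) (t + De l) ^ m l),
  (\prod_(l | P l && (l != l0)) De l ^ m l).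
have dl l : P l && (l != l0) -> De l != 0.
  by move=> /andP[Pl ll0]; apply: contraNneq ll0 => dl; rewrite (nc_inj nP Pl P0 (etrans dl (esym D0))).
split; first by apply/prodf_neq0 => l /dl ?; rewrite expfz_neq0.
  apply: lim0_prod => l /dl ?; apply: lim0Xz => //.
  by apply: lim0_eq (lim0_affine 1 (De l)); apply: cofin_all => t; rewrite mul1r.
by apply: cofin_all => t; rewrite /weight (bigD1 l0) //= D0 addr0.
Qed.

Lemma weight_reg P z : away P z -> forall s, exists2 w, w != 0 & lim0 (fun t => weight P (s * t + z)) w.
Proof.
move=> az s; exists (weight P z); first by apply/prodf_neq0 => l ?; rewrite expfz_neq0 ?az.
apply: lim0_prod => l Pl; apply: lim0Xz (az l Pl) _.
by apply: lim0_eq (lim0_affine s (z + De l)); apply: cofin_all => t; rewrite addrA.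
Qed.

Section Special.
Variables P1 P2 P3 : pred I.
Hypothesis T : triple P1 P2 P3.
Variable l1 : I.
Hypotheses (P1l : P1 l1) (D1l : De l1 = 0).

Lemma jac_special z : away P2 z -> away P3 (- 2 - z) ->
  exists u w, [/\ w != 0, lim0 u w &
    cofin (fun t => [/\ t != 0, away P1 t, away P3 (-1 * t + (- 2 - z)) &
      polar P1 t * polar P2 z + polar P1 t * polar P3 (-1 * t + (- 2 - z)) +
      polar P2 z * polar P3 (-1 * t + (- 2 - z)) = t ^ m l1 * u t])].
Proof.
move=> a2 a3; have [u [w [w0 uw e]]] := weight_special (tr1 T) P1l D1l.
have [w3 w30 u3] := weight_reg a3 (-1).
have w2 : weight P2 z != 0 by apply/prodf_neq0 => l ?; rewrite expfz_neq0 ?a2.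
exists (fun t => cst * (u t * weight P2 z * weight P3 (-1 * t + (- 2 - z)))), (cst * (w * weight P2 z * w3)).
split; first by rewrite !mulf_neq0.
  exact: lim0M (lim0_cst _) (lim0M (lim0M uw (lim0_cst _)) u3).
have g1 := class_away P1 (oner_neq0 K) 0.
have m1 : - 1 != 0 :> K by rewrite oppr_eq0 oner_neq0.
have g3 := class_away P3 m1 (- 2 - z).
apply: cofin_sub2 (cofinI g1 g3) (cofinI e (cofin_neq 0)) => t [b1 b3] [et t0].
rewrite mul1r addr0 in b1; split=> //.
rewrite (tr_jac T) //; last by ring.
by rewrite et; ring.
Qed.

(** As x tends to 0 the first polar has a pole, while the nonnegative exponent [m l1] keeps the
    Jacobian bounded; the coefficient of the pole must vanish. *)
Lemma special_antisym z : away P2 z -> away P3 (- 2 - z) ->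
  polar P2 z + polar P3 (- 2 - z) = 0.
Proof.
move=> a2 a3; have [u [w [w0 uw e]]] := jac_special a2 a3.
have := polar_lim (tr1 T) P1l (oner_neq0 K); rewrite D1l divr1 => l1'.
have lp3 := polar_reg a3 (-1).
have l2 := lim0D (lim0M l1' (lim0D (lim0_cst (polar P2 z)) lp3))
  (lim0M (lim0_id K) (lim0M (lim0_cst (polar P2 z)) lp3)).
rewrite mul0r addr0 in l2.
have [|_ n _] := lim0_order (z := m l1 + 1) l2 uw w0.
  apply: cofin_sub e => t [t0 _ _ e]; rewrite mul1r subr0 expfzDr // expr1z.
  transitivity (t * (t ^ m l1 * u t)); last by ring.
  by rewrite -e; ring.
apply/eqP/negPn/negP => s0; have [+ _] := n (mulf_neq0 (nc_nu (tr1 T) P1l) s0).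
by have := (nc_m (tr1 T) P1l).2 D1l; lia.
Qed.
End Special.

(** Each antisymmetry pairs the positions of two classes by De -> 2 - De and preserves weights. The
    first class, having a second line, embeds in the third, which therefore is not a single line and
    is special too. Then 0 and 2 both occur with the same weight, and a third line would give [m l1]
    > 0, which the Jacobian excludes. *)
Lemma two_special P1 P2 P3 l1 l2 : triple P1 P2 P3 ->
  P1 l1 -> De l1 = 0 -> P2 l2 -> De l2 = 0 ->
  (exists2 l3, P3 l3 & De l3 = 0) /\
  (exists2 l, P1 l & [/\ De l = 2, nu l = 2^-1, nu l1 = 2^-1 & forall l', P1 l' -> l' = l1 \/ l' = l]).
Proof.
move=> T P1l D1l P2l D2l; have T' := triple12 T.
have A23 z (a2 : away P2 z) (a3 : away P3 (- 2 - z)) := special_antisym T P1l D1l a2 a3.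
have A13 z (a1 : away P1 z) (a3 : away P3 (- 2 - z)) := special_antisym T' P2l D2l a1 a3.
have M13 : forall l, P1 l -> exists2 l', P3 l' & De l' = 2 - De l /\ nu l' = nu l.
  by apply: polar_match (tr1 T) (tr3 T) _ => z a1 a3; apply/eqP; rewrite -addr_eq0 A13.
have [l3 P3l D3l] : exists2 l3, P3 l3 & De l3 = 0.
  case: (pickP (fun l => P3 l && (De l == 0))) => [l /andP[? /eqP ?]|no]; first by exists l.
  have [l P3l [uq _ _]] : exists2 l, P3 l & [/\ forall l', P3 l' -> l' = l, nu l = 1 & De l = 1].
    by apply: nonspecial_single (tr3 T) _ => l Pl; have := no l; rewrite Pl /= => /negbT.
  have [l1' P1' ne] := special_other (tr1 T) P1l D1l.
  have [x Px [dx _]] := M13 _ P1l; have [y Py [dy _]] := M13 _ P1'.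
  move: ne; rewrite (nc_inj (tr1 T) P1' P1l) ?eqxx //.
  by move: dy; rewrite (uq _ Py) -(uq _ Px) dx => /addrI/oppr_inj ->.
split; first by exists l3.
have T'' := triple12 (triple23 T).
have A12 z (a1 : away P1 z) (a2 : away P2 (- 2 - z)) := special_antisym T'' P3l D3l a1 a2.
have M12 : forall l, P1 l -> exists2 l', P2 l' & De l' = 2 - De l /\ nu l' = nu l.
  by apply: polar_match (tr1 T) (tr2 T) _ => z a1 a2; apply/eqP; rewrite -addr_eq0 A12.
have M23 : forall l, P2 l -> exists2 l', P3 l' & De l' = 2 - De l /\ nu l' = nu l.
  by apply: polar_match (tr2 T) (tr3 T) _ => z a2 a3; apply/eqP; rewrite -addr_eq0 A23.
have M31 : forall l, P3 l -> exists2 l', P1 l' & De l' = 2 - De l /\ nu l' = nu l.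
  apply: polar_match (tr3 T) (tr1 T) _ => z a3 a1; apply/eqP; rewrite -addr_eq0 addrC.
  have zE : z = - 2 - (- 2 - z) by ring.
  by rewrite {2}zE A13 // -zE.
have [l P1l' [dl nl]] := M31 _ P3l; rewrite D3l subr0 in dl.
(* Pairing the first class with the second and the second with the third takes position 0 to 2 and
   back to 0. *)
have n3 : nu l3 = nu l1.
  have [y Py [dy ny]] := M12 _ P1l; have [w Pw [dw nw]] := M23 _ Py.
  rewrite -ny -nw; congr (nu _); apply: (nc_inj (tr3 T)) => //.
  by rewrite D3l dw dy D1l subr0 subrr.
have ll1 : l != l1.
  by apply: contra_eqN dl => /eqP ->; rewrite D1l eq_sym pnatr_eq0.
have m_other : m l1 = #|P1|%:Z - 2.
  have := nc_msum (tr1 T); rewrite (bigD1 l1) //= (eq_bigr (fun=> -1)) => [|j /andP[Pj jl]]; last first.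
    apply: (nc_m (tr1 T) Pj).1; apply: contraNneq jl => Dj.
    by rewrite (nc_inj (tr1 T) Pj P1l _) // D1l.
  rewrite sumr_const mulNrn natz (cardD1 l1 P1) (_ : (l1 \in P1) = true) //.
  have -> : #|[predD1 P1 & l1]| = #|(fun i => P1 i && (i != l1))|.
    by apply: eq_card => i; rewrite !inE andbC.
  by move: #|_| => n e; rewrite add1n -[n]/(n); lia.
have [m1|m1] := ltrP 0 (m l1); last first.
  have c2 : (#|P1| <= 2)%N by lia.
  have two l' : P1 l' -> l' = l1 \/ l' = l.
    move=> P1l''; case: (eqVneq l' l1) => [|n1]; first by left.
    case: (eqVneq l' l) => [|n2]; first by right.
    have : (#|[set l1; l; l']| <= #|P1|)%N.
      by apply: subset_leq_card; apply/subsetP => i; rewrite !inE -orbA => /or3P[] /eqP ->.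
    by rewrite -setUA cardsU1 cards2 !inE eq_sym (negPf ll1) eq_sym (negPf n1) [l == l']eq_sym n2; lia.
  have s1 : nu l1 + nu l = 1.
    rewrite -(nc_sum (tr1 T)) (bigD1 l1) //= (bigD1 l) /=; last by rewrite ll1 andbT.
    by rewrite big_pred0 ?addr0 // => j; apply/negP => /andP[/andP[/two[->|->]]]; rewrite eqxx.
  have h : nu l1 = 2^-1.
    have e : 2 * nu l1 = 1 by rewrite -[RHS]s1 nl n3; ring.
    have two0 : 2 != 0 :> K by rewrite pnatr_eq0.
    by apply: (mulfI two0); rewrite e mulfV //.
  by exists l => //; split=> //; rewrite nl n3.
(* As x -> 0 the Jacobian vanishes, which reads nu l1 * S = polar P1 ^+ 2.
   Comparing at infinity and at the double poles, all nu j are 1. *)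
pose S y := \sum_(j | P1 j) nu j / (y + De j) ^+ 2.
have ident y : away P1 y -> away P2 y -> away P3 (- 2 - y) -> nu l1 * S y = polar P1 y ^+ 2.
  move=> a1 a2 a3; have [u [w [w0 uw e]]] := jac_special T P1l D1l a2 a3.
  have e21 : polar P2 y = polar P1 y.
    by apply: (addIr (polar P3 (- 2 - y))); rewrite A23 // A13.
  have := polar_lim (tr1 T) P1l (oner_neq0 K); rewrite D1l divr1 => lt.
  have lS : lim0 (fun t => \sum_(j | P1 j) nu j / ((y + De j) * (1 * t + (y + De j)))) (S y).
    apply: lim0_sum => j Pj; have yj := a1 j Pj; rewrite expr2.
    by apply: lim0_div (lim0_cst _) (lim0M (lim0_cst _) (lim0_affine _ _)); rewrite mulf_neq0.
  have lp := polar_reg a1 1.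
  have lL := lim0B (lim0M lt lS) (lim0M (lim0_cst (polar P1 y)) lp).
  have [|_ n _] := lim0_order (z := m l1) lL uw w0; last first.
    by apply/eqP; rewrite expr2 -subr_eq0; apply/negPn/negP => /n[m0 _]; rewrite m0 in m1.
  have g := class_away P1 (oner_neq0 K) y.
  apply: cofin_sub2 e g => t [t0 b1 b3 et] b1'; rewrite -et e21.
  have E3 : polar P3 (-1 * t + (- 2 - y)) = - polar P1 (1 * t + y).
    have Eq : -1 * t + (- 2 - y) = - 2 - (1 * t + y) by ring.
    by apply/eqP; rewrite -addr_eq0 addrC Eq A13 // -Eq.
  rewrite E3; have dT : polar P1 y - polar P1 (1 * t + y) =
      t * \sum_(j | P1 j) nu j / ((y + De j) * (1 * t + (y + De j))).
    rewrite /polar -sumrB mulr_sumr; apply: eq_bigr => j Pj.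
    have h1 := a1 j Pj; have h2 := b1' j Pj; rewrite -addrA in h2.
    by rewrite -addrA; field; rewrite h1 mul1r in h2 *; rewrite h2.
  have -> : 1 * t - 0 = t by ring.
  transitivity (polar P1 t * (t * \sum_(j | P1 j) nu j / ((y + De j) * (1 * t + (y + De j))))
     - polar P1 y * polar P1 (1 * t + y)); first by ring.
  by rewrite -dT; ring.
have n1 : nu l1 = 1.
  have g : cofin (fun t : K => [/\ away P1 t^-1, away P2 t^-1 & away P3 (- 2 - t^-1)]).
    have inv P : cofin (fun t : K => away P t^-1 /\ away P (- 2 - t^-1)).
      have g1 : cofin (fun t : K => forall j, De j * t + 1 != 0 /\ (De j - 2) * t - 1 != 0).
        by apply: cofin_forall => j; apply: cofinI; apply: cofin_affine; rewrite ?oppr_eq0 oner_neq0 orbT.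
      apply: cofin_sub2 (cofin_neq 0) g1 => t t0 h; split=> j _; have [h1 h2] := h j.
        by apply: contra_neq h1 => e; rewrite -(mulr0 t) -e; field.
      by apply: contra_neq h2 => e; rewrite -(mulr0 t) -e; field.
    by apply: cofin_sub2 (inv P1) (cofinI (inv P2) (inv P3)) => t [? _] [[? _] [_ ?]].
  have k j : lim0 (fun t : K => De j * t + 1) 1 by apply: lim0_affine.
  have lS : lim0 (fun t => nu l1 * \sum_(j | P1 j) nu j / (De j * t + 1) ^+ 2)
      (nu l1 * \sum_(j | P1 j) nu j / 1 ^+ 2).
    apply: lim0M (lim0_cst _) _; apply: lim0_sum => j _.
    by apply: lim0_div (lim0_cst _) (lim0X 2 (k j)); rewrite expr1n oner_neq0.
  have lp : lim0 (fun t => (\sum_(j | P1 j) nu j / (De j * t + 1)) ^+ 2) ((\sum_(j | P1 j) nu j / 1) ^+ 2).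
    by apply: lim0X; apply: lim0_sum => j _; apply: lim0_div (lim0_cst _) (k j); rewrite oner_neq0.
  have sum1 (e : nat) : \sum_(j | P1 j) nu j / 1 ^+ e = 1.
    by rewrite -[RHS](nc_sum (tr1 T)); apply: eq_bigr => j _; rewrite expr1n divr1.
  rewrite sum1 mulr1 in lS; rewrite (sum1 1%N) expr1n in lp.
  apply: lim0_unique lS (lim0_eq _ lp).
  apply: cofin_sub2 (cofin_neq 0) g => t t0 [b1 b2 b3].
  have te j : t^-1 + De j = (De j * t + 1) / t by field.
  have hj j : P1 j -> De j * t + 1 != 0.
    by move=> /b1; apply: contra_neq => e; rewrite -(mulr0 t^-1) -e; field.
  transitivity (t^-1 ^+ 2 * (nu l1 * S t^-1)).
    rewrite ident // -exprMn mulr_sumr; congr (_ ^+ 2); apply: eq_bigr => j /hj h.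
    by rewrite te; field; rewrite h t0.
  rewrite mulrCA; congr (_ * _); rewrite /S mulr_sumr; apply: eq_bigr => j /hj h.
  by rewrite te; field; rewrite h t0.
have nall j : P1 j -> nu j = 1.
  move=> P1j; rewrite -n1; have m1' : - 1 != 0 :> K by rewrite oppr_eq0 oner_neq0.
  have lt := polar_lim (tr1 T) P1j (oner_neq0 K); rewrite divr1 in lt.
  have dij i : P1 i && (i != j) -> De i - De j != 0.
    by move=> /andP[Pi ij]; rewrite subr_eq0; apply: contraNneq ij => /(nc_inj (tr1 T) Pi P1j) ->.
  have lS : lim0 (fun t => nu l1 * (nu j + t ^+ 2 * \sum_(i | P1 i && (i != j)) nu i / (1 * t + (De i - De j)) ^+ 2))
     (nu l1 * (nu j + 0 ^+ 2 * \sum_(i | P1 i && (i != j)) nu i / (De i - De j) ^+ 2)).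
    apply: lim0M (lim0_cst _) (lim0D (lim0_cst _) (lim0M (lim0X 2 (lim0_id K)) _)).
    apply: lim0_sum => i /dij ?; apply: lim0_div (lim0_cst _) (lim0X 2 (lim0_affine _ _)).
    by rewrite expf_neq0.
  have l2' := lim0X 2 lt; rewrite expr0n mul0r addr0 in lS.
  have E : nu j ^+ 2 = nu l1 * nu j.
    apply: lim0_unique l2' (lim0_eq _ lS).
    have g2 : cofin (fun t => [/\ away P1 (1 * t - De j), away P2 (1 * t - De j) & away P3 (- 2 - (1 * t - De j))]).
      apply: cofin_sub2 (class_away P1 (oner_neq0 K) (- De j))
        (cofinI (class_away P2 (oner_neq0 K) (- De j)) (class_away P3 m1' (De j - 2))) => t a1 [a2 a3].
      split=> //; have -> : - 2 - (1 * t - De j) = -1 * t + (De j - 2) by ring.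
      exact: a3.
    apply: cofin_sub2 (cofin_neq 0) g2 => t t0 [b1 b2 b3].
    rewrite exprMn -ident // mulrCA; congr (_ * _); rewrite /S [X in _ = _ * X](bigD1 j) //= subrK mulrDr.
    rewrite mul1r [t ^+ 2 * (_ / _)]mulrCA divff ?expf_neq0 // mulr1; congr (_ + _ * _).
    by apply: eq_bigr => i _; congr (_ / _ ^+ 2); ring.
  by apply: (mulIf (nc_nu (tr1 T) P1j)); rewrite -expr2.
have := nc_sum (tr1 T); rewrite (eq_bigr (fun=> 1)) // sumr_const => /eqP.
by rewrite -[X in _ == X](mulr1n 1) eqr_nat; lia.
Qed.

End ThreeClasses.

Section ThreeDirections.
Variable K : numClosedFieldType.
Variables (F : {mpoly K[3]}) (I : finType) (a b c : I -> int) (k1 k2 k3 : K).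
Hypothesis H : horn_data F a b c k1 k2 k3.
Variables (cst : K) (m : I -> int).
Hypothesis cst0 : cst != 0.
Local Notation h l := (line a b c l : K -> K -> K).
Hypothesis HJ : forall p q, @off_lines K I a b c p q ->
  jac a b c p q = cst * \prod_l h l p q ^ m l.
Local Notation par := (par a b).
Local Notation cmass := (cmass K a b).
Local Notation lam := (lam K a b).
Local Notation cout := (cout K a b c).
Local Notation kap := (kap K a b c).
Hypothesis msum1 : forall l0, \sum_(l | par l0 l) m l = -1.

Let e : K := (\sum_l c l)%:~R.
Let e0 : e != 0. Proof. by rewrite intr_eq0 gt_eqF // (csum_gt0 H). Qed.
(** As [cmass l] is measured in the vector of [l], its inverse is the share of [l] in the total
    vector of its class. Likewise [De l] is a normalised residue, zero exactly when [kap l l] is. *)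
Let nu l : K := (cmass l)^-1.
Let De l : K := kap l l / e.

Lemma lam_trans l0 l l' : par l0 l -> par l l' -> lam l0 l' = lam l0 l * lam l l'.
Proof.
move=> p p'; have [ea eb] := lamP H p; have [ea' eb'] := lamP H p'.
have [ea2 eb2] := lamP H (par_trans H p p').
have := horn_dir H l0; rewrite -!(intr_eq0 K) => /orP[] n0; apply: (mulIf n0).
  by rewrite -ea2 ea' ea; ring.
by rewrite -eb2 eb' eb; ring.
Qed.

Lemma par_eq l0 l : par l0 l -> par l0 =1 par l.
Proof.
move=> p l'; apply/idP/idP => q; last exact: (par_trans H p q).
by apply: (par_trans H _ q); rewrite par_sym.
Qed.

Lemma cmass_par l0 l : par l0 l -> cmass l0 = lam l0 l * cmass l.
Proof.
move=> p; rewrite /cmass mulr_sumr (eq_bigl _ _ (par_eq p)).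
by apply: eq_bigr => l' p'; rewrite (lam_trans p p').
Qed.

Lemma cout_par l0 l : par l0 l -> cout l = cout l0.
Proof. by move=> p; apply: eq_bigl => l'; rewrite (par_eq p). Qed.

Lemma cmass_neq0_par l0 l : cmass l0 != 0 -> par l0 l -> cmass l != 0.
Proof. by move=> n0 p; move: n0; rewrite (cmass_par p) mulf_eq0 => /norP[]. Qed.

Lemma normal_par l0 : cmass l0 != 0 -> normal_class nu De m (par l0).
Proof.
move=> M0; have ML l p := @cmass_neq0_par l0 l M0 p.
have nuE l : par l0 l -> nu l = lam l0 l / cmass l0.
  move=> p; rewrite /nu (cmass_par p) invfM mulrA divff ?mul1r //.
  exact: (lam_neq0 H p).
split.
- by move=> l p; rewrite invr_eq0 ML.
- move=> l l'; rewrite !unfold_in => p p' /(mulIf (invr_neq0 e0)).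
  rewrite /kap !(lam_self H) !mul1r (cout_par p) (cout_par p') => /addrI E.
  have pl : par l l' by rewrite -(par_eq p).
  have [ea eb] := lamP H pl.
  have ec : (c l')%:~R = lam l l' * (c l)%:~R.
    apply: (mulfI (ML _ p')); rewrite -E (cmass_par pl); ring.
  by apply: (horn_dist H); apply/eqP; rewrite -(eqr_int K) !rmorphM /= ?ea ?eb ?ec; apply/eqP; ring.
- transitivity (\sum_(l | par l0 l) lam l0 l / cmass l0); first by apply: eq_bigr => l /nuE.
  by rewrite -mulr_suml divff.
- transitivity (\sum_(l | par l0 l) (lam l0 l / cmass l0 * cout l0 + (c l)%:~R) / e).
    apply: eq_bigr => l p; rewrite /De mulrA; congr (_ / _).
    rewrite /kap (lam_self H) mul1r mulrDr (cout_par p) mulrA mulVf ?ML // mul1r.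
    by rewrite -nuE.
  rewrite -mulr_suml big_split -!mulr_suml /= -/(cmass l0) divff // mul1r.
  have -> : cout l0 + \sum_(l | par l0 l) (c l)%:~R = e.
    by rewrite /e rmorph_sum [RHS](bigID (par l0)) addrC.
  by rewrite divff.
- move=> l p; have [_ mk _ _] := class_exponents H cst0 HJ l.
  have [m1 m0] := mk l (par_refl a b l); split=> [|/eqP].
    by rewrite mulf_eq0 invr_eq0 (negPf e0) orbF.
  by rewrite mulf_eq0 invr_eq0 (negPf e0) orbF => /eqP.
- exact: msum1.
Qed.

Section Cover.
Variables l1 l2 l3 : I.
Hypotheses (n12 : ~~ par l1 l2) (n13 : ~~ par l1 l3) (n23 : ~~ par l2 l3).
Hypothesis cover : forall l, [|| par l1 l, par l2 l | par l3 l].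
Hypotheses (M1 : cmass l1 != 0) (M2 : cmass l2 != 0) (M3 : cmass l3 != 0).

Lemma disjoint_par l l' l'' : ~~ par l l' -> par l l'' -> par l' l'' = false.
Proof.
move=> n p; apply/negbTE; apply: contra n => q; apply: (par_trans H p _).
by rewrite par_sym.
Qed.

Lemma big_cover (R : Type) (idx : R) (op : Monoid.com_law idx) (f : I -> R) :
  \big[op/idx]_l f l = op (op (\big[op/idx]_(l | par l1 l) f l)
    (\big[op/idx]_(l | par l2 l) f l)) (\big[op/idx]_(l | par l3 l) f l).
Proof.
rewrite (bigID (par l1)) -Monoid.mulmA /=; congr (op _ _).
rewrite (bigID (par l2)) /=; congr (op _ _); apply: eq_bigl => l.
  case p1: (par l1 l); first by rewrite (disjoint_par n12 p1).
  by [].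
have := cover l; case p1: (par l1 l); first by rewrite (disjoint_par n13 p1).
case p2: (par l2 l); first by rewrite (disjoint_par n23 p2).
by move=> /= ->.
Qed.

(** The total vector of the class of [l]; unlike [cmass] it does not depend on the
    representative. *)
Let V l : K * K := (cmass l * (a l)%:~R, cmass l * (b l)%:~R).

Lemma VE l0 l : cmass l0 != 0 -> par l0 l ->
  (a l)%:~R = nu l * (V l0).1 /\ (b l)%:~R = nu l * (V l0).2.
Proof.
move=> M0 p; have [-> ->] := lamP H p; have ML := cmass_neq0_par M0 p.
by rewrite /V /nu (cmass_par p) /=; split; field.
Qed.

Lemma line_normal l0 l p q z : cmass l0 != 0 -> par l0 l ->
  (V l0).1 * p + (V l0).2 * q = e * z + cout l0 -> h l p q = nu l * e * (z + De l).
Proof.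
move=> M0 pl E; have ML := cmass_neq0_par M0 pl; have [ea eb] := VE M0 pl.
rewrite /line ea eb /De /kap (lam_self H) mul1r (cout_par pl).
have -> : nu l * (V l0).1 * p + nu l * (V l0).2 * q = nu l * (e * z + cout l0).
  by rewrite -E; ring.
by rewrite /nu; field; rewrite ML e0.
Qed.

(** Each constant is counted by the two classes not containing its line. This is the origin of the
    -2 in [triple]. *)
Lemma sum_cout : cout l1 + cout l2 + cout l3 = 2 * e.
Proof.
have E l : cout l = e - \sum_(l' | par l l') (c l')%:~R.
  by rewrite /e rmorph_sum (bigID (par l)) /= addrC addrK.
rewrite !E {4}/e rmorph_sum big_cover /=.
have eE : e = \sum_(l | par l1 l) (c l)%:~R + \sum_(l | par l2 l) (c l)%:~R + \sum_(l | par l3 l) (c l)%:~R.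
  by rewrite /e rmorph_sum big_cover.
by rewrite eE; ring.
Qed.

Lemma sum_V : ((V l1).1 + (V l2).1 + (V l3).1 = 0) /\ ((V l1).2 + (V l2).2 + (V l3).2 = 0).
Proof.
split.
  by rewrite /V /= -!(sum_par H _).1 -big_cover -rmorph_sum (horn_suma H).
by rewrite /V /= -!(sum_par H _).2 -big_cover -rmorph_sum (horn_sumb H).
Qed.

Let del := (V l1).1 * (V l2).2 - (V l1).2 * (V l2).1.

Lemma del_neq0 : del != 0.
Proof.
rewrite /del /V /=.
have -> : cmass l1 * (a l1)%:~R * (cmass l2 * (b l2)%:~R) - cmass l1 * (b l1)%:~R * (cmass l2 * (a l2)%:~R)
   = cmass l1 * cmass l2 * ((a l1 * b l2)%:~R - (a l2 * b l1)%:~R).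
  by rewrite !rmorphM /=; ring.
rewrite !mulf_neq0 // subr_eq0 eqr_int eq_sym; exact: n12.
Qed.

Lemma solve_normal x y w : x + y + w = - 2 -> exists p q,
  [/\ (V l1).1 * p + (V l1).2 * q = e * x + cout l1,
      (V l2).1 * p + (V l2).2 * q = e * y + cout l2 &
      (V l3).1 * p + (V l3).2 * q = e * w + cout l3].
Proof.
move=> s; have d0 := del_neq0; have [s1 s2] := sum_V.
exists (((e * x + cout l1) * (V l2).2 - (e * y + cout l2) * (V l1).2) / del),
  (((V l1).1 * (e * y + cout l2) - (V l2).1 * (e * x + cout l1)) / del).
have v3 : (V l3).1 = - ((V l1).1 + (V l2).1) by apply/eqP; rewrite -addr_eq0 addrC s1.
have v3' : (V l3).2 = - ((V l1).2 + (V l2).2) by apply/eqP; rewrite -addr_eq0 addrC s2.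
have c3 : cout l3 = 2 * e - cout l1 - cout l2 by rewrite -sum_cout; ring.
have w3 : w = - 2 - x - y by rewrite -s; ring.
move: d0; rewrite v3 v3' c3 w3 /del => d0.
by split; field.
Qed.

Lemma triple_par : exists2 cst', cst' != 0 & triple nu De m cst' (par l1) (par l2) (par l3).
Proof.
(* The Jacobian is ([del] / [e])^2 times the form in [tr_jac], and each line is [nu l * e] times its
   normalised version. *)
pose cst' := cst * \prod_l (nu l * e) ^ m l * (e / del) ^+ 2.
have nul l : nu l != 0.
  by rewrite invr_eq0; have /or3P[] := cover l => /cmass_neq0_par; apply.
have d0 := del_neq0.
exists cst'.
  rewrite !mulf_neq0 ?expf_neq0 ?mulf_neq0 ?invr_eq0 //.
  by apply/prodf_neq0 => l _; rewrite expfz_neq0 // mulf_neq0.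
split; try exact: normal_par.
move=> x y w s a1 a2 a3; have [p [q [E1 E2 E3]]] := solve_normal s.
have L1 l pl := @line_normal l1 l p q x M1 pl E1.
have L2 l pl := @line_normal l2 l p q y M2 pl E2.
have L3 l pl := @line_normal l3 l p q w M3 pl E3.
have U : @off_lines K I a b c p q.
  move=> l; have /or3P[] := cover l => pl.
  - by rewrite L1 // !mulf_neq0 // a1.
  - by rewrite L2 // !mulf_neq0 // a2.
  - by rewrite L3 // !mulf_neq0 // a3.
have E := HJ U.
have W : \prod_l h l p q ^ m l = \prod_l (nu l * e) ^ m l *
    (weight De m (par l1) x * weight De m (par l2) y * weight De m (par l3) w).
  rewrite /weight !big_cover /=.
  have cw l0 z : (forall l, par l0 l -> h l p q = nu l * e * (z + De l)) ->
      \prod_(l | par l0 l) h l p q ^ m l =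
      (\prod_(l | par l0 l) (nu l * e) ^ m l) * \prod_(l | par l0 l) (z + De l) ^ m l.
    by move=> L; rewrite -big_split; apply: eq_bigr => l pl; rewrite L // expfzMl.
  by rewrite (cw l1 x) // (cw l2 y) // (cw l3 w) //; ring.
have Q (f : I -> K) (g : K * K -> K) : (forall l0 l, cmass l0 != 0 -> par l0 l -> f l = nu l ^+ 2 * g (V l0)) ->
    \sum_l f l / h l p q = (g (V l1) * polar nu De (par l1) x + g (V l2) * polar nu De (par l2) y +
      g (V l3) * polar nu De (par l3) w) / e.
  move=> fE; rewrite big_cover /= !mulrDl.
  have cl l0 z : cmass l0 != 0 -> away De (par l0) z ->
      (forall l, par l0 l -> h l p q = nu l * e * (z + De l)) ->
      \sum_(l | par l0 l) f l / h l p q = g (V l0) * polar nu De (par l0) z / e.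
    move=> M0 az L; rewrite /polar mulr_sumr mulr_suml; apply: eq_bigr => l pl.
    by rewrite L // (fE l0) //; field; rewrite e0 (az l pl) nul.
  by rewrite (cl l1 x) // (cl l2 y) // (cl l3 w).
have QA := Q (fun l => (a l)%:~R ^+ 2) (fun v => v.1 ^+ 2).
have QB := Q (fun l => (b l)%:~R ^+ 2) (fun v => v.2 ^+ 2).
have QE := Q (fun l => (a l)%:~R * (b l)%:~R) (fun v => v.1 * v.2).
rewrite /jac QA ?QB ?QE in E; last first.
- by move=> l0 l M0 pl; have [-> _] := VE M0 pl; ring.
- by move=> l0 l M0 pl; have [_ ->] := VE M0 pl; ring.
- by move=> l0 l M0 pl; have [-> ->] := VE M0 pl; ring.
have [s1 s2] := sum_V.
have v3 : (V l3).1 = - ((V l1).1 + (V l2).1) by apply/eqP; rewrite -addr_eq0 addrC s1.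
have v3' : (V l3).2 = - ((V l1).2 + (V l2).2) by apply/eqP; rewrite -addr_eq0 addrC s2.
rewrite W v3 v3' in E.
transitivity ((e / del) ^+ 2 * (cst * (\prod_l (nu l * e) ^ m l *
    (weight De m (par l1) x * weight De m (par l2) y * weight De m (par l3) w)))); last by rewrite /cst'; ring.
by rewrite -E; move: d0; rewrite /del => d0; field; rewrite d0 e0.
Qed.

End Cover.
End ThreeDirections.

(** * From Jacobian exponents to line configurations *)

Section Structure.
Variable K : numClosedFieldType.
Variables (F : {mpoly K[3]}) (I : finType) (a b c : I -> int) (k1 k2 k3 : K).
Hypothesis H : horn_data F a b c k1 k2 k3.
Local Notation par := (par a b).
Local Notation cmass := (cmass K a b).
Local Notation lam := (lam K a b).
Local Notation e := (\sum_l c l).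

Definition four_lines := exists s1 t1 s2 t2,
  [/\ perm_eq (index_enum I) [:: s1; t1; s2; t2] /\ ~~ par s1 s2,
      a t1 = - a s1 /\ b t1 = - b s1, a t2 = - a s2 /\ b t2 = - b s2 &
      0 < c s1 + c t1 /\ 0 < c s2 + c t2].

Definition six_lines := exists s1 t1 s2 t2 s3 t3,
  [/\ perm_eq (index_enum I) [:: s1; t1; s2; t2; s3; t3] /\ ~~ par s1 s2,
      [/\ a t1 = a s1, b t1 = b s1 & c t1 = c s1 + e],
      [/\ a t2 = a s2, b t2 = b s2 & c t2 = c s2 + e] &
      [/\ a t3 = a s3, b t3 = b s3 & c t3 = c s3 + e]].

Definition fan := exists l1 l2 l3,
  [/\ [/\ ~~ par l1 l2, ~~ par l1 l3 & ~~ par l2 l3],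
      forall l, [\/ par l1 l, l = l2 | l = l3] & cmass l1 != 0].

Lemma card2_split (P : pred I) l0 : P l0 -> #|P| = 2 ->
  exists l, [/\ l != l0, P l & forall l', P l' -> l' = l0 \/ l' = l].
Proof.
move=> P0 c2; have : #|[predD1 P & l0]| = 1%N.
  by have := cardD1 l0 P; rewrite c2 (_ : (l0 \in P) = true) //; lia.
move/eqP/card1P => [l lP]; exists l.
have := lP l; rewrite !inE eqxx => /andP[-> Pl]; split=> // l' Pl'.
case: (eqVneq l' l0) => [|n]; first by left.
by right; apply/eqP; have := lP l'; rewrite !inE n (_ : (l' \in P) = true) // => <-.
Qed.

Lemma perm_index (s : seq I) : uniq s -> (forall l, l \in s) -> perm_eq (index_enum I) s.
Proof.
move=> us ms; apply: uniq_perm => // [|l]; first exact: index_enum_uniq.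
by rewrite mem_index_enum ms.
Qed.

Lemma npar_neq l l' : ~~ par l l' -> l != l'.
Proof. by apply: contraNneq => ->; rewrite par_refl. Qed.

(** Mass 0 makes the two vectors of a class opposite. The constants of one class are those outside
    the other, hence have a positive sum. *)
Lemma four_linesP : two_classes K a b -> four_lines.
Proof.
move=> [s1 [s2 [n12 cover [M1 M2] [card1 card2]]]].
have [t1 [ts1 p1 u1]] := card2_split (par_refl a b s1) card1.
have [t2 [ts2 p2 u2]] := card2_split (par_refl a b s2) card2.
have cross x y : par s1 x -> par s2 y -> x != y.
  move=> px py; apply: npar_neq; apply: contra n12 => q.
  by apply: (par_trans H px); apply: (par_trans H q); rewrite par_sym.
have pair s t : t != s -> par s t -> (forall l, par s l -> l = s \/ l = t) -> cmass s = 0 ->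
    [/\ a t = - a s, b t = - b s & \sum_(l | par s l) c l = c s + c t].
  move=> ts pt uq M0.
  have S (V : nmodType) (f : I -> V) : \sum_(l | par s l) f l = f s + f t.
    rewrite (bigD1 s) ?par_refl //= (bigD1 t) /= ?pt ?ts // big_pred0 ?addr0 // => l.
    by apply/negP => /andP[/andP[/uq[->|->]]]; rewrite eqxx.
  move: M0; rewrite /cmass S (lam_self H) => /eqP; rewrite addrC addr_eq0 => /eqP lt.
  have [ea eb] := lamP H pt; rewrite lt !mulN1r in ea eb.
  by split; rewrite ?S //; apply/eqP; rewrite -(eqr_int K) rmorphN /= ?ea ?eb.
have [a1 b1 c1] := pair _ _ ts1 p1 u1 M1; have [a2 b2 c2] := pair _ _ ts2 p2 u2 M2.
have g1 := cnonpar_gt0 H M1; have g2 := cnonpar_gt0 H M2.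
have r1 : \sum_(l | ~~ par s1 l) c l = \sum_(l | par s2 l) c l.
  apply: eq_bigl => l; have := cover l; case p: (par s1 l) => //= _.
  by rewrite (disjoint_par H n12 p).
have r2 : \sum_(l | ~~ par s2 l) c l = \sum_(l | par s1 l) c l.
  apply: eq_bigl => l; have := cover l; case p: (par s1 l) => /=; [move=> _|by move=> ->].
  by rewrite (disjoint_par H n12 p).
rewrite r1 c2 in g1; rewrite r2 c1 in g2.
exists s1, t1, s2, t2; split=> //; split=> //; apply: perm_index.
  rewrite /= !inE !negb_or (eq_sym s1 t1) ts1 (eq_sym s2 t2) ts2 /= !cross ?par_refl //.
move=> l; rewrite !inE; have /orP[/u1[->|->]|/u2[->|->]] := cover l; by rewrite eqxx ?orbT.
Qed.

(** Two special classes force the third and give six lines; otherwise at least two classes are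
    single lines, and the third class with these two forms a fan. *)
Lemma six_or_fan (cst : K) (m : I -> int) : cst != 0 ->
  (forall p q, @off_lines K I a b c p q -> jac a b c p q = cst * \prod_l line a b c l p q ^ m l) ->
  three_classes K a b m -> six_lines \/ fan.
Proof.
move=> cst0 HJ [l1 [l2 [l3 [[n12 n13 n23] cover [M1 M2 M3] msum]]]].
have [cst' cst'0 T] := triple_par H cst0 HJ msum n12 n13 n23 cover M1 M2 M3.
set nu := fun l => _ in T; set De := fun l => _ in T.
have eK : e%:~R != 0 :> K by rewrite intr_eq0 gt_eqF // (csum_gt0 H).
pose special l0 := exists2 l, par l0 l & De l = 0.
have single l0 : normal_class nu De m (par l0) -> ~ special l0 -> forall l, par l0 l -> l = l0.
  move=> nP ns; have [|x Px [u _ _]] := nonspecial_single cst'0 nP.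
    by move=> l pl; apply/eqP => D0; apply: ns; exists l.
  by move=> l /u ->; rewrite (u l0) ?par_refl.
have decs l0 : {special l0} + {~ special l0}.
  case: (pickP (fun l => par l0 l && (De l == 0))) => [l /andP[pl /eqP D0]|no]; first by left; exists l.
  by right=> -[l pl D0]; have := no l; rewrite pl D0 eqxx.
have pairs P1 P2 P3 : triple nu De m cst' P1 P2 P3 -> (forall l l', P1 l -> P1 l' -> par l l') ->
   (exists2 l, P1 l & De l = 0) -> (exists2 l, P2 l & De l = 0) ->
   exists s t, [/\ P1 s, P1 t, s != t, forall l, P1 l -> l = s \/ l = t &
     [/\ a t = a s, b t = b s & c t = c s + e]].
  move=> T' pp [s Ps Ds] [s2 Ps2 Ds2]; have [_ [t Pt [Dt nt ns u]]] := two_special cst'0 T' Ps Ds Ps2 Ds2.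
  have pst := pp _ _ Ps Pt.
  have two0 : 2 != 0 :> K by rewrite pnatr_eq0.
  (* Weight 1/2 is mass 2, so the two lines have the same vector; the positions 0 and 2 then put
     their constants [e] apart. *)
  have Ms : cmass s = 2 by apply: invr_inj.
  have Mt : cmass t = 2 by apply: invr_inj.
  have lst : lam s t = 1.
    by have := cmass_par H pst; rewrite Ms Mt => /esym/eqP; rewrite -subr_eq0 -{2}[2]mul1r -mulrBl mulf_eq0 subr_eq0 (negPf two0) orbF => /eqP.
  have [ea eb] := lamP H pst; rewrite lst !mul1r in ea eb.
  exists s, t; split=> //; first by apply: contra_eqN Dt => /eqP <-; rewrite Ds eq_sym.
  split; apply/eqP; rewrite -(eqr_int K) ?ea ?eb // rmorphD /=; apply/eqP.
  move: Ds Dt; rewrite /De /kap !(lam_self H) !mul1r Ms Mt (cout_par H pst) => /eqP.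
  rewrite mulf_eq0 invr_eq0 (negPf eK) orbF => /eqP Ds /(congr1 (fun x => x * e%:~R)).
  rewrite divfK // => Dt; apply: (mulfI two0); rewrite mulrDr -Dt.
  have -> : 2 * (c s)%:~R = - cout K a b c s by apply/eqP; rewrite -addr_eq0 addrC Ds.
  by ring.
have T12 := triple12 T; have T23 := triple23 T; have T312 := triple12 T23.
have pp l0 l l' : par l0 l -> par l0 l' -> par l l'.
  by move=> p p'; rewrite -(par_eq H p).
have six : special l1 -> special l2 -> special l3 -> six_lines.
  move=> sp1 sp2 sp3.
  have [s1 [t1 [ps1 pt1 st1 u1 w1]]] := pairs _ _ _ T (@pp l1) sp1 sp2.
  have [s2 [t2 [ps2 pt2 st2 u2 w2]]] := pairs _ _ _ T12 (@pp l2) sp2 sp1.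
  have [s3 [t3 [ps3 pt3 st3 u3 w3]]] := pairs _ _ _ T312 (@pp l3) sp3 sp1.
  exists s1, t1, s2, t2, s3, t3; split=> //; split; last first.
    apply: contra n12 => q.
    by apply: (par_trans H ps1); apply: (par_trans H q); rewrite par_sym.
  apply: perm_index.
    have cross x y l l' : ~~ par l l' -> par l x -> par l' y -> x != y.
      move=> n px py; apply: npar_neq; apply: contra n => q.
      by apply: (par_trans H px); apply: (par_trans H q); rewrite par_sym.
    rewrite /= !inE !negb_or st1 st2 st3 /=.
    by rewrite (cross _ _ _ _ n12 ps1 ps2) (cross _ _ _ _ n12 ps1 pt2) (cross _ _ _ _ n12 pt1 ps2) (cross _ _ _ _ n12 pt1 pt2)
      (cross _ _ _ _ n13 ps1 ps3) (cross _ _ _ _ n13 ps1 pt3) (cross _ _ _ _ n13 pt1 ps3) (cross _ _ _ _ n13 pt1 pt3)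
      (cross _ _ _ _ n23 ps2 ps3) (cross _ _ _ _ n23 ps2 pt3) (cross _ _ _ _ n23 pt2 ps3) (cross _ _ _ _ n23 pt2 pt3).
  by move=> l; rewrite !inE; have /or3P[/u1[->|->]|/u2[->|->]|/u3[->|->]] := cover l; rewrite eqxx ?orbT.
have third P1 P2 P3 : triple nu De m cst' P1 P2 P3 ->
   (exists2 l, P1 l & De l = 0) -> (exists2 l, P2 l & De l = 0) -> exists2 l, P3 l & De l = 0.
  by move=> T' [s Ps Ds] [s2 Ps2 Ds2]; have [] := two_special cst'0 T' Ps Ds Ps2 Ds2.
have mkfan x y z : ~~ par x y -> ~~ par x z -> ~~ par y z -> (forall l, [|| par x l, par y l | par z l]) ->
    cmass x != 0 -> (forall l, par y l -> l = y) -> (forall l, par z l -> l = z) -> fan.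
  move=> nxy nxz nyz cv Mx uy uz; exists x, y, z; split=> // l.
  by have /or3P[?|/uy ->|/uz ->] := cv l; [apply: Or31|apply: Or32|apply: Or33].
have N1 := tr1 T; have N2 := tr2 T; have N3 := tr3 T.
case: (decs l1) (decs l2) (decs l3) => [s1|s1] [s2|s2] [s3|s3].
- by left; apply: six.
- by left; apply: six => //; apply: third T s1 s2.
- by left; apply: six => //; apply: third T23 s1 s3.
- by right; apply: (mkfan l1 l2 l3) => //; apply: single.
- left; apply: six => //; apply: third (triple23 T12) s2 s3.
- right; apply: (mkfan l2 l1 l3) => //; try exact: single.
    by rewrite par_sym.
  by move=> l; have := cover l; rewrite orbCA.
- right; apply: (mkfan l3 l1 l2) => //; try exact: single; try by rewrite par_sym.
  by move=> l; have := cover l; rewrite orbA orbC.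
- by right; apply: (mkfan l1 l2 l3) => //; apply: single.
Qed.

Theorem horn_structure : [\/ four_lines, six_lines | fan].
Proof.
have [cst [m [cst0 HJ]]] := jac_monomial H.
have [two|three] := direction_count H cst0 HJ; first by apply: Or31; apply: four_linesP.
by have [?|?] := six_or_fan cst0 HJ three; [apply: Or32|apply: Or33].
Qed.

End Structure.

(** * Evaluation and equivalence of Laurent polynomials *)

Section LaurentEval.
Variable K : numFieldType.
Local Notation laurent := {freeg 'rV[int]_3 / K}.
Implicit Types (D : laurent) (v : 'rV[int]_3).

Lemma ord3E : [/\ (0 : 'I_3) = o0, (1 : 'I_3) = o1 & (2 : 'I_3) = o2].
Proof. by split; apply: val_inj. Qed.

Lemma wtE v : wt v = v 0 0 + v 0 1 + v 0 2.
Proof. by have [-> -> ->] := ord3E; rewrite /wt sum3. Qed.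

Lemma row3P v (w : 'rV[int]_3) : v 0 0 = w 0 0 -> v 0 1 = w 0 1 -> v 0 2 = w 0 2 -> v = w.
Proof.
by have [-> -> ->] := ord3E => e0 e1 e2; apply/rowP; elim/ord3P.
Qed.

Lemma fglift_sum (M : lmodType K) (f : 'rV[int]_3 -> M) D :
  fglift f D = \sum_(v <- dom D) coeff v D *: f v.
Proof. by rewrite -{1}[D]Freeg_dom fglift_Freeg /prelift big_map. Qed.

Lemma coeff_fglift (g : 'rV[int]_3 -> laurent) D x :
  coeff x (fglift g D) = \sum_(v <- dom D) coeff v D * coeff x (g v).
Proof. by rewrite fglift_sum raddf_sum; apply: eq_bigr => v _; rewrite /= coeffZ. Qed.

Definition mon (x y z : K) v : K := x ^ v 0 0 * y ^ v 0 1 * z ^ v 0 2.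

Definition evL D (x y z : K) : K := \sum_(v <- dom D) coeff v D * mon x y z v.

Lemma evL_fgliftE D x y z : evL D x y z = fglift (fun v => mon x y z v : K^o) D.
Proof. by rewrite fglift_sum. Qed.

Lemma evLU k v x y z : evL << k *g v >> x y z = k * mon x y z v.
Proof. by rewrite evL_fgliftE liftU. Qed.

Lemma evLB D1 D2 x y z : evL (D1 - D2) x y z = evL D1 x y z - evL D2 x y z.
Proof. by rewrite !evL_fgliftE; apply: (@lift_is_additive K _ K^o). Qed.

Lemma evL_sum (T : Type) (r : seq T) (f : T -> laurent) x y z :
  evL (\sum_(i <- r) f i) x y z = \sum_(i <- r) evL (f i) x y z.
Proof.
have ev0 : evL 0 x y z = 0 by have := evLB 0 0 x y z; rewrite !subrr.
have evD A B : evL (A + B) x y z = evL A x y z + evL B x y z.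
  by rewrite -[B in LHS]opprK evLB -[- B]add0r evLB ev0 sub0r opprK.
by rewrite (big_morph (fun D => evL D x y z) evD ev0).
Qed.

Lemma evLZ k D x y z : evL (k *: D) x y z = k * evL D x y z.
Proof.
rewrite -[D in LHS]freeg_sumE scaler_sumr evL_sum {2}/evL mulr_sumr; apply: eq_bigr => v _.
have -> : k *: (<< coeff v D *g v >> : laurent) = << k * coeff v D *g v >>.
  by apply/(@eqP laurent)/freeg_eqP => w; rewrite coeffZ !coeffU mulrA.
by rewrite evLU -mulrA.
Qed.

Lemma evL_fglift (g : 'rV[int]_3 -> laurent) D x y z :
  evL (fglift g D) x y z = \sum_(v <- dom D) coeff v D * evL (g v) x y z.
Proof. by rewrite fglift_sum evL_sum; apply: eq_bigr => v _; rewrite evLZ. Qed.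

Lemma mulrACA3 (A A' B B' C C' : K) :
  A * A' * (B * B') * (C * C') = A * B * C * (A' * B' * C').
Proof. by ring. Qed.

Lemma monD (x y z : K) (u v : 'rV[int]_3) : x != 0 -> y != 0 -> z != 0 ->
  mon x y z (u + v) = mon x y z u * mon x y z v.
Proof. by move=> x0 y0 z0; rewrite /mon !mxE !expfzDr // mulrACA3. Qed.

Lemma evL_scale l m n D x y z :
  evL (laurent_scale l m n D) x y z = evL D (l * x) (m * y) (n * z).
Proof.
rewrite evL_fglift; apply: eq_bigr => v _; congr (_ * _).
by rewrite evLU /mon !expfzMl mulrACA3.
Qed.

Lemma evL_shift u D x y z : x != 0 -> y != 0 -> z != 0 ->
  evL (laurent_shift u D) x y z = mon x y z u * evL D x y z.
Proof.
move=> x0 y0 z0; rewrite evL_fglift {2}/evL mulr_sumr; apply: eq_bigr => v _.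
by rewrite evLU mul1r monD // mulrCA.
Qed.

Lemma monZ (x y z : K) (n : int) v : mon x y z (n *: v) = mon x y z v ^ n.
Proof. by rewrite /mon !mxE !expfzMl -!exprz_exp !(exprzAC _ n) !exprz_exp. Qed.

Lemma evL_subst al be ga D x y z : x != 0 -> y != 0 -> z != 0 ->
  evL (laurent_subst al be ga D) x y z =
  evL D (mon x y z al) (mon x y z be) (mon x y z ga).
Proof.
move=> x0 y0 z0; rewrite evL_fglift; apply: eq_bigr => v _; congr (_ * _).
by rewrite evLU mul1r !monD // !monZ.
Qed.

Definition homogL (w : int) D := forall v, wt v != w -> coeff v D = 0.

Lemma homogL_fglift w (g : 'rV[int]_3 -> laurent) D :
  (forall v, v \in dom D -> homogL w (g v)) -> homogL w (fglift g D).
Proof.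
move=> hg x wx; rewrite coeff_fglift big1_seq // => v /andP[_ vD].
by rewrite (hg v vD) // mulr0.
Qed.

Lemma homogLU w k v : wt v = w -> homogL w << k *g v >>.
Proof.
move=> <- x wx; rewrite coeffU; have /negPf-> : v != x by apply: contraNneq wx => ->.
by rewrite mulr0.
Qed.

Lemma homogL_dom w D v : homogL w D -> v \in dom D -> wt v = w.
Proof. by move=> hD; rewrite mem_dom; apply: contra_neq_eq; apply: hD. Qed.

Lemma homogL_laurent w D : homogL w D -> laurent_homog D.
Proof. by move=> hD; exists w => v; apply: homogL_dom. Qed.

Lemma homogLB w D1 D2 : homogL w D1 -> homogL w D2 -> homogL w (D1 - D2).
Proof. by move=> h1 h2 v wv; rewrite coeffB h1 // h2 // subrr. Qed.

Lemma evL_homogL w D l x y z : homogL w D -> l != 0 ->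
  evL D (l * x) (l * y) (l * z) = l ^ w * evL D x y z.
Proof.
move=> hD l0; rewrite /evL mulr_sumr; apply: eq_big_seq => v /(homogL_dom hD) <-.
by rewrite /mon !expfzMl wtE !expfzDr // mulrACA3 mulrCA.
Qed.

(** Multiplication by a high power t^N gives a polynomial vanishing at all but finitely many
    points. *)
Lemma laurent_coeffs (T : eqType) (s : seq T) (e : T -> int) (k : T -> K) :
  cofin (fun t => \sum_(i <- s) k i * t ^ e i = 0) ->
  forall n, \sum_(i <- s | e i == n) k i = 0.
Proof.
move=> E n; pose N := (\sum_(i <- s) `|e i| + `|n|)%N.
have bound i : i \in s -> 0 <= e i + N%:Z.
  by move=> si; rewrite /N (big_rem i si) /=; lia.
have nN : 0 <= n + N%:Z by rewrite /N; lia.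
pose p : {poly K} := \sum_(i <- s) (k i)%:P * 'X^(absz (e i + N%:Z)).
have p0 : p = 0.
  apply: poly_cofin0; apply: cofin_sub2 (cofin_neq 0) E => t t0 e0.
  transitivity (t ^ N%:Z * \sum_(i <- s) k i * t ^ e i); last by rewrite e0 mulr0.
  rewrite /p horner_sum mulr_sumr; apply: eq_big_seq => i si.
  rewrite hornerM hornerC hornerXn -[t ^+ _]/(t ^ (absz (e i + N%:Z))%:Z) gez0_abs ?bound //.
  by rewrite expfzDr //; ring.
have : p`_(absz (n + N%:Z)) = 0 by rewrite p0 coef0.
apply: etrans; rewrite /p coef_sum big_mkcond; apply: eq_big_seq => i si.
rewrite coefCM coefXn; have -> : (absz (n + N%:Z) == absz (e i + N%:Z)) = (e i == n).
  by have := bound i si; lia.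
by case: eqP => _; rewrite ?mulr1 ?mulr0.
Qed.

End LaurentEval.

Section LaurentUnique.
Variable K : numFieldType.
Local Notation laurent := {freeg 'rV[int]_3 / K}.
Implicit Types (D : laurent) (v : 'rV[int]_3).

(** Homogeneity recovers the exponent of z from the other two, so values at z = 1 suffice. *)
Lemma homogL_eq0 w D : homogL w D ->
  cofin (fun X => cofin (fun Y => evL D X Y 1 = 0)) -> D = 0.
Proof.
move=> hD E; apply/(@eqP laurent)/freeg_eqP => v; rewrite coeff0.
case: (boolP (v \in dom D)) => [vD|/coeff_outdom //].
have EX : cofin (fun X => \sum_(u <- dom D | u 0 1 == v 0 1) coeff u D * X ^ u 0 0 = 0).
  apply: cofin_sub E => X EY; apply: laurent_coeffs.
  apply: cofin_sub EY => Y; apply: etrans; apply: eq_bigr => u _.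
  by rewrite /mon exp1rz mulr1 mulrA.
have := @laurent_coeffs K 'rV[int]_3 [seq u : 'rV[int]_3 <- dom D | u 0 1 == v 0 1] (fun u => u 0 0) (fun u => coeff u D).
move=> /(_ _ (v 0 0)); rewrite big_filter_cond => <-; last first.
  by apply: cofin_sub EX => X; rewrite big_filter.
rewrite (big_rem v vD) /= !eqxx /= big1_seq ?addr0 // => u /andP[/andP[/eqP e1 /eqP e0]].
rewrite mem_rem_uniq ?uniq_dom // inE => /andP[uv uD]; case/eqP: uv.
apply: row3P => //; have := homogL_dom hD uD; rewrite -(homogL_dom hD vD) !wtE e0 e1.
exact: addrI.
Qed.

Lemma evL_of_mpoly (F : {mpoly K[3]}) x y z :
  evL (laurent_of_mpoly F) x y z = F.@[fun i => [:: x; y; z]`_i].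
Proof.
rewrite /laurent_of_mpoly evL_sum mevalE; apply: eq_bigr => m _.
rewrite evLU /mon !mxE; have [-> -> ->] := ord3E.
rewrite !big_ord_recl big_ord0 mulr1 /= -(mulrA (x ^+ _)).
by congr (_ * (_ * (_ * _))); congr (_ ^+ m _); apply: val_inj.
Qed.

Lemma homogL_of_mpoly d (F : {mpoly K[3]}) : F \is d.-homog -> homogL d%:Z (laurent_of_mpoly F).
Proof.
move=> /dhomogP hF v wv; rewrite /laurent_of_mpoly raddf_sum big1_seq //= => m /hF /= dm.
apply: homogLU wv; rewrite wtE !mxE; have [-> -> ->] := ord3E.
by rewrite -dm mdegE sum3.
Qed.

Definition row3 (x y z : int) : 'rV[int]_3 := \row_i [:: x; y; z]`_i.

Lemma mon_row3 (x y z : K) i j k : mon x y z (row3 i j k) = x ^ i * y ^ j * z ^ k.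
Proof. by rewrite /mon !mxE. Qed.

Lemma wt_row3 i j k : wt (row3 i j k) = i + j + k.
Proof. by rewrite wtE !mxE. Qed.

(** The third coordinates only complete each weight to 1 and z is fixed, so on the chart z = 1 the
    substitution is the monomial map with matrix w. Its inverse is [dt] times the adjugate. *)
Lemma unimodular_monomial w11 w12 w21 w22 dt :
  w11 * w22 - w12 * w21 = dt -> dt * dt = 1 ->
  invertible_monomial (row3 w11 w21 (1 - w11 - w21)) (row3 w12 w22 (1 - w12 - w22)) (row3 0 0 1).
Proof.
move=> e dd; split; rewrite ?wt_row3; [ring|ring|by []|].
move=> v v0; exists (dt * (w22 * v 0 0 - w12 * v 0 1), dt * (w11 * v 0 1 - w21 * v 0 0)).
have D1 x : dt * (w11 * w22 - w12 * w21) * x = x by rewrite e dd mul1r.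
split=> [|[c1 c2] /= ->].
  have v2 : v 0 2 = - v 0 0 - v 0 1 by move: v0; rewrite wtE; lia.
  apply: row3P; rewrite !mxE /= ?v2;
  [rewrite -[v 0 0 in LHS]D1|rewrite -[v 0 1 in LHS]D1|rewrite -[v 0 0 in LHS]D1 -[v 0 1 in LHS]D1]; ring.
rewrite !mxE /=; congr (_, _); [rewrite -[c1 in RHS]D1|rewrite -[c2 in RHS]D1]; ring.
Qed.

End LaurentUnique.

(** * Equivalence from a monomial change of coordinates *)

Section Equiv.
Variable K : numClosedFieldType.

(** No operation multiplies by a constant, so [k3] is absorbed by scaling all variables by a [D]-th
    root of its inverse. The shift [u] removes the monomial factor and adjusts the degree to [D]. *)
Lemma monomial_equiv d D (F G : {mpoly K[3]}) w11 w12 w21 w22 i j dt (k1 k2 k3 : K) :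
  F \is d.-homog -> G \is D.-homog -> (0 < D)%N ->
  w11 * w22 - w12 * w21 = dt -> dt * dt = 1 -> k1 != 0 -> k2 != 0 -> k3 != 0 ->
  cofin (fun X => cofin (fun Y =>
    F.@[pt (k1 * (X ^ w11 * Y ^ w21)) (k2 * (X ^ w12 * Y ^ w22))] =
    k3 * (X ^ i * Y ^ j) * G.@[pt X Y])) ->
  poly_equiv F G.
Proof.
move=> hF hG D0 e dd k10 k20 k30 E.
have hF' := homogL_of_mpoly hF; have hG' := homogL_of_mpoly hG.
split; [exact: homogL_laurent hF'|exact: homogL_laurent hG'|].
pose al := row3 w11 w21 (1 - w11 - w21); pose be := row3 w12 w22 (1 - w12 - w22).
pose ga := row3 0 0 1; pose u := row3 (- i) (- j) (D%:Z - d%:Z + i + j).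
pose l := D.-root (k3^-1).
have l0 : l != 0 by rewrite rootC_eq0 // invr_eq0.
pose L1 := laurent_scale k1 k2 1 (laurent_of_mpoly F).
pose L2 := laurent_subst al be ga L1.
pose L3 := laurent_shift u L2.
have h1 : homogL d%:Z L1.
  by apply: homogL_fglift => v /(homogL_dom hF') <-; apply: homogLU.
have h2 : homogL d%:Z L2.
  apply: homogL_fglift => v /(homogL_dom h1) <-; apply: homogLU.
  by rewrite !wtE !mxE /=; ring.
have h3 : homogL D%:Z L3.
  apply: homogL_fglift => v /(homogL_dom h2) dv; apply: homogLU.
  by rewrite wtE !mxE /=; move: dv; rewrite wtE; lia.
have h4 : homogL D%:Z (laurent_scale l l l L3).
  by apply: homogL_fglift => v /(homogL_dom h3) <-; apply: homogLU.
have -> : laurent_of_mpoly G = laurent_scale l l l L3.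
  apply/esym/eqP; rewrite -subr_eq0; apply/eqP; apply: homogL_eq0 (homogLB h4 hG') _.
  apply: cofin_sub2 (cofin_neq 0) E => X X0 EY; apply: cofin_sub2 (cofin_neq 0) EY => Y Y0.
  rewrite evLB evL_scale (evL_homogL _ _ _ h3) // evL_shift ?oner_neq0 //.
  rewrite evL_subst ?oner_neq0 // !mon_row3 !exp1rz !expr0z !(mulr1, mul1r) evL_scale !mulr1.
  rewrite !evL_of_mpoly => ->.
  have lD : l ^ D%:Z = k3^-1 by rewrite -[l ^ _]/(l ^+ D) /l rootCK.
  rewrite lD -!invr_expz; apply/eqP; rewrite subr_eq0; apply/eqP.
  rewrite /pt; field.
  by rewrite k30 !expfz_neq0.
have st A B : laurent_step A B -> clos_refl_trans _ (@laurent_step K) A B by exact: rt_step.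
apply: (rt_trans _ _ _ L3); last by apply: st; apply: StepScale.
apply: (rt_trans _ _ _ L2); last by apply: st; apply: StepShift.
apply: (rt_trans _ _ _ L1); first by apply: st; apply: StepScale; rewrite ?oner_neq0.
by apply: st; apply: StepSubst; apply: unimodular_monomial e dd.
Qed.

(* A vanishing determinant gives a kernel of powers of 2, and one of absolute
   value n > 1 gives a kernel of n-th roots of unity. *)
Lemma monomial_det w11 w12 w21 w22 :
  (forall z1 z2 : K, z1 != 0 -> z2 != 0 -> z1 ^ w11 * z2 ^ w21 = 1 ->
     z1 ^ w12 * z2 ^ w22 = 1 -> z1 = 1 /\ z2 = 1) ->
  (w11 * w22 - w12 * w21) * (w11 * w22 - w12 * w21) = 1.
Proof.
move=> inj; set dt := _ - _.
have two0 : (2 : K) != 0 by rewrite pnatr_eq0.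
have two z : (2 : K) ^ z = 1 -> z = 0.
  case: z => [[|n]|n] //= /eqP; [rewrite -[_ ^ _]/(2 ^+ n.+1)|rewrite -[_ ^ _]/(2 ^- n.+1) invr_eq1];
    by rewrite -natrX pnatr_eq1 -(expn0 2) eqn_exp2l.
have key n1 n2 : n1 * w11 + n2 * w21 = 0 -> n1 * w12 + n2 * w22 = 0 -> n1 = 0 /\ n2 = 0.
  move=> e1 e2; have := inj (2 ^ n1) (2 ^ n2).
  rewrite !expfz_neq0 // !exprz_exp -!expfzDr // e1 e2 expr0z => /(_ isT isT erefl erefl)[].
  by move=> /two-> /two->.
have dt0 : dt != 0.
  apply/eqP => d0; have [] := key w21 (- w11); rewrite /dt in d0; [ring|lia|].
  move=> z21 /eqP; rewrite oppr_eq0 => /eqP z11.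
  have [] := key w22 (- w12); rewrite ?z21 ?z11; [ring|ring|].
  move=> z22 /eqP; rewrite oppr_eq0 => /eqP z12.
  by have [] := key 1 0; rewrite ?z21 ?z11 ?z22 ?z12.
suff d1 : (`|dt| <= 1)%N.
  have : dt = 1 \/ dt = -1 by lia.
  by case=> ->.
rewrite leqNgt; apply/negP => d2.
(* A root of 1 + X + ... + X^(n-1) is an n-th root of unity different from 1 in characteristic 0. *)
pose p : {poly K} := \poly_(i < absz dt) 1.
have sp : size p = absz dt.
  by apply: (@size_poly_eq K _ (fun=> 1)); rewrite oner_neq0.
have [z rz] : exists z, root p z by apply/closed_rootP; rewrite sp; lia.
have pz : \sum_(i < absz dt) z ^+ i = 0.
  by move: rz; rewrite /root horner_poly => /eqP; under eq_bigr do rewrite mul1r.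
have zn : z ^+ (absz dt) = 1 by apply/eqP; rewrite -subr_eq0 subrX1 pz mulr0.
have z0 : z != 0 by apply/eqP => z0; move: zn; rewrite z0 expr0n; case: (absz dt) d2 => // n _ /eqP; rewrite eq_sym oner_eq0.
have zd : z ^ dt = 1.
  case: (intP dt) zn => [|n|n] /=; rewrite ?expr0z // => zn.
  by rewrite -invr_expz -[z ^ _]/(z ^+ n.+1) zn invr1.
have pair n1 n2 : n1 * w11 + n2 * w21 = 0 \/ n1 * w11 + n2 * w21 = dt ->
    n1 * w12 + n2 * w22 = 0 \/ n1 * w12 + n2 * w22 = dt -> z ^ n1 = 1 /\ z ^ n2 = 1.
  have ev n : n = 0 \/ n = dt -> z ^ n = 1 by case=> ->; rewrite ?expr0z.
  by move=> /ev e1 /ev e2; apply: inj; rewrite ?expfz_neq0 // !exprz_exp -!expfzDr.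
(* The rows of the adjugate are exponent vectors whose images are multiples of [dt], so the powers
   of [z] along them lie in the kernel. *)
have [h22 h12] : z ^ w22 = 1 /\ z ^ (- w12) = 1.
  by apply: pair; [right|left]; rewrite /dt; ring.
have [h21 h11] : z ^ (- w21) = 1 /\ z ^ w11 = 1.
  by apply: pair; [left|right]; rewrite /dt; ring.
have [z1 _] : z = 1 /\ 1 = 1 :> K.
  apply: inj; rewrite ?oner_neq0 ?exp1rz ?mulr1 //.
  by apply: invr_inj; rewrite invr1 -h12 invr_expz.
move: pz; rewrite z1; under eq_bigr do rewrite expr1n.
by rewrite sumr_const card_ord => /eqP; rewrite pnatr_eq0; lia.
Qed.

End Equiv.

Section HornEquiv.
Variable K : numClosedFieldType.

Lemma cofin_scale (P : K -> Prop) z : z != 0 -> cofin P -> cofin (fun t => P (z * t)).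
Proof.
move=> z0 [D D0 DP]; exists (D \Po (z *: 'X)) => [|t]; last first.
  by rewrite horner_comp hornerZ hornerX => /DP.
have [t Dt] := poly_nonroot D0; apply/eqP => e.
have : (D \Po (z *: 'X)).[t / z] = 0 by rewrite e horner0.
by rewrite horner_comp hornerZ hornerX mulrCA divff // mulr1 => /eqP; rewrite (negPf Dt).
Qed.

Variables (F : {mpoly K[3]}) (I : finType) (a b c : I -> int) (k1 k2 k3 : K).
Hypothesis H : horn_data F a b c k1 k2 k3.
Local Notation h := (line a b c).

(** Unimodularity comes from [horn_inj]: a kernel element (z1, z2) of the monomial map moves (x, y)
    to (z1 x, z2 y) without changing the products of lines, hence without changing (p, q), so z1 =
    z2 = 1. *)
Lemma horn_equiv d D (G : {mpoly K[3]}) (X Y : K -> K -> K) w11 w12 w21 w22 i j (r1 r2 r3 : K) :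
  F \is d.-homog -> G \is D.-homog -> (0 < D)%N -> r1 != 0 -> r2 != 0 -> r3 != 0 ->
  cofin (fun x => cofin (fun y => exists p q, [/\ off_lines a b c p q, X p q = x, Y p q = y &
    [/\ \prod_l h l p q ^ a l = r1 * (x ^ w11 * y ^ w21),
        \prod_l h l p q ^ b l = r2 * (x ^ w12 * y ^ w22) &
        \prod_l h l p q ^ (- c l) = r3 * (x ^ i * y ^ j) * G.@[pt x y]]])) ->
  poly_equiv F G.
Proof.
move=> hF hG D0 r10 r20 r30 E.
apply: (@monomial_equiv _ d D F G w11 w12 w21 w22 i j (w11 * w22 - w12 * w21) (k1 * r1) (k2 * r2) (k3 * r3)) => //;
  rewrite ?mulf_neq0 ?(horn_k1 H) ?(horn_k2 H) ?(horn_k3 H) //.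
- apply: (@monomial_det K) => z1 z2 z10 z20 e1 e2.
  have [x [[x0 Ex] Ex']] := cofin_ex (cofinI (cofinI (cofin_neq 0) E) (cofin_scale z10 E)).
  have [y [[y0 [p [q [U xE yE [h1 h2 _]]]]]]] :=
    cofin_ex (cofinI (cofinI (cofin_neq 0) Ex) (cofin_scale z20 Ex')).
  move=> [p' [q' [U' xE' yE' [h1' h2' _]]]].
  have [] := horn_inj H U U'.
  - rewrite h1 h1' !expfzMl; congr (_ * (_ * _)).
    by rewrite mulrACA e1 mul1r.
  - rewrite h2 h2' !expfzMl; congr (_ * (_ * _)).
    by rewrite mulrACA e2 mul1r.
  move=> ep eq; subst p' q'; move: xE' yE'; rewrite xE yE => /esym xx /esym yy.
  by split; [apply: (mulIf x0)|apply: (mulIf y0)]; rewrite mul1r.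
apply: cofin_sub E => x; apply: cofin_sub => y [p [q [U _ _ [h1 h2 h3]]]].
by have [] := horn_eq H U; rewrite h1 h2 h3 !mulrA.
Qed.

End HornEquiv.

(** * The three configurations *)

Section EndFour.
Variable K : numClosedFieldType.
Variables (d : nat) (F : {mpoly K[3]}) (I : finType) (a b c : I -> int) (k1 k2 k3 : K).
Hypothesis hF : F \is d.-homog.
Hypothesis H : horn_data F a b c k1 k2 k3.
Local Notation h := (line a b c).

Lemma solve2 (s t : I) (u v : K) : ~~ par a b s t ->
  exists p q, h s p q = u /\ h t p q = v.
Proof.
rewrite /par -subr_eq0 -(intr_eq0 K) rmorphB !rmorphM /= => n.
set D := _ - _ in n.
exists (((u - (c s)%:~R) * (b t)%:~R - (v - (c t)%:~R) * (b s)%:~R) / - D).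
exists (((v - (c t)%:~R) * (a s)%:~R - (u - (c s)%:~R) * (a t)%:~R) / - D).
by split; rewrite /line /D in n *; field; rewrite ?n //.
Qed.

(** The lines of a pair have a constant sum, so X = h s1 / h t1 gives 1 + X = [m] / h t1, and F
    becomes a monomial in X and Y times (1 + X)^m (1 + Y)^n. *)
Lemma four_equiv : four_lines a b c -> exists m n : nat, [/\ (1 <= m)%N, (1 <= n)%N &
  poly_equiv F (('X_o0 + 'X_o2) ^+ m * ('X_o1 + 'X_o2) ^+ n)].
Proof.
move=> [s1 [t1 [s2 [t2 [[pe n12] [at1 bt1] [at2 bt2] [g1 g2]]]]]].
have [m Em] : exists m : nat, c s1 + c t1 = m%:Z by exists (absz (c s1 + c t1)); rewrite gez0_abs // ltW.
have [n En] : exists n : nat, c s2 + c t2 = n%:Z by exists (absz (c s2 + c t2)); rewrite gez0_abs // ltW.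
rewrite Em ltz_nat in g1; rewrite En ltz_nat in g2.
have m0 : m%:R != 0 :> K by rewrite pnatr_eq0 -lt0n.
have n0 : n%:R != 0 :> K by rewrite pnatr_eq0 -lt0n.
exists m, n; split=> //.
pose X (p q : K) := h s1 p q / h t1 p q; pose Y (p q : K) := h s2 p q / h t2 p q.
have sum1 (p q : K) : h s1 p q + h t1 p q = m%:R.
  by rewrite -[m%:R]/(m%:~R) -Em /line at1 bt1 !rmorphD !rmorphN /=; ring.
have sum2 (p q : K) : h s2 p q + h t2 p q = n%:R.
  by rewrite -[n%:R]/(n%:~R) -En /line at2 bt2 !rmorphD !rmorphN /=; ring.
apply: (@horn_equiv K F I a b c k1 k2 k3 H d (1 * m + 1 * n)%N _ X Y (a s1) (b s1) (a s2) (b s2) (- c s1) (- c s2)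
  1 1 (m%:R ^- m * n%:R ^- n)) => //; rewrite ?oner_neq0 //.
- by apply: dhomogM; apply: dhomogMn; rewrite rpredD // dhomogX /= mdeg1.
- by rewrite !mul1n addn_gt0 g1.
- by rewrite mulf_neq0 // invr_eq0 expf_neq0.
apply: cofin_sub2 (cofin_neq 0) (cofin_neq (-1)) => x x0 x1.
apply: cofin_sub2 (cofin_neq 0) (cofin_neq (-1)) => y y0 y1.
have x1' : 1 + x != 0 by rewrite addrC -[1]opprK subr_eq0.
have y1' : 1 + y != 0 by rewrite addrC -[1]opprK subr_eq0.
have [p [q [hs1 hs2]]] := solve2 (m%:R * x / (1 + x)) (n%:R * y / (1 + y)) n12.
have ht1 : h t1 p q = m%:R / (1 + x).
  by apply: (addrI (h s1 p q)); rewrite sum1 hs1; field.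
have ht2 : h t2 p q = n%:R / (1 + y).
  by apply: (addrI (h s2 p q)); rewrite sum2 hs2; field.
have P (f : I -> K) : \prod_l f l = f s1 * f t1 * (f s2 * f t2).
  by rewrite (perm_big _ pe) /= !big_cons big_nil mulr1 !mulrA.
exists p, q; split.
- move=> l; have : l \in [:: s1; t1; s2; t2] by rewrite -(perm_mem pe) mem_index_enum.
  rewrite !inE => /or4P[] /eqP->; by rewrite ?hs1 ?ht1 ?hs2 ?ht2 !mulf_neq0 ?invr_eq0.
- by rewrite /X hs1 ht1; field; apply/andP.
- by rewrite /Y hs2 ht2; field; apply/andP.
have cm : c t1 = m%:Z - c s1 by rewrite -Em addrAC subrr add0r.
have cn : c t2 = n%:Z - c s2 by rewrite -En addrAC subrr add0r.
have E1 (u t : K) k : t != 0 -> (u * t) ^ k * t ^ (- k) = u ^ k.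
  by move=> t0; rewrite expfzMl -mulrA -expfzDr // subrr mulr1.
have E2 (u t : K) k l : t != 0 -> (u * t) ^ (- k) * t ^ (- (l - k)) = u ^ (- k) * t ^ (- l).
  by move=> t0; rewrite expfzMl -mulrA -expfzDr //; congr (_ * _ ^ _); ring.
have t10 : h t1 p q != 0 by rewrite ht1 mulf_neq0 ?invr_eq0.
have t20 : h t2 p q != 0 by rewrite ht2 mulf_neq0 ?invr_eq0.
have hs1' : h s1 p q = x * h t1 p q by rewrite hs1 ht1; ring.
have hs2' : h s2 p q = y * h t2 p q by rewrite hs2 ht2; ring.
split; rewrite P ?at1 ?bt1 ?at2 ?bt2 ?cm ?cn hs1' hs2' ?E1 ?E2 ?mul1r //.
rewrite mevalM !rmorphXn /= !mevalD !mevalXU /pt /= ht1 ht2 -!invr_expz -![_ ^ Posz _]/(_ ^+ _).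
rewrite !(addrC _ 1) !expr_div_n; field.
by rewrite ?expfz_neq0 ?expf_neq0 //=; apply/and4P; split; rewrite ?expf_neq0.
Qed.

End EndFour.

(** * Three pairs of parallel lines and the conic *)

Section EndSix.
Variable K : numClosedFieldType.
Variables (d : nat) (F : {mpoly K[3]}) (I : finType) (a b c : I -> int) (k1 k2 k3 : K).
Hypothesis hF : F \is d.-homog.
Hypothesis H : horn_data F a b c k1 k2 k3.
Local Notation h := (line a b c).

Definition conic : {mpoly K[3]} := 'X_o0 ^+ 2 + 'X_o1 ^+ 2 + 'X_o2 ^+ 2 -
  2 * ('X_o0 * 'X_o1 + 'X_o0 * 'X_o2 + 'X_o1 * 'X_o2).

Lemma conic_homog : conic \is 2.-homog.
Proof.
have X i j : 'X_i * 'X_j \is [in K[3], 2.-homog] by rewrite -[2%N]/(1 + 1)%N; apply: dhomogM; rewrite dhomogX /= mdeg1.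
have X2 i : 'X_i ^+ 2 \is [in K[3], 2.-homog] by rewrite expr2 X.
by rewrite /conic mulr_natl !(rpredB, rpredD, rpredMn).
Qed.

Lemma conic_eval x y : conic.@[pt x y] = x ^+ 2 + y ^+ 2 + 1 - 2 * (x * y + x + y).
Proof.
rewrite /conic !(mevalB, mevalD, mevalM, mevalXU, meval1) /pt /=; ring.
Qed.

Lemma cofin_conic x : cofin (fun y => conic.@[pt x y] != 0).
Proof.
exists ('X^2 + (- 2 * (x + 1)) *: 'X + ((x - 1) ^+ 2)%:P).
  apply/eqP => /polyP/(_ 2); rewrite !coefD coefXn coefZ coefX coefC coef0 /= mulr0 !addr0.
  by move/eqP; rewrite oner_eq0.
move=> y; rewrite conic_eval !hornerD hornerXn hornerZ hornerX hornerC.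
by congr (_ != 0); ring.
Qed.

Lemma six_equiv : six_lines a b c -> exists n : nat, (1 <= n)%N /\ poly_equiv F (conic ^+ n).
Proof.
move=> [s1 [t1 [s2 [t2 [s3 [t3 [[pe n12] [at1 bt1 ct1] [at2 bt2 ct2] [at3 bt3 ct3]]]]]]]].
have g := csum_gt0 H; have sa := horn_suma H; have sb := horn_sumb H.
have [n En] : exists n : nat, \sum_l c l = n%:Z by exists (absz (\sum_l c l)); rewrite gez0_abs // ltW.
have S (f : I -> int) : \sum_l f l = f s1 + f t1 + (f s2 + f t2) + (f s3 + f t3).
  by rewrite (perm_big _ pe) /= !big_cons big_nil; ring.
rewrite En in g ct1 ct2 ct3; rewrite ltz_nat in g.
move: sa sb En; rewrite !S at1 at2 at3 bt1 bt2 bt3 => sa sb En.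
have a3 : a s3 = - a s1 - a s2 by lia.
have b3 : b s3 = - b s1 - b s2 by lia.
have c3 : c s3 = - n%:Z - c s1 - c s2 by lia.
have [m m0 Em] : exists2 m : K, m != 0 & n%:R = 2 * m.
  exists (n%:R / 2); last by field.
  by rewrite mulf_neq0 ?invr_eq0 ?pnatr_eq0 // -lt0n.
exists n; split=> //.
(* The lines of a pair have equal exponents in x and y, so only the products h s h t occur there. *)
pose X (p q : K) := h s1 p q * h t1 p q / (h s3 p q * h t3 p q).
pose Y (p q : K) := h s2 p q * h t2 p q / (h s3 p q * h t3 p q).
have hs3 (p q : K) : h s3 p q = - (2 * m) - h s1 p q - h s2 p q.
  by rewrite -Em -[n%:R]/(n%:~R) /line a3 b3 c3 !rmorphB !rmorphN /=; ring.
have ht (s t : I) (p q : K) : a t = a s -> b t = b s -> c t = c s + n -> h t p q = h s p q + 2 * m.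
  by move=> ea eb ec; rewrite -Em -[n%:R]/(n%:~R) /line ea eb ec !rmorphD /=; ring.
apply: (@horn_equiv K F I a b c k1 k2 k3 H d (2 * n)%N _ X Y (a s1) (b s1) (a s2) (b s2)
  (- c s1 - n%:Z) (- c s2 - n%:Z) 1 1 ((8 * m) ^- n)) => //; rewrite ?oner_neq0 //.
- by apply: dhomogMn conic_homog.
- by rewrite muln_gt0.
- by rewrite invr_eq0 expf_neq0 // mulf_neq0 // pnatr_eq0.
apply: cofin_sub (cofin_neq 0) => x x0.
apply: cofin_sub2 (cofinI (cofin_neq 0) (cofin_conic x))
  (cofinI (cofin_neq (x + 1)) (cofinI (cofin_neq (1 - x)) (cofin_neq (x - 1)))) => y [y0].
have [Q QQ] : exists Q, Q = conic.@[pt x y] by eexists.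
have := conic_eval x y; rewrite -QQ => QE Q0 [yp [ym yd]].
have {}yp : x - y + 1 != 0 by apply: contra_neq yp => e; rewrite -[y]addr0 -e; ring.
have {}ym : x + y - 1 != 0 by apply: contra_neq ym => e; rewrite -[y]subr0 -e; ring.
have {}yd : x - y - 1 != 0 by apply: contra_neq yd => e; rewrite -[y]addr0 -e; ring.
(* The inverse is the polar map of the answer: with G = conic^n, the forms h t are x G_x / G, y G_y
   / G and z G_z / G at (x, y, 1), and each h s is h t - n with n = 2 m. Their numerators factor
   through [A], [B] and [C]. *)
pose A := x - y + 1; pose B := x + y - 1; pose C := x - y - 1.
have [p [q [h1 h2]]] := solve2 c (2 * m * (A * B) / Q) (2 * m * (- C * B) / Q) n12.
have h3 : h s3 p q = 2 * m * (- C * A) / Q.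
  by rewrite hs3 h1 h2; apply: (mulIf Q0); rewrite !mulrBl !divfK // /A /B /C QE; ring.
have t1E : h t1 p q = 4 * m * x * C / Q.
  by rewrite (ht s1) // h1; apply: (mulIf Q0); rewrite mulrDl !divfK // /A /B /C QE; ring.
have t2E : h t2 p q = - 4 * m * y * A / Q.
  by rewrite (ht s2) // h2; apply: (mulIf Q0); rewrite mulrDl !divfK // /A /B /C QE; ring.
have t3E : h t3 p q = - 4 * m * B / Q.
  by rewrite (ht s3) // h3; apply: (mulIf Q0); rewrite mulrDl !divfK // /A /B /C QE; ring.
have P (f : I -> K) : \prod_l f l = f s1 * f t1 * (f s2 * f t2) * (f s3 * f t3).
  by rewrite (perm_big _ pe) /= !big_cons big_nil mulr1 !mulrA.
have four0 : (4 : K) != 0 by rewrite pnatr_eq0.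
have two0 : (2 : K) != 0 by rewrite pnatr_eq0.
pose W := 8 * m ^+ 2 * A * B * C / Q ^+ 2.
have W0 : W != 0.
  by rewrite /W !mulf_neq0 ?invr_eq0 ?expf_neq0 // pnatr_eq0.
have Z1 : h s1 p q * h t1 p q = x * W by rewrite h1 t1E /W; field.
have Z2 : h s2 p q * h t2 p q = y * W by rewrite h2 t2E /W; field.
have Z3 : h s3 p q * h t3 p q = W by rewrite h3 t3E /W; field.
(* This is how the conic enters F: the constants within a pair differ by n, which leaves an n-th
   power of the product of the h s. *)
have Z : h s1 p q * h s2 p q * h s3 p q = W ^+ 2 * Q / (8 * m).
  by rewrite h1 h2 h3 /W; field; rewrite m0.
have E (s t : I) k : h s p q ^ k * h t p q ^ k = (h s p q * h t p q) ^ k by rewrite expfzMl.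
have EV (s t : I) k : h s p q != 0 -> h t p q != 0 ->
    h s p q ^ (- k) * h t p q ^ (- (k + n)) = (h s p q * h t p q) ^ (- k - n%:Z) * h s p q ^ n.
  move=> s0 t0; rewrite expfzMl mulrAC -expfzDr // opprD; congr (_ ^ _ * _); ring.
have off l : h l p q != 0.
  have : l \in [:: s1; t1; s2; t2; s3; t3] by rewrite -(perm_mem pe) mem_index_enum.
  rewrite !inE => /orP[/eqP->|/orP[/eqP->|/or4P[] /eqP->]];
    by rewrite ?h1 ?t1E ?h2 ?t2E ?h3 ?t3E !mulf_neq0 ?invr_eq0 ?oppr_eq0.
exists p, q; split=> //.
- by rewrite /X Z1 Z3 mulfK.
- by rewrite /Y Z2 Z3 mulfK.
clearbody W.
have R (u v : int) : (x * W) ^ u * (y * W) ^ v * W ^ (- u - v) = 1 * (x ^ u * y ^ v).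
  rewrite !expfzMl !expfzDr // -!invr_expz; field; by rewrite !expfz_neq0.
split; rewrite P ?at1 ?at2 ?at3 ?bt1 ?bt2 ?bt3 ?ct1 ?ct2 ?ct3 ?E ?EV //.
- by rewrite Z1 Z2 Z3 a3 R.
- by rewrite Z1 Z2 Z3 b3 R.
rewrite Z1 Z2 Z3 rmorphXn /= -QQ.
transitivity ((x * W) ^ (- c s1 - n%:Z) * (y * W) ^ (- c s2 - n%:Z) * W ^ (- (- c s1 - n%:Z) - (- c s2 - n%:Z))
  * W ^ (- (n%:Z + n%:Z)) * (h s1 p q * h s2 p q * h s3 p q) ^+ n).
  rewrite -[_ * W ^ _ * W ^ _]mulrA -expfzDr // !exprMn -![_ ^ Posz _]/(_ ^+ _).
  set w1 := W ^ _; set w2 := W ^ _; have -> : w1 = w2 by rewrite /w1 /w2 c3; congr (_ ^ _); ring.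
  ring.
rewrite R mul1r Z exprMn exprMn exprVn -exprM mul2n -addnn.
have -> : W ^ (- (n%:Z + n%:Z)) = (W ^+ (n + n))^-1 by rewrite -invr_expz.
set w := W ^+ _; have w0 : w != 0 by rewrite expf_neq0.
set v := _ ^+ n; field; by rewrite w0 andbT expf_neq0 ?mulf_neq0 ?pnatr_eq0.
Qed.

End EndSix.

(** * Injective rational functions of one variable *)

Section Moebius.
Variable K : numClosedFieldType.

(** If A' B = A B', coprimality makes A divide A', which is nonzero and of smaller degree. *)
Lemma wronskian_neq0 (A B : {poly K}) : coprimep A B -> (1 < size A)%N ->
  A^`() * B - A * B^`() != 0.
Proof.
move=> AB sA; rewrite subr_eq0; apply/eqP => E.
have A0 : A != 0 by rewrite -size_poly_gt0 ltnW.
have dA : A %| A^`() by rewrite -(Gauss_dvdpl _ AB) E dvdp_mulr.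
have A'0 : A^`() != 0.
  apply/eqP => /polyP/(_ (size A).-2); rewrite coef_deriv coef0 => /eqP.
  by rewrite mulrn_eq0 /= prednK ?lead_coef_eq0 ?(negPf A0) //; case: (size A) sA => [|[]].
by have := dvdp_leq A'0 dA; rewrite leqNgt lt_size_deriv.
Qed.

(* For generic s, B.[s] *: A - A.[s] *: B has no root other than s, which is
   simple since the Wronskian does not vanish there; so A and B are linear. *)
Lemma injective_fraction (A0 B0 : {poly K}) : A0 \is monic -> B0 \is monic -> size A0 = size B0 ->
  (forall s s', A0.[s] != 0 -> B0.[s] != 0 -> A0.[s'] != 0 -> B0.[s'] != 0 ->
     A0.[s] * B0.[s'] = A0.[s'] * B0.[s] -> s = s') ->
  exists r1 r2, r1 != r2 /\ A0 * ('X - r2%:P) = B0 * ('X - r1%:P).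
Proof.
move=> mA mB sAB inj.
have A00 := monic_neq0 mA; have B00 := monic_neq0 mB.
set G := gcdp A0 B0; pose A := A0 %/ G; pose B := B0 %/ G.
have AG : A0 = A * G by rewrite divpK ?dvdp_gcdl.
have BG : B0 = B * G by rewrite divpK ?dvdp_gcdr.
have G0 : G != 0 by rewrite gcdp_eq0 negb_and A00.
have A1 : A != 0 by apply: contraNneq A00 => A0'; rewrite AG A0' mul0r.
have B1 : B != 0 by apply: contraNneq B00 => B0'; rewrite BG B0' mul0r.
have cop : coprimep A B by apply: coprimep_div_gcd; rewrite A00.
have sE : size A = size B.
  have : size A0 = size B0 by []; rewrite AG BG !size_mul //.
  move: A1 B1 G0; rewrite -!size_poly_gt0.
  by case: (size A) (size B) (size G) => [|u] [|v] [|w] //= _ _ _ /addIn->.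
have lE : lead_coef A = lead_coef B.
  apply: (mulIf (_ : lead_coef G != 0)); first by rewrite lead_coef_eq0.
  by rewrite -!lead_coefM -AG -BG (monicP mA) (monicP mB).
have gen : cofin (fun s => A0.[s] != 0 /\ B0.[s] != 0) by apply: cofinI (cofin_poly A00) (cofin_poly B00).
have AneB : A != B.
  apply/eqP => AB; have [s [as0 bs0]] := cofin_ex gen.
  have [s' [[as'0 bs'0]]] := cofin_ex (cofinI gen (cofin_neq s)).
  by rewrite (inj s' s) ?eqxx // AG BG AB mulrC.
have sA : (1 < size A)%N.
  rewrite ltnNge; apply/negP => sA1; case/eqP: AneB.
  have sB1 : (size B <= 1)%N by rewrite -sE.
  move: lE; rewrite (size1_polyC sA1) (size1_polyC sB1) !lead_coefC => -> //.
have nonprop z : A.[z] != 0 -> B.[z] != 0 -> A.[z] *: B - B.[z] *: A != 0.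
  move=> az bz; rewrite subr_eq0; apply/eqP => E.
  have : A %| A.[z] *: B by rewrite E dvdpZr.
  rewrite dvdpZr // => dAB; have := coprimep_dvdl dAB cop.
  by rewrite coprimepp => /eqP s1; rewrite s1 in sA.
(* Injectivity is known only off the zeros of [A0] and [B0], so [s] must also avoid the fibres
   through roots of the common factor [G]. *)
have Gg : cofin (fun s => forall z, root G z -> A.[z] != 0 -> B.[z] != 0 -> A.[z] * B.[s] != B.[z] * A.[s]).
  have [rs Grs] := closed_field_poly_normal G.
  have : cofin (fun s => forall z, z \in rs -> A.[z] != 0 -> B.[z] != 0 -> A.[z] * B.[s] != B.[z] * A.[s]).
    apply: cofin_seq => z _; case: (eqVneq A.[z] 0) => [az|az]; first by apply: cofin_all => s.
    case: (eqVneq B.[z] 0) => [bz|bz]; first by apply: cofin_all => s.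
    apply: cofin_sub (cofin_poly (nonprop z az bz)) => s.
    by rewrite hornerD hornerN !hornerZ subr_eq0.
  apply: cofin_sub => s h z; rewrite Grs rootZ ?lead_coef_eq0 // root_prod_XsubC; exact: h.
have Wg := cofin_poly (wronskian_neq0 cop sA).
have := cofinI (cofinI gen Gg) (cofinI Wg (cofin_poly (_ : A - B != 0))).
rewrite subr_eq0 => /(_ AneB) /cofin_ex[s [[[as0 bs0] Gs] [Ws ABs]]].
pose P := B.[s] *: A - A.[s] *: B.
have [as1 gs1] : A.[s] != 0 /\ G.[s] != 0 by apply/andP; move: as0; rewrite AG hornerM mulf_eq0 negb_or.
have bs1 : B.[s] != 0 by move: bs0; rewrite BG hornerM mulf_eq0 negb_or => /andP[].
(* [A] and [B] share their leading coefficient and differ at [s], so the top terms of [P] do not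
   cancel. *)
have sP : size P = size A.
  apply/eqP; rewrite eqn_leq; apply/andP; split.
    rewrite /P (leq_trans (size_polyD _ _)) // geq_max size_polyN !(leq_trans (size_scale_leq _ _)) //.
    by rewrite sE.
  rewrite leqNgt; apply/negP => sPA; have : P`_(size A).-1 = 0 by apply: nth_default; rewrite -ltnS prednK // ltnW.
  rewrite coefB !coefZ {2}sE -!/(lead_coef _) lE -mulrBl => /eqP.
  rewrite mulf_eq0 lead_coef_eq0 (negPf B1) orbF subr_eq0 => /eqP e.
  by move: ABs; rewrite hornerD hornerN e subrr eqxx.
have rP z : root P z -> z = s.
  rewrite /root hornerD hornerN !hornerZ subr_eq0 => /eqP E.
  have cz : ~~ ((A.[z] == 0) && (B.[z] == 0)).
    apply/negP => /andP[az bz]; have := coprimep_root cop az; by rewrite bz.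
  have az : A.[z] != 0.
    apply: contraNneq cz => az; rewrite az eqxx /=; move/eqP: E; rewrite az mulr0 eq_sym mulf_eq0.
    by rewrite (negPf as1).
  have bz : B.[z] != 0.
    apply: contraNneq cz => bz; rewrite bz eqxx andbT; move/eqP: E; rewrite bz mulr0 mulf_eq0.
    by rewrite (negPf bs1).
  have gz : G.[z] != 0.
    apply: contraTneq isT => gz; have := Gs z; rewrite /root gz eqxx az bz => /(_ isT isT isT)/eqP[].
    by rewrite mulrC E mulrC.
  apply: inj; rewrite ?AG ?BG ?hornerM ?mulf_neq0 //.
  by rewrite mulrACA [RHS]mulrACA (mulrC A.[z]) E (mulrC G.[z]).
have rs : root P s by rewrite /root hornerD hornerN !hornerZ mulrC subrr.
have [Q PQ] := factor_theorem _ _ rs.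
have sQ : size Q = 1%N.
  apply/eqP; rewrite -[_ == _]negbK; apply/negP => /closed_rootP[z Qz].
  have zs : z = s by apply: rP; rewrite PQ rootM Qz.
  have : P^`().[s] = 0.
    rewrite PQ derivM derivXsubC mulr1 hornerD hornerM hornerXsubC subrr mulr0 add0r.
    by rewrite -zs; apply/eqP.
  rewrite /P derivB !derivZ hornerD hornerN !hornerZ => /eqP.
  by move: Ws; rewrite hornerD hornerN !hornerM mulrC => /negPf->.
have sP2 : size A = 2%N.
  by rewrite -sP PQ size_mul ?polyXsubC_eq0 // -?size_poly_gt0 sQ ?size_XsubC.
have lin (C : {poly K}) : size C = 2%N -> exists r, C = lead_coef C *: ('X - r%:P).
  move=> sC; have [rs' Crs] := closed_field_poly_normal C.
  have : size rs' = 1%N.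
    have lC : lead_coef C != 0 by rewrite lead_coef_eq0 -size_poly_gt0 sC.
    by move: sC; rewrite Crs size_scale // (size_prod_XsubC _ id) => -[].
  by case: rs' Crs => [|r []] //= Crs _; exists r; rewrite {1}Crs big_seq1.
have [r1 Ar] := lin A sP2; have [r2 Br] := lin B (etrans (esym sE) sP2).
exists r1, r2; split.
  by apply: contraNneq AneB => r12; rewrite Ar Br lE r12.
by rewrite AG BG Ar Br lE -!scalerAl; congr (_ *: _); rewrite mulrAC [RHS]mulrAC; congr (_ * _); rewrite mulrC.
Qed.

Lemma mup_prod (T : Type) (s : seq T) (r : T -> K) (P : pred T) (m : T -> nat) x :
  mup x (\prod_(t <- s | P t) ('X - (r t)%:P) ^+ m t) = (\sum_(t <- s | P t && (r t == x)) m t)%N.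
Proof.
rewrite -(mul1n (\sum_(_ <- s | _) _)%N) big_mkcondr /=.
elim: s => [|t s IH]; first by rewrite !big_nil muln0 mupNroot // root1.
rewrite !big_cons; case: (P t) => //; rewrite mupM ?expf_neq0 ?polyXsubC_eq0 //.
  by rewrite IH mup_XsubCX !mul1n; case: eqP.
by apply/monic_neq0/monic_prod => i _; apply: monic_exp; apply: monicXsubC.
Qed.

Section Exponents.
Variables (T : finType) (r : T -> K).

(** Representatives in the finite type [T] allow a big operation to be partitioned by the values of
    [r]. *)
Lemma grouped_rep : exists rep : T -> T,
  (forall t, r (rep t) = r t) /\ forall t u, (rep t == rep u) = (r t == r u).
Proof.
pose rep t := odflt t [pick u | r u == r t].
have rrep t : r (rep t) = r t.
  by rewrite /rep; case: pickP => /= [u /eqP //|/(_ t)]; rewrite eqxx.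
exists rep; split=> // t u; apply/eqP/eqP => [e|e]; first by rewrite -rrep e rrep.
rewrite /rep (eq_pick (Q := fun v => r v == r u)) => [|v]; last by rewrite /= e.
by case: pickP => //= /(_ u); rewrite eqxx.
Qed.

Lemma grouped0 (V : Type) (idx : V) (op : Monoid.com_law idx) (f : T -> V) :
  (forall u, \big[op/idx]_(t | r t == r u) f t = idx) -> \big[op/idx]_t f t = idx.
Proof.
have [rep [rrep repE]] := grouped_rep => f0.
rewrite (partition_big rep predT) //= big1 // => u _.
case: (pickP (fun t => rep t == u)) => [t0 /eqP <-|no]; last by rewrite big_pred0.
by under eq_bigl do rewrite repE.
Qed.

Lemma prod_grouped (m : T -> int) s : (forall t, s != r t) ->
  (forall x, \sum_(t | r t == x) m t = 0) -> \prod_t (s - r t) ^ m t = 1.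
Proof.
move=> off m0; apply: grouped0 => u.
transitivity (\prod_(t | r t == r u) (s - r u) ^ m t).
  by apply: eq_bigr => t /eqP <-.
have su : s - r u != 0 by rewrite subr_eq0.
rewrite -(big_morph (fun n : int => (s - r u) ^ n) (op1 := *%R) (op2 := +%R) (id2 := 0)).
- by rewrite m0 expr0z.
- by move=> i j; rewrite expfzDr.
- by rewrite expr0z.
Qed.

Lemma injective_exponents (n : T -> int) : \sum_t n t = 0 ->
  (forall s s', (forall t, n t != 0 -> s != r t) -> (forall t, n t != 0 -> s' != r t) ->
    \prod_t (s - r t) ^ n t = \prod_t (s' - r t) ^ n t -> s = s') ->
  exists r1 r2, r1 != r2 /\
    forall x, \sum_(t | r t == x) n t = (x == r1)%:Z - (x == r2)%:Z.
Proof.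
move=> sn inj.
pose A : {poly K} := \prod_(t | 0 < n t) ('X - (r t)%:P) ^+ absz (n t).
pose B : {poly K} := \prod_(t | ~~ (0 < n t)) ('X - (r t)%:P) ^+ absz (n t).
have split_sum (Q : pred T) : \sum_(t | Q t) n t =
    (\sum_(t | (0 < n t)%R && Q t) absz (n t))%N%:Z - (\sum_(t | ~~ (0 < n t)%R && Q t) absz (n t))%N%:Z.
  rewrite (bigID (fun t => 0 < n t)) /= !(big_morph Posz PoszD (erefl _)) -sumrN.
  by congr (_ + _); apply: eq_big => t; rewrite 1?andbC // => /andP[]; lia.
have split_prod s : \prod_t (s - r t) ^ n t = A.[s] / B.[s].
  rewrite (bigID (fun t => 0 < n t)) /= !horner_prod -prodfV.
  congr (_ * _); apply: eq_bigr => t; rewrite horner_exp hornerXsubC; first by case: (n t).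
  by case: (n t) => [[|k]|k] //; rewrite expr0z expr0 invr1.
have mon (Q : pred T) : \prod_(t | Q t) ('X - (r t)%:P) ^+ absz (n t) \is monic.
  by apply: monic_prod => t _; apply: monic_exp; apply: monicXsubC.
have off s : A.[s] != 0 -> B.[s] != 0 -> forall t, n t != 0 -> s != r t.
  move=> As Bs t nt; apply/eqP => st.
  have z : ('X - (r t)%:P).[s] ^+ absz (n t) = 0.
    by rewrite hornerXsubC st subrr expr0n absz_eq0 (negPf nt).
  case p: (0 < n t).
    by move: As; rewrite horner_prod (bigD1 t) //= horner_exp z mul0r eqxx.
  by move: Bs; rewrite horner_prod (bigD1 t) ?p //= horner_exp z mul0r eqxx.
have [|s s' As Bs As' Bs' e|r1 [r2 [r12 E]]] := injective_fraction (mon (fun t => 0 < n t)) (mon (fun t => ~~ (0 < n t))).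
- rewrite !size_prod_XsubC_exp; congr _.+1; apply/eqP; rewrite -eqz_nat -subr_eq0; apply/eqP.
  apply: etrans (etrans (esym (split_sum xpredT)) sn).
  by congr (_%:Z - _%:Z); apply: eq_bigl => t; rewrite andbT.
- apply: inj; [exact: off|exact: off|].
  by rewrite !split_prod; apply/eqP; rewrite eqr_div // e.
exists r1, r2; split=> // x; rewrite split_sum.
have := congr1 (mup x) E; rewrite !mupM ?polyXsubC_eq0 ?monic_neq0 ?mon //.
have mX y : mup x ('X - y%:P) = (if y == x then 1%N else 0%N).
  by rewrite -mup_XsubCX expr1.
rewrite !mup_prod !mX !(eq_sym x); case: (r1 == x); case: (r2 == x) => /=; lia.
Qed.

End Exponents.

(** Adjoining [r1] and [r2] with opposite exponents reduces to the case where all grouped exponents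
    vanish. *)
Lemma two_points (T : finType) (r : T -> K) (m : T -> int) r1 r2 j1 j2 :
  (forall x, \sum_(t | r t == x) m t = (x == r1)%:Z * j1 + (x == r2)%:Z * j2) ->
  \sum_t m t = j1 + j2 /\
  forall s, (forall t, s != r t) -> s != r1 -> s != r2 ->
    \prod_t (s - r t) ^ m t = (s - r1) ^ j1 * (s - r2) ^ j2.
Proof.
move=> E; pose r' (t : T + bool) := match t with inl t => r t | inr b => if b then r1 else r2 end.
pose m' (t : T + bool) := match t with inl t => m t | inr b => if b then - j1 else - j2 end.
have E' x : \sum_(t | r' t == x) m' t = 0.
  rewrite big_sumType /= E big_mkcond big_bool /= !(eq_sym x).
  by case: (r1 == x); case: (r2 == x); rewrite /=; ring.
split=> [|s off s1 s2].
  have := @grouped0 _ r' _ 0 +%R m' (fun u => E' _).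
  rewrite big_sumType big_bool /= => /eqP; rewrite -opprD subr_eq0 => /eqP //.
have off' t : s != r' t by case: t => [t|[]] /=.
have := prod_grouped off' E'; rewrite big_sumType big_bool /= -!invr_expz -invfM => e.
by apply: divr1_eq.
Qed.

End Moebius.

Lemma primitive_direction (x y : int) : (x != 0) || (y != 0) ->
  exists al be u v g : int, [/\ x = g * al, y = g * be & u * al + v * be = 1].
Proof.
move=> xy; have [u [v uv]] := Bezoutz x y.
have g0 : gcdz x y != 0 by rewrite gcdz_eq0 negb_and.
have xE : x = gcdz x y * (x %/ gcdz x y)%Z by rewrite mulrC divzK // dvdz_gcdl.
have yE : y = gcdz x y * (y %/ gcdz x y)%Z by rewrite mulrC divzK // dvdz_gcdr.
exists (x %/ gcdz x y)%Z, (y %/ gcdz x y)%Z, u, v, (gcdz x y); split=> //.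
apply: (mulfI g0); rewrite mulr1 mulrDr !(mulrCA (gcdz x y)) -xE -yE //.
Qed.

Lemma two_point_monomial (K : fieldType) (W Y D x : K) (M j e C : int) :
  W != 0 -> Y != 0 -> D != 0 -> x != 0 ->
  x ^ C * ((- W * Y / D) ^ j * (W * x ^ M / D) ^ (- j - e)) =
  (-1) ^ j * W ^ (- e) * Y ^ j * (x ^ (C - M * j - M * e) * D ^ e).
Proof.
move=> W0 Y0 D0 x0; rewrite -[- W]mulN1r !expfzMl !exprz_inv exprz_exp.
have -> : - (- j - e) = j + e by ring.
have -> : M * (- j - e) = - (M * j) - M * e by ring.
rewrite !expfzDr // -!invr_expz; field.
by rewrite !expfz_neq0.
Qed.

(** * One class of parallel lines and two further lines *)

Section EndFan.
Variable K : numClosedFieldType.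
Variables (d : nat) (F : {mpoly K[3]}) (I : finType) (a b c : I -> int) (k1 k2 k3 : K).
Hypothesis hF : F \is d.-homog.
Hypothesis H : horn_data F a b c k1 k2 k3.
Local Notation h := (line a b c).
Local Notation par := (par a b).

(** A primitive direction makes the multiples [mu] integral. Their sum is nonzero with the mass, and
    the sign of the direction is free. *)
Lemma fan_direction l1 : cmass K a b l1 != 0 -> exists (al be : int) (mu : I -> int),
  [/\ forall l, par l1 l -> a l = mu l * al /\ b l = mu l * be,
      forall l, par l1 l -> mu l != 0 & 0 < \sum_(l | par l1 l) mu l].
Proof.
move=> cm; have [al [be [u [v [g [ga gb uv]]]]]] := primitive_direction (horn_dir H l1).
have g0 : g != 0 by apply: contraTneq (horn_dir H l1) => g0; rewrite ga gb g0 !mul0r eqxx.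
pose mu l := u * a l + v * b l.
have muE l : par l1 l -> a l = mu l * al /\ b l = mu l * be.
  rewrite /par ga gb => /eqP e; have {}e : a l * be = al * b l.
    by apply: (mulfI g0); rewrite -mulrCA e mulrA.
  split; rewrite /mu -[LHS]mulr1 -uv.
    by rewrite mulrDr mulrDl; congr (_ + _); [ring|rewrite mulrCA e; ring].
  by rewrite mulrDr mulrDl; congr (_ + _); [rewrite -!mulrA e; ring|ring].
have mu0 l : par l1 l -> mu l != 0.
  move=> /muE[ea eb]; apply: contraTneq (horn_dir H l) => m0.
  by rewrite ea eb m0 !mul0r eqxx.
have M0 : \sum_(l | par l1 l) mu l != 0.
  rewrite -(intr_eq0 K) rmorph_sum /=; apply: contra_neq cm => M0.
  have m1 : (mu l1)%:~R != 0 :> K by rewrite intr_eq0 mu0 ?par_refl.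
  apply: (mulIf m1); rewrite mul0r -[RHS]M0 mulr_suml; apply: eq_bigr => l pl.
  have [ea eb] := muE l pl; have [ea1 eb1] := muE l1 (par_refl a b l1).
  have [la lb] := lamP H pl; move: la lb; rewrite ea eb ea1 eb1 !rmorphM /= !mulrA => la lb.
  have [n0|n0] : al%:~R != 0 :> K \/ be%:~R != 0 :> K.
  - rewrite !intr_eq0; apply/orP; apply: contraTT (horn_dir H l1).
    by rewrite !negb_or !negbK ga gb => /andP[/eqP-> /eqP->]; rewrite !mulr0 eqxx.
  - by apply: (mulIf n0); rewrite la.
  - by apply: (mulIf n0); rewrite lb.
case: (ltrP 0 (\sum_(l | par l1 l) mu l)) => Mp; first by exists al, be, mu.
exists (- al), (- be), (fun l => - mu l); split=> [l /muE[-> ->]|l /mu0|].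
- by rewrite !mulrNN.
- by rewrite oppr_eq0.
- by rewrite sumrN oppr_gt0 lt_neqAle M0.
Qed.

Variables (l1 l2 l3 : I) (al be : int) (mu : I -> int).
Hypotheses (n12 : ~~ par l1 l2) (n13 : ~~ par l1 l3) (n23 : ~~ par l2 l3).
Hypothesis cover : forall l, [\/ par l1 l, l = l2 | l = l3].
Hypothesis muE : forall l, par l1 l -> a l = mu l * al /\ b l = mu l * be.
Hypothesis mu0 : forall l, par l1 l -> mu l != 0.
Let M := \sum_(l | par l1 l) mu l.
Hypothesis M_gt0 : 0 < M.
Let MK : K := M%:~R.
Let MK0 : MK != 0. Proof. by rewrite intr_eq0 gt_eqF. Qed.
Let C1 : int := c l2 + c l3.

Lemma fan_split (V : Type) (idx : V) (op : Monoid.com_law idx) (f : I -> V) :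
  \big[op/idx]_l f l = op (\big[op/idx]_(l | par l1 l) f l) (op (f l2) (f l3)).
Proof.
have n : l3 != l2 by apply: contraNneq n23 => ->; apply: par_refl.
rewrite (bigID (par l1)) /=; congr (op _ _).
rewrite (bigD1 l2) //=; congr (op _ _); rewrite (bigD1 l3) ?n13 //= big1 ?Monoid.mulm1 // => l.
by case: (cover l) => [->|->|->] //; rewrite eqxx ?andbF.
Qed.

Let a3 : a l3 = - (M * al) - a l2.
Proof.
have := horn_suma H; rewrite fan_split.
rewrite (eq_bigr (fun l => mu l * al)) => [|l /muE[]//]; rewrite -mulr_suml -/M /=; lia.
Qed.
Let b3 : b l3 = - (M * be) - b l2.
Proof.
have := horn_sumb H; rewrite fan_split.
rewrite (eq_bigr (fun l => mu l * be)) => [|l /muE[]//]; rewrite -mulr_suml -/M /=; lia.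
Qed.

(** The extra index is the point s = 0: for a fixed ratio, h l2 and h l3 are multiples of their sum
    s. Lines outside the class get exponent 0. *)
Local Notation T := (I + 'I_1)%type.
Let r (t : T) : K :=
  if t is inl l then if par l1 l then C1%:~R + MK * (c l)%:~R / (mu l)%:~R else 0 else 0.
Let n (t : T) : int := if t is inl l then if par l1 l then mu l else 0 else - M.
Let g (t : T) : int := if t is inl l then if par l1 l then - c l else 0 else - C1.
Let R s : K := \prod_t (s - r t) ^ n t.
Let R2 s : K := \prod_t (s - r t) ^ g t.
Let ka : K := \prod_(l | par l1 l) (- (mu l)%:~R / MK) ^ mu l.
Let kc : K := \prod_(l | par l1 l) (- (mu l)%:~R / MK) ^ (- c l).

(** As the a and the b sum to 0, h l2 + h l3 is [C1] - [M] (al p + be q) and depends on the class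
    direction alone. *)
Lemma fan_lines p q l : par l1 l ->
  h l p q = - (mu l)%:~R / MK * (h l2 p q + h l3 p q - r (inl l)).
Proof.
move=> pl; have [ea eb] := muE pl; have m0 : (mu l)%:~R != 0 :> K by rewrite intr_eq0 mu0.
rewrite /r pl /line ea eb a3 b3 /C1 !rmorphB !rmorphN !rmorphD !rmorphM /= -/MK; field.
exact/andP.
Qed.

Lemma prod_points (m : I -> int) (j : int) s :
  \prod_(t : T) (s - r t) ^ (if t is inl l then if par l1 l then m l else 0 else j) =
  (\prod_(l | par l1 l) (s - r (inl l)) ^ m l) * s ^ j.
Proof.
rewrite big_sumType big_ord1 /= subr0; congr (_ * _); rewrite [RHS]big_mkcond.
by apply: eq_bigr => l _; case: (par l1 l); rewrite ?expr0z.
Qed.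

Lemma prod_par (m : I -> int) (p q s : K) : h l2 p q + h l3 p q = s ->
  \prod_(l | par l1 l) h l p q ^ m l =
  (\prod_(l | par l1 l) (- (mu l)%:~R / MK) ^ m l) * \prod_(l | par l1 l) (s - r (inl l)) ^ m l.
Proof.
by move=> hs; rewrite -big_split; apply: eq_bigr => l pl; rewrite fan_lines // hs expfzMl.
Qed.

(** The ratio X = h l2 / h l3 and the sum s serve as coordinates. The class depends on s alone, and
    s enters x and y only through [R s]. *)
Lemma fan_point s X : X != 0 -> 1 + X != 0 -> (forall t, n t != 0 -> s != r t) ->
  exists p q, [/\ off_lines a b c p q,
    h l2 p q = s * X / (1 + X) /\ h l3 p q = s / (1 + X),
    \prod_l h l p q ^ a l = X ^ a l2 * (ka * (1 + X) ^ M * R s) ^ al,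
    \prod_l h l p q ^ b l = X ^ b l2 * (ka * (1 + X) ^ M * R s) ^ be &
    \prod_l h l p q ^ (- c l) = kc * X ^ (- c l2) * (1 + X) ^ C1 * R2 s].
Proof.
move=> X0 X1 off.
have s0 : s != 0 by apply: (off (inr ord0)); rewrite /= oppr_eq0 gt_eqF.
have offp l : par l1 l -> s != r (inl l).
  by move=> pl; apply: off; rewrite /= pl mu0.
have [p [q [h2 h3]]] := solve2 c (s * X / (1 + X)) (s / (1 + X)) n23.
have hs : h l2 p q + h l3 p q = s by rewrite h2 h3; field.
have h3n : h l3 p q != 0 by rewrite h3 mulf_neq0 ?invr_eq0.
have h2E : h l2 p q = X * h l3 p q by rewrite h2 h3; ring.
have key (w w2 : int) (f : I -> int) : (forall l, par l1 l -> f l = mu l * w) -> f l2 = w2 ->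
    f l3 = - (M * w) - w2 -> \prod_l h l p q ^ f l = X ^ w2 * (ka * (1 + X) ^ M * R s) ^ w.
  move=> fE f2 f3; rewrite fan_split (eq_bigr (fun l => (h l p q ^ mu l) ^ w)) => [|l pl]; last first.
    by rewrite fE // exprz_exp.
  rewrite -(big_morph (fun x : K => x ^ w) (fun x y => expfzMl x y w) (exp1rz _ w)) /=.
  rewrite (prod_par _ hs) -/ka f2 f3 h2E (expfzMl X) -(mulrA (X ^ _)) -expfzDr //.
  have -> : w2 + (- (M * w) - w2) = - M * w by ring.
  rewrite -exprz_exp h3 mulrCA -expfzMl; congr (_ * _ ^ _).
  rewrite /R prod_points (expfzMl s) exprz_inv opprK; ring.
exists p, q; split.
- move=> l; case: (cover l) => [pl|->|->] //.
    rewrite fan_lines // hs mulf_neq0 ?subr_eq0 ?offp // mulf_neq0 ?invr_eq0 //.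
    by rewrite oppr_eq0 intr_eq0 mu0.
  by rewrite h2E mulf_neq0.
- by [].
- by apply: key => [l /muE[]||].
- by apply: key => [l /muE[]||].
rewrite fan_split /= (prod_par _ hs) -/kc h2E (expfzMl X) -(mulrA (X ^ _)) -expfzDr //.
have -> : - c l2 - c l3 = - C1 by rewrite /C1; ring.
rewrite /R2 prod_points h3 (expfzMl s) exprz_inv opprK /=; ring.
Qed.

Lemma sum_points (m : I -> int) (j : int) :
  \sum_(t : T) (if t is inl l then if par l1 l then m l else 0 else j) =
  \sum_(l | par l1 l) m l + j.
Proof. by rewrite big_sumType big_ord1 /= [in RHS]big_mkcond. Qed.

(* On the line h l2 = h l3 both monomials depend on s only through R s, so R
   is injective. *)
Lemma fan_exponents : exists r1 r2, r1 != r2 /\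
  forall x, \sum_(t | r t == x) n t = (x == r1)%:Z - (x == r2)%:Z.
Proof.
apply: injective_exponents => [|s s' off off' e]; first by rewrite sum_points subrr.
have X1 : 1 + 1 != 0 :> K by rewrite -(natrD _ 1 1) pnatr_eq0.
have [p [q [U [h2 h3] pa pb _]]] := fan_point (oner_neq0 K) X1 off.
have [p' [q' [U' [h2' h3'] pa' pb' _]]] := fan_point (oner_neq0 K) X1 off'.
have [] := horn_inj H U U'; first by rewrite pa pa' /R e.
  by rewrite pb pb' /R e.
move=> ep eq; subst p' q'; move: h3'; rewrite h3 => /(congr1 (fun x => x * (1 + 1))).
by rewrite !divfK.
Qed.

Let e := \sum_l c l.

(** Every index satisfies M g = (C1 - r) n, so the grouped exponents of [R2] vanish wherever those
    of [R] do, that is off one zero and one pole. As [g] sums to - e, the pole is [r1] - M e. *)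
Lemma fan_shape : exists r1 (j : int), MK * j%:~R = C1%:~R - r1 /\
  forall s, (forall t, s != r t) -> s != r1 -> s != r1 - MK * e%:~R ->
    R s = (s - r1) / (s - (r1 - MK * e%:~R)) /\
    R2 s = (s - r1) ^ j * (s - (r1 - MK * e%:~R)) ^ (- j - e).
Proof.
have [r1 [r2 [r12 N]]] := fan_exponents.
have G x : MK * (\sum_(t | r t == x) g t)%:~R = (C1%:~R - x) * (\sum_(t | r t == x) n t)%:~R.
  rewrite !rmorph_sum /= !mulr_sumr; apply: eq_bigr => -[l|o] /eqP <- /=; last first.
    by rewrite /MK !rmorphN /=; ring.
  case pl: (par l1 l); last by rewrite !mulr0.
  have m0 : (mu l)%:~R != 0 :> K by rewrite intr_eq0 mu0.
  by rewrite rmorphN /=; field.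
pose j1 := \sum_(t | r t == r1) g t; pose j2 := \sum_(t | r t == r2) g t.
have E1 : MK * j1%:~R = C1%:~R - r1 by rewrite G N eqxx (negPf r12) subr0 mulr1.
have E2 : MK * j2%:~R = r2 - C1%:~R.
  by rewrite G N eqxx eq_sym (negPf r12) sub0r rmorphN mulrN1 opprB.
have Eg x : \sum_(t | r t == x) g t = (x == r1)%:Z * j1 + (x == r2)%:Z * j2.
  case: (eqVneq x r1) => [->|x1]; first by rewrite (negPf r12) mul1r mul0r addr0.
  case: (eqVneq x r2) => [->|x2]; first by rewrite mul1r mul0r add0r.
  have := G x; rewrite N (negPf x1) (negPf x2) subrr mulr0 => /eqP.
  by rewrite mulf_eq0 (negPf MK0) intr_eq0 => /eqP ->; rewrite !mul0r addr0.
have [sg pg] := two_points Eg.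
have [_ pn] : \sum_t n t = 1 + -1 /\ forall s, (forall t, s != r t) -> s != r1 -> s != r2 ->
    \prod_t (s - r t) ^ n t = (s - r1) ^ 1 * (s - r2) ^ -1.
  by apply: two_points => x; rewrite N mulr1 mulrN1.
have j2E : j2 = - j1 - e.
  have aux (S A x y : int) : - S - A = x + y -> y = - x - (S + A) by lia.
  by move: sg; rewrite sum_points sumrN /e fan_split /=; apply: aux.
have r2E : r2 = r1 - MK * e%:~R.
  have -> : r2 = MK * j2%:~R + C1%:~R by rewrite E2 subrK.
  have -> : r1 = C1%:~R - MK * j1%:~R by rewrite E1; ring.
  by rewrite j2E rmorphB rmorphN /=; ring.
exists r1, j1; split=> // s off s1; rewrite -r2E => s2.
by rewrite /R pn // /R2 pg // j2E expr1z exprN1.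
Qed.

(** From R = (s - r1) / (s - r2) and Y = - (1 + X)^M R, the sum (1 + X)^M + Y is a constant multiple
    of (1 + X)^M / (s - r2): this produces the second factor of the normal form. The [v t] are the
    values of Y / (1 + X)^M to be avoided, where s could meet a point [r t]. *)
Lemma fan_generic : exists (r0 : K) (v : T -> K) (j A : int), r0 != 0 /\
  forall X Y, X != 0 -> 1 + X != 0 -> Y != 0 -> (1 + X) ^ M + Y != 0 ->
    (forall t, Y != v t * (1 + X) ^ M) ->
  exists p q, [/\ off_lines a b c p q, h l2 p q / h l3 p q = X,
    - (1 + h l2 p q / h l3 p q) ^ M * R (h l2 p q + h l3 p q) = Y &
    [/\ \prod_l h l p q ^ a l = (- ka) ^ al * (X ^ a l2 * Y ^ al),
        \prod_l h l p q ^ b l = (- ka) ^ be * (X ^ b l2 * Y ^ be) &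
        \prod_l h l p q ^ (- c l) =
          r0 * (X ^ (- c l2) * Y ^ j) * ((1 + X) ^ A * ((1 + X) ^ M + Y) ^ e)]].
Proof.
have [r1 [j [_ shape]]] := fan_shape.
have e0 : e%:~R != 0 :> K by rewrite intr_eq0 gt_eqF // (csum_gt0 H).
set r2 := r1 - MK * e%:~R in shape.
have Me0 : MK * e%:~R != 0 by rewrite mulf_neq0.
exists (kc * (-1) ^ j * (MK * e%:~R) ^ (- e)), (fun t => MK * e%:~R / (r t - r2) - 1), j, (C1 - M * j - M * e).
split.
  rewrite !mulf_neq0 ?expfz_neq0 ?oppr_eq0 ?oner_neq0 //.
  by apply/prodf_neq0 => l pl; rewrite expfz_neq0 // mulf_neq0 ?invr_eq0 // oppr_eq0 intr_eq0 mu0.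
move=> X Y X0 X1 Y0 D0 vY.
have [Q [QE Q0]] : exists Q, Q = (1 + X) ^ M /\ Q != 0 by exists ((1 + X) ^ M); rewrite expfz_neq0.
rewrite -QE in D0 vY.
(* The solution of Y = - Q (s - r1) / (s - r2). *)
pose s := r2 + MK * e%:~R * Q / (Q + Y).
have s2E : s - r2 = MK * e%:~R * Q / (Q + Y) by rewrite /s addrC addKr.
have s1E : s - r1 = - (MK * e%:~R) * Y / (Q + Y).
  by rewrite /s /r2; field.
have s2 : s != r2 by rewrite -subr_eq0 s2E !mulf_neq0 ?invr_eq0.
have s1 : s != r1 by rewrite -subr_eq0 s1E !mulf_neq0 ?invr_eq0 ?oppr_eq0.
have off t : s != r t.
  apply: contra_neq (vY t) => st; rewrite -st s2E; field.
  by rewrite e0 Q0 MK0 D0.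
have [p [q [U [h2 h3] pa pb pc]]] := fan_point X0 X1 (fun t _ => off t).
have [RE R2E] := shape s off s1 s2.
have s0 : s != 0 by apply: (off (inr ord0)).
have hX : h l2 p q / h l3 p q = X by rewrite h2 h3; field; rewrite X1.
have hs : h l2 p q + h l3 p q = s by rewrite h2 h3; field.
have RY : R s = - (Y / Q) by rewrite RE -/r2 s1E s2E; field; rewrite e0 Q0 MK0 D0.
exists p, q; split=> //.
  by rewrite hX hs -QE RY; field.
have kaY : ka * (1 + X) ^ M * R s = - ka * Y by rewrite RY -QE; field.
rewrite pa pb pc kaY !(expfzMl (- ka)); split; [ring|ring|].
have := two_point_monomial M j e C1 Me0 Y0 D0 X1; rewrite -QE => E.
rewrite R2E -/r2 s1E s2E -[LHS]mulrA E; ring.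
Qed.

Lemma fan_equiv : exists m n k : nat, [/\ (1 <= n)%N, (1 <= k)%N &
  poly_equiv F (('X_o0 + 'X_o2) ^+ m * (('X_o0 + 'X_o2) ^+ k + 'X_o1 * 'X_o2 ^+ (k - 1)) ^+ n)].
Proof.
have [r0 [v [j [A [r00 gen]]]]] := fan_generic.
have e_gt0 := csum_gt0 H.
have [n' En] : exists n : nat, e = n%:Z by exists (absz e); rewrite gez0_abs // ltW.
have [k Ek] : exists k : nat, M = k%:Z by exists (absz M); rewrite gez0_abs // ltW.
have n1 : (1 <= n')%N by rewrite -ltz_nat -En.
have k1' : (1 <= k)%N by rewrite -ltz_nat -Ek.
rewrite Ek En in gen.
have ka0 : ka != 0.
  by apply/prodf_neq0 => l pl; rewrite expfz_neq0 // mulf_neq0 ?invr_eq0 // oppr_eq0 intr_eq0 mu0.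
(* Since F is a polynomial, it stays finite at Y = 1 as t = 1 + X tends to 0. The other factors have
   nonzero limits, so t^A has no pole. *)
have A_ge0 : 0 <= A.
  have cz z : cofin (fun t : K => 1 != z * t ^ k).
    exists (1 - z *: 'X^k) => [|t].
      apply/eqP => /(congr1 (horner^~ 0)); rewrite horner0 hornerD hornerC hornerN hornerZ hornerXn.
      by rewrite -(prednK k1') exprS mul0r mulr0 subr0 => /eqP; rewrite oner_eq0.
    by rewrite hornerD hornerC hornerN hornerZ hornerXn subr_eq0.
  pose x w ww (t : K) := w * ((t - 1) ^ ww * 1) : K.
  have xl w ww : lim0 (x w ww) (w * ((-1) ^ ww * 1)).
    have L : lim0 (fun t : K => t - 1) (-1).
      by apply: lim0_eq (lim0_affine 1 (-1)); apply: cofin_all => t; rewrite mul1r.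
    have N1 : -1 != 0 :> K by rewrite oppr_eq0 oner_eq0.
    exact: lim0M (lim0_cst w) (lim0M (lim0Xz ww N1 L) (lim0_cst 1)).
  pose P (t : K) i := pt (x (k1 * (- ka) ^ al) (a l2) t) (x (k2 * (- ka) ^ be) (b l2) t) i.
  have Pl i : lim0 (fun t => P t i) (pt (k1 * (- ka) ^ al * ((-1) ^ a l2 * 1)) (k2 * (- ka) ^ be * ((-1) ^ b l2 * 1)) i).
    by elim/ord3P: i; rewrite /P /pt /=; [apply: xl|apply: xl|apply: lim0_cst].
  pose u (t : K) := x (k3 * r0) (- c l2) t * (t ^+ k + 1) ^+ n'.
  have ul : lim0 u (k3 * r0 * ((-1) ^ (- c l2) * 1) * (0 ^+ k + 1) ^+ n').
    exact: lim0M (xl _ _) (lim0X n' (lim0D (lim0X k (lim0_id K)) (lim0_cst 1))).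
  have u0 : k3 * r0 * ((-1) ^ (- c l2) * 1) * (0 ^+ k + 1) ^+ n' != 0.
    rewrite -(prednK k1') exprS mul0r add0r expr1n !mulr1 !mulf_neq0 ?(horn_k3 H) //.
    by rewrite expfz_neq0 // oppr_eq0 oner_eq0.
  have [] := lim0_order (z := A) (lim0_meval F Pl) ul u0 => //.
  apply: cofin_sub2 (cofinI (cofin_neq 0) (cofin_neq 1)) (cofinI (cz (-1)) (cofin_forall (fun t => cz (v t)))) => t [t0 t1] [c1 cv].
  have tX : t - 1 != 0 by rewrite subr_eq0.
  have tE : 1 + (t - 1) = t by rewrite addrC subrK.
  have [||||p [q [U _ _ [pa pb pc]]]] := gen (t - 1) 1 tX; rewrite ?tE ?oner_neq0 //.
    by apply: contra_neq c1 => /eqP; rewrite addr_eq0 => /eqP ->; rewrite mulN1r opprK.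
  have [e1 _ _] := horn_eq H U; move: e1.
  rewrite pa pb pc tE !exp1rz => e1.
  have PE : F.@[fun i => P t i] = t ^ A * u t.
    transitivity (F.@[pt (k1 * ((- ka) ^ al * ((t - 1) ^ a l2 * 1))) (k2 * ((- ka) ^ be * ((t - 1) ^ b l2 * 1)))]).
      by apply: meval_eq => i; rewrite /P /x !mulrA.
    by rewrite e1 /u /x -[t ^+ k]/(t ^ k%:Z); rewrite -[_ ^ n'%:Z]/(_ ^+ n'); ring.
  exact: PE.
have [m Em] : exists m : nat, A = m%:Z by exists (absz A); rewrite gez0_abs.
exists m, n', k; split=> //.
apply: (@horn_equiv K F I a b c k1 k2 k3 H d (1 * m + k * n')%N _
  (fun p q => h l2 p q / h l3 p q) (fun p q => - (1 + h l2 p q / h l3 p q) ^ M * R (h l2 p q + h l3 p q))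
  (a l2) (b l2) al be (- c l2) j ((- ka) ^ al) ((- ka) ^ be) r0) => //.
- have X i : 'X_i \is [in K[3], 1.-homog] by rewrite dhomogX /= mdeg1.
  apply: dhomogM; first by apply: dhomogMn; rewrite rpredD.
  apply: dhomogMn; apply: rpredD.
    by have := dhomogMn k (rpredD (X o0) (X o2)); rewrite mul1n.
  by have := dhomogM (X o1) (dhomogMn (k - 1) (X o2)); rewrite mul1n subnKC.
- by rewrite addn_gt0 !muln_gt0 k1' n1 orbT.
- by rewrite expfz_neq0 // oppr_eq0.
- by rewrite expfz_neq0 // oppr_eq0.
apply: cofin_sub2 (cofin_neq 0) (cofin_neq (-1)) => X X0 X1.
have X1' : 1 + X != 0 by rewrite addrC -[1]opprK subr_eq0.
have cv : cofin (fun Y => forall t, Y != v t * (1 + X) ^ k) by apply: cofin_forall => t; apply: cofin_neq.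
apply: cofin_sub2 (cofinI (cofin_neq 0) (cofin_neq (- (1 + X) ^ k))) cv => Y [Y0 Y1] vY.
have [|p [q [U XE YE [pa pb pc]]]] := gen X Y X0 X1' Y0 _ vY.
  by rewrite addrC -[_ ^ _]opprK subr_eq0.
exists p, q; split=> //; first by rewrite Ek.
split=> //; rewrite pc; congr (_ * _).
rewrite Em mevalM !rmorphXn /= !mevalD mevalM !rmorphXn /= !mevalD !mevalXU /pt /= expr1n mulr1.
by rewrite (addrC X).
Qed.

End EndFan.

Lemma cremona_classification (K : numClosedFieldType) (d : nat) (F : {mpoly K[3]}) :
  F \is d.-homog -> toric_polar_cremona F ->
  [\/ exists a b : nat, [/\ (1 <= a)%N, (1 <= b)%N &
        poly_equiv F (('X_o0 + 'X_o2) ^+ a * ('X_o1 + 'X_o2) ^+ b)],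
      exists a b e : nat, [/\ (1 <= b)%N, (1 <= e)%N &
        poly_equiv F (('X_o0 + 'X_o2) ^+ a *
          (('X_o0 + 'X_o2) ^+ e + 'X_o1 * 'X_o2 ^+ (e - 1)) ^+ b)] |
      exists e : nat, (1 <= e)%N /\ poly_equiv F (conic K ^+ e)].
Proof.
move=> hF /(horn_uniformisation hF) [I [a [b [c [k1 [k2 [k3 H]]]]]]].
case: (horn_structure H) => [four|six|[l1 [l2 [l3 [[n12 n13 n23] cover cm]]]]].
- exact/Or31/(four_equiv hF H).
- exact/Or33/(six_equiv hF H).
have [al [be [mu [muE mu0 M0]]]] := fan_direction H cm.
exact/Or32/(fan_equiv hF H n12 n13 n23 cover muE mu0 M0).
Qed.

Theorem theorem1 (R : realType) (d : nat) (F : {mpoly R[i][3]})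
    (hF : F \is d.-homog) (hcr : toric_polar_cremona F) :
  let x : {mpoly R[i][3]} := 'X_0 in
  let y : {mpoly R[i][3]} := 'X_1 in
  let z : {mpoly R[i][3]} := 'X_2 in
  (exists a b : nat, [/\ (1 <= a)%N, (1 <= b)%N &
     poly_equiv F ((x + z) ^+ a * (y + z) ^+ b)]) \/
  (exists a b e : nat, [/\ (1 <= b)%N, (1 <= e)%N &
     poly_equiv F ((x + z) ^+ a * ((x + z) ^+ e + y * z ^+ (e - 1)) ^+ b)]) \/
  (exists e : nat, (1 <= e)%N /\
     poly_equiv F
       ((x ^+ 2 + y ^+ 2 + z ^+ 2 - 2 * (x * y + x * z + y * z)) ^+ e)).
Proof.
have [e0 e1 e2] := ord3E; rewrite e2 e1 e0.
case: (cremona_classification hF hcr) => h; [by left|by right; left|].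
by right; right; move: h; rewrite /conic.
Qed.
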